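(* Let $q\ge0$ be an integer and let $J_q$ be the Bessel function of the first kind of order $q$. Let $0<z_1<z_2<\cdots$ be the positive zeros of $\frac{d}{dz}J_q$ and $z_{-k}=-z_k$ for $k\ge1$. Then for every $z\in\mathbb{C}$ with $\frac{d}{dz}J_q(z)\neq0$, $$J_q(z)=\frac{A^{(0,num)}(z)+\sum_{k=-\infty,\,k\ne0}^{\infty}\frac{a_{-1}^{(k,num)}}{z-z_k}}{A^{(0,den)}(z)+\sum_{k=-\infty,\,k\ne0}^{\infty}\frac{a_{-1}^{(k,den)}}{z-z_k}},$$ where for $k\ne0$ $$a_{-1}^{(k,num)}=\left.\frac{J_q(z)}{\frac{d^2}{dz^2}J_q(z)}\right|_{z=z_k}=\frac{4J_q(z_k)}{J_{q-2}(z_k)-2J_q(z_k)+J_{q+2}(z_k)},$$ $$a_{-1}^{(k,den)}=\left.\frac{1}{\frac{d^2}{dz^2}J_q(z)}\right|_{z=z_k}=\frac{4}{J_{q-2}(z_k)-2J_q(z_k)+J_{q+2}(z_k)},$$ and $$A^{(0,num)}(z)=\begin{cases}-\frac{2}{z}, & q=0,\\ 0, & q\ge1,\end{cases}\qquad A^{(0,den)}(z)=\begin{cases}-\frac{2}{z}, & q=0,\\ 0, & q=1,\\ \sum_{n=1}^{q-1}\frac{a_{-n}^{(0,den)}}{z^n}, & q\ge2,\end{cases}$$ with $a_{-n}^{(0,den)}$ the coefficient of $z^{-n}$ in the Laurent expansion about $z=0$ of $1/\frac{d}{dz}J_q(z)$.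
   Context: Bi-infinite sums are understood as limits of symmetric partial sums, $\sum_{k=-\infty,k\neq0}^\infty=\lim_{N\to\infty}\sum_{1\le|k|\le N}$. Bessel functions of negative integer order are given by $J_{-n}=(-1)^nJ_n$. *)

(* Defs.v *)
From Stdlib Require Import Reals ZArith.
From Coquelicot Require Import Coquelicot.

Local Open Scope C_scope.

(** [Series] is real-valued; the sum of a complex series is taken componentwise. *)
Definition CSeries (a : nat -> C) : C :=
  (Series (fun m => Re (a m)), Series (fun m => Im (a m))).

(** [J_n(z) = sum_m (-1)^m / (m! (m+n)!) (z/2)^(2m+n)] for a natural order [n]. *)
Definition BesselJ_nat (n : nat) (z : C) : C :=
  CSeries (fun m =>
    (- (1)) ^ m / (INR (fact m) * INR (fact (m + n))) * (z / 2) ^ (2 * m + n)).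

(** Integer order, with [J_(-n) = (-1)^n J_n]. *)
Definition BesselJ (n : Z) (z : C) : C :=
  if (0 <=? n)%Z then BesselJ_nat (Z.to_nat n) z
  else (- (1)) ^ Z.to_nat (- n) * BesselJ_nat (Z.to_nat (- n)) z.

(** [C_derive] is a total operator which returns the complex derivative wherever
    the function is complex differentiable; Bessel functions of integer order
    are entire. *)
Definition dJ (q : Z) : C -> C := C_derive (BesselJ q).
Definition ddJ (q : Z) : C -> C := C_derive (dJ q).

(** [S] is the limit as [N -> oo] of the sums of [f k] over [1 <= |k| <= N]. *)
Definition is_bisum (f : Z -> C) (S : C) : Prop :=
  filterlim
    (fun N : nat =>
       sum_n_m (fun k : nat => f (Z.of_nat k) + f (- Z.of_nat k)%Z) 1 N)
    eventually (locally S).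

(** [sum_(n in Z) c n z^n] is the Laurent expansion of [f] about [0]: its regular
    and principal parts both converge, with total [f z], on a punctured disc. *)
Definition is_laurent0 (f : C -> C) (c : Z -> C) : Prop :=
  exists r : R, (0 < r)%R /\
  forall z : C, (0 < Cmod z < r)%R ->
  exists u v : C,
    is_series (V := C_NormedModule) (fun n => c (Z.of_nat n) * z ^ n) u /\
    is_series (V := C_NormedModule)
      (fun n => c (- Z.of_nat (S n))%Z / z ^ S n) v /\
    f z = u + v.

(** The coefficient of [z^n]; [iota] selects the unique value satisfying the
    predicate (Laurent expansions on a punctured disc are unique). *)
Definition laurent0_coef (f : C -> C) (n : Z) : C :=
  iota (T := C_CompleteNormedModule)
    (fun a => exists c : Z -> C, is_laurent0 f c /\ c n = a).

(** Residues of [J_q / J_q'] and [1 / J_q'] at the simple zero [x] of [J_q']. *)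
Definition a_num (q : Z) (x : C) : C := BesselJ q x / ddJ q x.
Definition a_den (q : Z) (x : C) : C := 1 / ddJ q x.

Definition A0_num (q : nat) (w : C) : C :=
  match q with
  | O => - (2 / w)
  | S _ => 0
  end.

Definition A0_den (q : nat) (w : C) : C :=
  match q with
  | O => - (2 / w)
  | S O => 0
  | S (S _) =>
      sum_n_m (fun n : nat =>
        laurent0_coef (fun s => 1 / dJ (Z.of_nat q) s) (- Z.of_nat n)%Z / w ^ n)
        1 (q - 1)
  end.

(* Main.v *)
Require Import Defs.
From Stdlib Require Import Reals ZArith Lra Lia Psatz.
From Coquelicot Require Import Coquelicot.

(** The expansions are Mittag-Leffler expansions.  For a numerator [n] equal to [J] or [1], removing from
    [n / J'] its principal parts at the zeros of [J'] inside a square with vertices [X (+-1 +- i)] leaves a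
    function holomorphic there, and Cauchy's formula bounds it at [w] by an integral of [n / J'] over the
    square.  Take [X] to be a zero of [J] between two consecutive zeros of [J'].

    On the vertical sides [J'' + J] is of size [(|J| + |J'|) / X], so [J] grows from its zero [X] like
    [sinh]: there [|J| <= sqrt 2 |J'|] and [|J'|] is at least of order [X^(-1/2) exp |Im z|], the amplitude of
    [J'(X)] being controlled by a Sonine-type energy.  On the horizontal sides one integrates Bessel's
    equation along rays [z = T e] issuing from 0: [- Im (conj e z J' conj J)] is increasing in [T] and
    grows like [exp (2 Im z)].  The same monotone quantity shows that [J'] has only real zeros.

    Hence [1 / J'] contributes [O(X^(-1/2))].  The function [J / J'] is only bounded, but it is odd, and
    subtracting Cauchy's formulas at [w] and [- w] gives the kernel [2 w / (z^2 - w^2)] and [O(1 / X)]. *)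

(** * Complex derivatives and continuity *)

Local Open Scope C_scope.

(** The obstacle is a lower bound for [J'] on the whole contour. It is drawn from the differential
    equation: each estimate is the monotonicity of a quadratic form in [J] and [J'] whose derivative
    Bessel's equation signs, up to small errors. Starting a vertical side at a zero of [J] makes the
    mixed term of [J] and its derivative along the side start at 0 and stay nonnegative, so no
    decaying component can cancel the growth. A horizontal side offers no such starting point, but
    every ray issuing from 0 does, since the form used there vanishes at the origin. Poles are
    removed algebraically: functions are given by power series, each root is divided out on the
    coefficients, and what remains is a quotient of entire functions, regular on a slightly larger
    square. Cauchy's formula for holomorphic functions then does the work of residues. It is
    obtained by deformation, and its constant [kappa], being nonzero, is divided out at the end. The
    Laurent coefficients in [A0_den], defined by selection, are identified through uniqueness with
    those of a long division. *)

Lemma filterlim_Cmod {T : Type} (F : (T -> Prop) -> Prop) {FF : Filter F}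
  (f : T -> C) (l : C) :
  filterlim f F (locally (T := C_UniformSpace) l) <->
  forall eps : R, (0 < eps)%R -> F (fun x => (Cmod (f x - l) < eps)%R).
Proof.
split.
- intros H eps He.
  (* Balls of [C_UniformSpace] are componentwise; passing to [Cmod] costs a factor [sqrt 2 <= 2]. *)
  assert (He2 : (0 < eps / 2)%R) by lra.
  apply (H (fun y => Cmod (y - l) < eps)%R).
  exists (mkposreal _ He2). intros y Hy.
  apply C_NormedModule_mixin_compat2 in Hy. simpl in Hy.
  unfold minus, plus, opp in Hy; simpl in Hy.
  apply Rlt_le_trans with (1 := Hy).
  assert (sqrt 2 <= 2)%R.
  { rewrite <- (sqrt_Rsqr 2) at 2 by lra. apply sqrt_le_1_alt. unfold Rsqr; lra. }
  nra.
- intros H P [eps HP].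
  unfold filtermap. generalize (H eps (cond_pos eps)). apply filter_imp.
  intros x Hx. apply HP. now apply C_NormedModule_mixin_compat1.
Qed.

Lemma C_eq_Re_Im (a b : C) : Re a = Re b -> Im a = Im b -> a = b.
Proof. destruct a, b. simpl. now intros -> ->. Qed.

Section ContinuousC.
Context {U : UniformSpace}.
Implicit Types f g : U -> C.

Lemma continuous_Re f x : continuous (U := C_UniformSpace) f x -> continuous (fun y => Re (f y)) x.
Proof. intros H. apply (continuous_comp f Re); [exact H | apply (continuous_fst (U := R_UniformSpace) (V := R_UniformSpace))]. Qed.

Lemma continuous_Im f x : continuous (U := C_UniformSpace) f x -> continuous (fun y => Im (f y)) x.
Proof. intros H. apply (continuous_comp f Im); [exact H | apply (continuous_snd (U := R_UniformSpace) (V := R_UniformSpace))]. Qed.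

Lemma continuous_pair {V W : UniformSpace} (a : U -> V) (b : U -> W) x :
  continuous a x -> continuous b x ->
  continuous (U := prod_UniformSpace V W) (fun y => (a y, b y)) x.
Proof.
intros Ha Hb. apply filterlim_locally. intros eps.
pose proof (proj1 (filterlim_locally _ _) Ha eps) as H1.
pose proof (proj1 (filterlim_locally _ _) Hb eps) as H2.
generalize (filter_and _ _ H1 H2). apply filter_imp. intros y [h1 h2]. now split.
Qed.

Lemma continuous_Cpair (a b : U -> R) x :
  continuous a x -> continuous b x ->
  continuous (U := C_UniformSpace) (fun y => (a y, b y) : C) x.
Proof. exact (continuous_pair a b x). Qed.

Lemma continuous_Cplus f g x :
  continuous (U := C_UniformSpace) f x -> continuous (U := C_UniformSpace) g x ->
  continuous (U := C_UniformSpace) (fun y => f y + g y) x.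
Proof. exact (continuous_plus (V := C_R_NormedModule) f g x). Qed.

Lemma continuous_Copp f x :
  continuous (U := C_UniformSpace) f x -> continuous (U := C_UniformSpace) (fun y => - f y) x.
Proof. exact (continuous_opp (V := C_R_NormedModule) f x). Qed.

Lemma continuous_Cminus f g x :
  continuous (U := C_UniformSpace) f x -> continuous (U := C_UniformSpace) g x ->
  continuous (U := C_UniformSpace) (fun y => f y - g y) x.
Proof. intros Hf Hg. apply continuous_Cplus; [|apply continuous_Copp]; easy. Qed.

Lemma continuous_Cmult f g x :
  continuous (U := C_UniformSpace) f x -> continuous (U := C_UniformSpace) g x ->
  continuous (U := C_UniformSpace) (fun y => f y * g y) x.
Proof.
intros Hf Hg.
pose proof (continuous_Re _ _ Hf). pose proof (continuous_Im _ _ Hf).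
pose proof (continuous_Re _ _ Hg). pose proof (continuous_Im _ _ Hg).
apply continuous_Cpair.
- apply (continuous_minus (V := R_NormedModule)); apply (continuous_mult (K := R_AbsRing)); easy.
- apply (continuous_plus (V := R_NormedModule)); apply (continuous_mult (K := R_AbsRing)); easy.
Qed.

Lemma continuous_Cinv f x :
  continuous (U := C_UniformSpace) f x -> f x <> 0 ->
  continuous (U := C_UniformSpace) (fun y => / f y) x.
Proof.
intros Hf Hn.
pose proof (continuous_Re _ _ Hf) as H1. pose proof (continuous_Im _ _ Hf) as H2.
assert (Hd : continuous (fun y => Rinv (Re (f y) ^ 2 + Im (f y) ^ 2))%R x).
{ assert (Hs : forall a : U -> R, continuous a x -> continuous (fun y => a y ^ 2)%R x).
  { intros a Ha. apply (continuous_comp a (fun t => t ^ 2)%R); [exact Ha|].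
    apply (ex_derive_continuous (K := R_AbsRing) (V := R_NormedModule)). now auto_derive. }
  apply (continuous_comp (fun y => Re (f y) ^ 2 + Im (f y) ^ 2)%R Rinv).
  - apply (continuous_plus (V := R_NormedModule)); now apply Hs.
  - apply (ex_derive_continuous (K := R_AbsRing) (V := R_NormedModule)). auto_derive.
    intros h. apply Hn. apply C_eq_Re_Im; simpl; nra. }
apply continuous_Cpair.
- apply (continuous_mult (K := R_AbsRing)); easy.
- apply (continuous_mult (K := R_AbsRing)); [apply (continuous_opp (V := R_NormedModule))|]; easy.
Qed.

Lemma continuous_Cdiv f g x :
  continuous (U := C_UniformSpace) f x -> continuous (U := C_UniformSpace) g x ->
  g x <> 0 -> continuous (U := C_UniformSpace) (fun y => f y / g y) x.
Proof. intros Hf Hg Hn. apply continuous_Cmult; [easy | now apply continuous_Cinv]. Qed.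

Lemma continuous_Cconst (c : C) x : continuous (U := C_UniformSpace) (fun _ : U => c) x.
Proof. apply continuous_const. Qed.

Lemma continuous_RtoC (a : U -> R) x :
  continuous a x -> continuous (U := C_UniformSpace) (fun y => RtoC (a y)) x.
Proof. intros H. apply continuous_Cpair; [easy | apply continuous_const]. Qed.

End ContinuousC.

Ltac Ccontinuity :=
  lazymatch goal with
  | |- continuous (fun _ => _ + _) _ => apply continuous_Cplus; Ccontinuity
  | |- continuous (fun _ => _ - _) _ => apply continuous_Cminus; Ccontinuity
  | |- continuous (fun _ => _ * _) _ => apply continuous_Cmult; Ccontinuity
  | |- continuous (fun x => x) _ => apply continuous_id
  | |- continuous (fun _ => _) _ => first [apply continuous_Cconst | idtac]
  | |- _ => idtac
  end.

Notation cont h z := (continuous (T := C_UniformSpace) (U := C_UniformSpace) h z).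
Definition Cder (h : C -> C) (z l : C) : Prop :=
  is_derive (K := C_AbsRing) (V := C_NormedModule) h z l.

Lemma cont_Cmod (h : C -> C) z :
  cont h z <-> forall eps, (0 < eps)%R -> exists d, (0 < d)%R /\
    forall k, (Cmod (k - z) < d -> Cmod (h k - h z) < eps)%R.
Proof.
unfold continuous. rewrite (filterlim_Cmod (locally (T := C_UniformSpace) z)). split; intros H eps He.
- destruct (H eps He) as [d Hd]. exists d. split; [apply cond_pos|].
  intros k Hk. apply Hd. now apply C_NormedModule_mixin_compat1.
- destruct (H eps He) as [d [Hd H']].
  assert (Hd2 : (0 < d / 2)%R) by lra.
  exists (mkposreal _ Hd2). intros k Hk. apply H'.
  apply C_NormedModule_mixin_compat2 in Hk. simpl in Hk.
  unfold minus, plus, opp in Hk; simpl in Hk.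
  apply Rlt_le_trans with (1 := Hk).
  assert (sqrt 2 <= 2)%R.
  { rewrite <- (sqrt_Rsqr 2) at 2 by lra. apply sqrt_le_1_alt. unfold Rsqr; lra. }
  nra.
Qed.

Lemma Cder_Cmod (h : C -> C) z l :
  Cder h z l <-> forall eps, (0 < eps)%R -> exists d, (0 < d)%R /\
    forall k, (Cmod (k - z) < d -> Cmod (h k - h z - l * (k - z)) <= eps * Cmod (k - z))%R.
Proof.
split.
- intros [_ H] eps He.
  destruct (H z (fun P HP => HP) (mkposreal _ He)) as [d Hd].
  exists d. split; [apply cond_pos|]. intros k Hk.
  specialize (Hd k Hk). simpl in Hd.
  replace (h k - h z - l * (k - z)) with
    (minus (minus (h k) (h z)) (scal (minus k z) l) : C); [exact Hd|].
  unfold minus, plus, opp, scal; simpl. unfold mult; simpl. ring.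
- intros H. split.
  + apply is_linear_scal_l.
  + intros x Hx.
    assert (x = z) as ->.
    { symmetry. apply is_filter_lim_locally_unique. exact Hx. }
    intros eps. destruct (H eps (cond_pos eps)) as [d [Hd H']].
    exists (mkposreal _ Hd). intros k Hk. specialize (H' k Hk).
    replace (h k - h z - l * (k - z)) with
      (minus (minus (h k) (h z)) (scal (minus k z) l) : C) in H'; [exact H'|].
    unfold minus, plus, opp, scal; simpl. unfold mult; simpl. ring.
Qed.

Lemma Cder_cont h z l : Cder h z l -> cont h z.
Proof.
intros H. apply cont_Cmod. intros eps He.
destruct (proj1 (Cder_Cmod _ _ _) H 1%R Rlt_0_1) as [d [Hd H']].
pose proof (Cmod_ge_0 l) as Hl.
exists (Rmin d (eps / (2 + Cmod l))). split.
- apply Rmin_pos; [easy|]. apply Rdiv_lt_0_compat; lra.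
- intros k Hk.
  assert (Hk1 := Rlt_le_trans _ _ _ Hk (Rmin_l _ _)).
  assert (Hk2 := Rlt_le_trans _ _ _ Hk (Rmin_r _ _)).
  specialize (H' k Hk1).
  replace (h k - h z) with ((h k - h z - l * (k - z)) + l * (k - z)) by ring.
  apply Rle_lt_trans with (1 := Cmod_triangle _ _). rewrite Cmod_mult.
  apply Rmult_lt_compat_r with (r := (2 + Cmod l)%R) in Hk2; [|lra].
  replace (eps / (2 + Cmod l) * (2 + Cmod l))%R with eps in Hk2 by (field; lra).
  pose proof (Cmod_ge_0 (k - z)). nra.
Qed.

Lemma Cder_ext h g z l : (forall x, h x = g x) -> Cder h z l -> Cder g z l.
Proof. intros H. now apply is_derive_ext. Qed.

Lemma Cder_const (c z : C) : Cder (fun _ => c) z 0.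
Proof. apply (is_derive_const (K := C_AbsRing) (V := C_NormedModule)). Qed.

Lemma Cder_id (z : C) : Cder (fun x => x) z 1.
Proof.
apply Cder_Cmod. intros eps He. exists 1%R. split; [lra|]. intros k _.
replace (k - z - 1 * (k - z)) with (RtoC 0) by ring. rewrite Cmod_0.
pose proof (Cmod_ge_0 (k - z)). nra.
Qed.

Lemma Cder_plus h g z a b : Cder h z a -> Cder g z b -> Cder (fun x => h x + g x) z (a + b).
Proof. exact (is_derive_plus (K := C_AbsRing) (V := C_NormedModule) h g z a b). Qed.

Lemma Cder_opp h z a : Cder h z a -> Cder (fun x => - h x) z (- a).
Proof. exact (is_derive_opp (K := C_AbsRing) (V := C_NormedModule) h z a). Qed.

Lemma Cder_minus h g z a b : Cder h z a -> Cder g z b -> Cder (fun x => h x - g x) z (a - b).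
Proof. exact (is_derive_minus (K := C_AbsRing) (V := C_NormedModule) h g z a b). Qed.

Lemma Cder_comp h g z a b : Cder h (g z) a -> Cder g z b -> Cder (fun x => h (g x)) z (a * b).
Proof.
intros Hh Hg. apply Cder_Cmod. intros eps He.
pose proof (Cmod_ge_0 a) as Ha. pose proof (Cmod_ge_0 b) as Hb.
set (e1 := (Rmin 1 (eps / (2 + Cmod a + Cmod b)))).
assert (He1 : (0 < e1)%R).
{ apply Rmin_pos; [lra|]. apply Rdiv_lt_0_compat; lra. }
assert (He1' : (e1 <= 1)%R) by apply Rmin_l.
assert (He1'' : (e1 * (2 + Cmod a + Cmod b) <= eps)%R).
{ pose proof (Rmin_r 1 (eps / (2 + Cmod a + Cmod b))) as h1. fold e1 in h1.
  apply Rmult_le_compat_r with (r := (2 + Cmod a + Cmod b)%R) in h1; [|lra].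
  replace (eps / (2 + Cmod a + Cmod b) * (2 + Cmod a + Cmod b))%R with eps in h1 by (field; lra).
  easy. }
destruct (proj1 (Cder_Cmod _ _ _) Hh e1 He1) as [d1 [Hd1 H1]].
destruct (proj1 (Cder_Cmod _ _ _) Hg e1 He1) as [d2 [Hd2 H2]].
pose proof (proj1 (cont_Cmod _ _) (Cder_cont _ _ _ Hg) d1 Hd1) as [d3 [Hd3 H3]].
exists (Rmin d2 d3). split; [now apply Rmin_pos|]. intros k Hk.
assert (Hk1 := Rlt_le_trans _ _ _ Hk (Rmin_l _ _)).
assert (Hk2 := Rlt_le_trans _ _ _ Hk (Rmin_r _ _)).
specialize (H1 (g k) (H3 k Hk2)). specialize (H2 k Hk1).
replace (h (g k) - h (g z) - a * b * (k - z)) with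
  ((h (g k) - h (g z) - a * (g k - g z)) + a * (g k - g z - b * (k - z))) by ring.
apply Rle_trans with (1 := Cmod_triangle _ _). rewrite Cmod_mult.
assert (H4 : (Cmod (g k - g z) <= (e1 + Cmod b) * Cmod (k - z))%R).
{ replace (g k - g z) with ((g k - g z - b * (k - z)) + b * (k - z)) by ring.
  apply Rle_trans with (1 := Cmod_triangle _ _). rewrite Cmod_mult. lra. }
pose proof (Cmod_ge_0 (k - z)).
assert (Cmod a * Cmod (g k - g z - b * (k - z)) <= Cmod a * (e1 * Cmod (k - z)))%R by nra.
assert (e1 * Cmod (g k - g z) <= e1 * ((e1 + Cmod b) * Cmod (k - z)))%R by nra.
assert (e1 * (e1 + Cmod b + Cmod a) * Cmod (k-z) <= eps * Cmod (k - z))%R.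
{ apply Rmult_le_compat_r; [easy|]. nra. }
lra.
Qed.

Lemma Cder_sqr z : Cder (fun x => x * x) z (2 * z).
Proof.
apply Cder_Cmod. intros eps He. exists eps. split; [lra|]. intros k Hk.
replace (k * k - z * z - 2 * z * (k - z)) with ((k - z) * (k - z)) by ring.
rewrite Cmod_mult. pose proof (Cmod_ge_0 (k - z)). nra.
Qed.

Lemma Cder_scal (c : C) h z a : Cder h z a -> Cder (fun x => c * h x) z (c * a).
Proof.
intros H. apply (Cder_comp (fun y => c * y) h z c a); [|easy].
apply Cder_Cmod. intros eps He. exists 1%R. split; [lra|]. intros k _.
replace (c * k - c * h z - c * (k - h z)) with (RtoC 0) by ring. rewrite Cmod_0.
pose proof (Cmod_ge_0 (k - h z)). nra.
Qed.

Lemma Cder_eq h (z a b : C) : Cder h z a -> a = b -> Cder h z b.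
Proof. now intros H <-. Qed.

(* Polarisation reduces products to squares. *)
Lemma Cder_mult h g z a b :
  Cder h z a -> Cder g z b -> Cder (fun x => h x * g x) z (a * g z + h z * b).
Proof.
intros Hh Hg.
apply (Cder_ext (fun x => / 4 * (((h x + g x) * (h x + g x)) - ((h x - g x) * (h x - g x))))).
{ intros x. field. }
eapply Cder_eq.
- apply Cder_scal. apply Cder_minus.
  + apply (Cder_comp (fun x => x * x) (fun x => h x + g x)); [apply Cder_sqr|].
    apply Cder_plus; eassumption.
  + apply (Cder_comp (fun x => x * x) (fun x => h x - g x)); [apply Cder_sqr|].
    apply Cder_minus; eassumption.
- simpl. field.
Qed.

Lemma Cder_Cinv (z : C) : z <> 0 -> Cder (fun x => / x) z (- / (z * z)).
Proof.
intros Hz. apply Cder_Cmod. intros eps He.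
assert (Hm := proj1 (Cmod_gt_0 z) Hz).
set (m := Cmod z) in *.
exists (Rmin (m / 2) (eps * m ^ 3 / 2)). split.
{ apply Rmin_pos; [lra|]. pose proof (pow_lt m 3 Hm). nra. }
intros k Hk.
assert (Hk1 := Rlt_le_trans _ _ _ Hk (Rmin_l _ _)).
assert (Hk2 := Rlt_le_trans _ _ _ Hk (Rmin_r _ _)).
assert (Hkm : (m / 2 < Cmod k)%R).
{ pose proof (Cmod_triangle k (z - k)) as h. replace (k + (z - k)) with z in h by ring.
  rewrite <- (Cmod_opp (z - k)) in h. replace (- (z - k)) with (k - z) in h by ring.
  fold m in h. lra. }
assert (Hk0 : k <> 0) by (apply Cmod_gt_0; lra).
replace (/ k - / z - - / (z * z) * (k - z)) with ((k - z) * (k - z) / (k * (z * z))) by (field; easy).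
rewrite Cmod_div by (repeat apply Cmult_neq_0; easy).
rewrite !Cmod_mult. fold m.
apply Rle_div_l. { apply Rlt_gt. apply Rmult_lt_0_compat; nra. }
pose proof (Cmod_ge_0 (k - z)).
apply Rle_trans with (Cmod (k - z) * (eps * m ^ 3 / 2))%R; [nra|].
replace (eps * Cmod (k - z) * (Cmod k * (m * m)))%R with
  (Cmod (k - z) * (eps * (m * m) * Cmod k))%R by ring.
apply Rmult_le_compat_l; [easy|].
replace (eps * m ^ 3 / 2)%R with (eps * (m * m) * (m / 2))%R by field.
apply Rmult_le_compat_l; [|lra]. repeat apply Rmult_le_pos; lra.
Qed.

Lemma Cder_div h g z a b :
  Cder h z a -> Cder g z b -> g z <> 0 ->
  Cder (fun x => h x / g x) z ((a * g z - h z * b) / (g z * g z)).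
Proof.
intros Hh Hg Hn.
eapply Cder_eq.
- apply Cder_mult; [eassumption|].
  apply (Cder_comp Cinv g); [now apply Cder_Cinv | eassumption].
- simpl. field. easy.
Qed.

Lemma Cder_unique h z a b : Cder h z a -> Cder h z b -> a = b.
Proof.
intros Ha Hb. rewrite <- (is_C_derive_unique h z a) by easy. now apply is_C_derive_unique.
Qed.

(** The bridge to real calculus: contour integrals and growth estimates alike differentiate real and
    imaginary parts along straight paths [a + t b]. *)
Lemma Cder_path h (a b : C) (t : R) l :
  Cder h (a + t * b) l ->
  is_derive (fun s : R => Re (h (a + s * b))) t (Re (l * b)) /\
  is_derive (fun s : R => Im (h (a + s * b))) t (Im (l * b)).
Proof.
intros H.
assert (Hc : forall eps : R, (0 < eps)%R -> exists d : posreal, forall k : R,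
  k <> 0%R -> (Rabs k < d)%R ->
  (Cmod ((h (a + (t + k)%R * b)%C - h (a + t * b)%C) / k - l * b)%C < eps)%R).
{ intros eps He.
  pose proof (Cmod_ge_0 b) as Hb.
  destruct (proj1 (Cder_Cmod _ _ _) H (eps / (2 * (1 + Cmod b)))%R) as [d [Hd H']].
  { apply Rdiv_lt_0_compat; lra. }
  assert (Hd' : (0 < d / (1 + Cmod b))%R) by (apply Rdiv_lt_0_compat; lra).
  exists (mkposreal _ Hd'). intros k Hk0 Hk. simpl in Hk.
  assert (Hkc : RtoC k <> 0) by (intros h0; apply RtoC_inj in h0; easy).
  specialize (H' (a + (t + k)%R * b)).
  replace (a + (t + k)%R * b - (a + t * b)) with (k * b) in H' by (rewrite RtoC_plus; ring).
  rewrite Cmod_mult, Cmod_R in H'.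
  assert (Hk1 : (Rabs k * Cmod b < d)%R).
  { apply Rmult_lt_compat_r with (r := (1 + Cmod b)%R) in Hk; [|lra].
    replace (d / (1 + Cmod b) * (1 + Cmod b))%R with d in Hk by (field; lra).
    pose proof (Rabs_pos k). nra. }
  specialize (H' Hk1).
  replace ((h (a + (t + k)%R * b) - h (a + t * b)) / k - l * b) with
    ((h (a + (t + k)%R * b) - h (a + t * b) - l * (k * b)) / k) by (field; easy).
  rewrite Cmod_div, Cmod_R by easy.
  assert (Hak : (0 < Rabs k)%R) by now apply Rabs_pos_lt.
  apply Rlt_div_l; [easy|]. apply Rle_lt_trans with (1 := H').
  replace (eps / (2 * (1 + Cmod b)) * (Rabs k * Cmod b))%R with
    (eps * Rabs k * (Cmod b / (2 * (1 + Cmod b))))%R by (field; lra).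
  assert ((Cmod b / (2 * (1 + Cmod b)) < 1)%R).
  { apply Rlt_div_l; lra. }
  assert (0 < eps * Rabs k)%R by nra. nra. }
split; apply is_derive_Reals; intros eps He; destruct (Hc eps He) as [d Hd];
exists d; intros k Hk0 Hk; apply Rle_lt_trans with (2 := Hd k Hk0 Hk).
- apply Rle_trans with (2 := re_le_Cmod _). right. f_equal.
  destruct (h (a + (t + k)%R * b)) as [x1 y1], (h (a + t * b)) as [x2 y2], (l * b) as [x3 y3].
  unfold Re; simpl. field. easy.
- apply Rle_trans with (2 := Rle_trans _ _ _ (Rmax_r _ _) (Rmax_Cmod _)). right. f_equal.
  destruct (h (a + (t + k)%R * b)) as [x1 y1], (h (a + t * b)) as [x2 y2], (l * b) as [x3 y3].
  unfold Im; simpl. field. easy.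
Qed.

(** * Entire functions *)

Definition Csum (a : nat -> C) (l : C) : Prop :=
  is_series (K := C_AbsRing) (V := C_NormedModule) a l.

Lemma Csum_unique a l m : Csum a l -> Csum a m -> l = m.
Proof. apply (filterlim_locally_unique (sum_n a)). Qed.

Lemma Csum_eq a (l m : C) : Csum a l -> l = m -> Csum a m.
Proof. now intros H <-. Qed.

Lemma Csum_ext a b l : (forall n, a n = b n) -> Csum a l -> Csum b l.
Proof. intros H. now apply is_series_ext. Qed.

Lemma Csum_plus a b l m : Csum a l -> Csum b m -> Csum (fun n => a n + b n) (l + m).
Proof. exact (is_series_plus (K := C_AbsRing) (V := C_NormedModule) a b l m). Qed.

Lemma Csum_scal (c : C) a l : Csum a l -> Csum (fun n => c * a n) (c * l).
Proof. exact (is_series_scal (K := C_AbsRing) (V := C_NormedModule) c a l). Qed.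

Lemma Csum_minus a b l m : Csum a l -> Csum b m -> Csum (fun n => a n - b n) (l - m).
Proof. exact (is_series_minus (K := C_AbsRing) (V := C_NormedModule) a b l m). Qed.

Lemma Csum_shift a l : Csum a (l + a O) -> Csum (fun n => a (S n)) l.
Proof. exact (is_series_incr_1 (K := C_AbsRing) (V := C_NormedModule) a l). Qed.

Lemma Csum_unshift a l : Csum (fun n => a (S n)) l -> Csum a (l + a O).
Proof.
intros H. apply (is_series_decr_1 (K := C_AbsRing) (V := C_NormedModule) a).
match goal with |- is_series _ ?x => replace x with l; [exact H|] end.
unfold plus, opp; simpl. ring.
Qed.

Lemma Csum_zero : Csum (fun _ => 0) 0.
Proof.
apply (filterlim_ext (fun _ => RtoC 0)); [|apply filterlim_const].
intros n. induction n as [|n IH]; [now rewrite sum_O|].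
rewrite sum_Sn, <- IH. symmetry. apply (plus_zero_r (G := C_AbelianMonoid)).
Qed.

Lemma Csum_Cmod_le a l (b : nat -> R) B :
  Csum a l -> is_series b B -> (forall n, (Cmod (a n) <= b n)%R) -> (Cmod l <= B)%R.
Proof.
intros Ha Hb H.
apply (is_lim_seq_le (fun n => Cmod (sum_n a n)) (sum_n b) (Cmod l) B); [|exact (filterlim_comp _ _ _ _ _ _ _ _ Ha (filterlim_norm (K := C_AbsRing) (V := C_NormedModule) l))|exact Hb].
intros n. induction n as [|n IH].
- rewrite !sum_O. apply H.
- rewrite !sum_Sn. apply Rle_trans with (1 := Cmod_triangle _ _).
  apply Rplus_le_compat; [exact IH | apply H].
Qed.

Lemma Csum_exists a (b : nat -> R) :
  ex_series b -> (forall n, (Cmod (a n) <= b n)%R) -> exists l, Csum a l.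
Proof.
intros Hb H. apply (ex_series_le (K := C_AbsRing) (V := C_CompleteNormedModule) a b H Hb).
Qed.

Lemma Csum_Re_Im a l :
  Csum a l -> is_series (fun n => Re (a n)) (Re l) /\ is_series (fun n => Im (a n)) (Im l).
Proof.
intros H.
assert (E : forall n, sum_n (fun k => Re (a k)) n = Re (sum_n a n) /\
                      sum_n (fun k => Im (a k)) n = Im (sum_n a n)).
{ induction n as [|n [IH1 IH2]].
  - rewrite !sum_O. easy.
  - rewrite !sum_Sn, IH1, IH2. easy. }
split.
- apply (filterlim_ext (fun n => Re (sum_n a n))). { intros n. symmetry. apply E. }
  apply (filterlim_comp _ _ _ _ _ _ _ _ H (continuous_fst (U := R_UniformSpace) (V := R_UniformSpace) (Re l) (Im l))).
- apply (filterlim_ext (fun n => Im (sum_n a n))). { intros n. symmetry. apply E. }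
  apply (filterlim_comp _ _ _ _ _ _ _ _ H (continuous_snd (U := R_UniformSpace) (V := R_UniformSpace) (Re l) (Im l))).
Qed.

Lemma CSeries_Csum a l : Csum a l -> CSeries a = l.
Proof.
intros H. destruct (Csum_Re_Im a l H) as [H1 H2]. unfold CSeries.
rewrite (is_series_unique _ _ H1), (is_series_unique _ _ H2). symmetry. apply surjective_pairing.
Qed.

(** Serves the substitution of [z * z] in a power series: the partial sums of orders [2 m] and
    [2 m + 1] both equal that of order [m] of the original series. *)
Lemma Csum_double a l :
  Csum a l -> Csum (fun k => if Nat.even k then a (Nat.div2 k) else RtoC 0) l.
Proof.
intros H. unfold Csum, is_series.
set (a' := fun k => if Nat.even k then a (Nat.div2 k) else RtoC 0).
assert (E : forall m, sum_n a' (2 * m) = sum_n a m /\ sum_n a' (S (2 * m)) = sum_n a m).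
{ assert (step : forall m, sum_n a' (2 * m) = sum_n a m -> sum_n a' (S (2 * m)) = sum_n a m).
  { intros m Hm. rewrite sum_Sn, Hm. unfold a' at 1. rewrite Nat.even_succ, <- Nat.negb_even, Nat.even_even.
    apply (plus_zero_r (G := C_AbelianMonoid)). }
  induction m as [|m [_ IH]].
  - assert (sum_n a' (2 * 0) = sum_n a 0) by (rewrite !sum_O; reflexivity). auto.
  - assert (sum_n a' (2 * S m) = sum_n a (S m)).
    { replace (2 * S m)%nat with (S (S (2 * m))) by lia. rewrite sum_Sn, IH, (sum_Sn a). f_equal.
      unfold a'. replace (S (S (2 * m))) with (2 * S m)%nat by lia.
      now rewrite Nat.even_even, Nat.div2_double. }
    auto. }
intros P HP. destruct (H P HP) as [N HN]. exists (2 * N)%nat. intros n Hn.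
destruct (Nat.Even_or_Odd n) as [[m ->]|[m ->]].
- refine (eq_ind_r (fun x => P x) (HN m _) (proj1 (E m))). lia.
- rewrite Nat.add_1_r. refine (eq_ind_r (fun x => P x) (HN m _) (proj2 (E m))). lia.
Qed.

(** Infinite radius of convergence, stated by bounded terms because that form passes easily through
    shifts, sums and recurrences. *)
Definition fast_decay (c : nat -> C) : Prop :=
  forall rho : R, (0 < rho)%R -> exists M : R, forall n, (Cmod (c n) * rho ^ n <= M)%R.

Lemma fast_decay_geom c (r : R) :
  fast_decay c -> (0 <= r)%R ->
  exists M : R, (0 <= M)%R /\ forall n, (Cmod (c n) * r ^ n <= M * (1 / 2) ^ n)%R.
Proof.
(* Doubling the radius pays for the factor [(1 / 2) ^ n]; the [+ 1] keeps it positive when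
   [r = 0]. *)
intros Hc Hr. destruct (Hc (2 * (r + 1))%R) as [M HM]; [lra|].
exists M. split.
{ apply Rle_trans with (2 := HM O). rewrite pow_O, Rmult_1_r. apply Cmod_ge_0. }
intros n. specialize (HM n). pose proof (Cmod_ge_0 (c n)).
assert (r ^ n <= (r + 1) ^ n)%R by (apply pow_incr; lra).
assert (0 <= r ^ n)%R by now apply pow_le.
assert (h2 : (0 < 2 ^ n)%R) by (apply pow_lt; lra).
rewrite Rpow_mult_distr in HM. replace (1 / 2)%R with (/ 2)%R by lra. rewrite pow_inv.
apply (proj1 (Rle_div_r _ M (2 ^ n) h2)).
apply Rle_trans with (2 := HM).
replace (Cmod (c n) * r ^ n * 2 ^ n)%R with (Cmod (c n) * (2 ^ n * r ^ n))%R by ring.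
apply Rmult_le_compat_l; [easy|]. apply Rmult_le_compat_l; lra.
Qed.

Lemma is_series_geom_half (M : R) : is_series (fun n => M * (1 / 2) ^ n)%R (2 * M)%R.
Proof.
replace (2 * M)%R with (M * / (1 - 1 / 2))%R by field.
apply (is_series_scal (K := R_AbsRing) (V := R_NormedModule) M (fun n => (1 / 2) ^ n)%R). apply is_series_geom. rewrite Rabs_pos_eq; lra.
Qed.

Lemma fast_decay_Csum c z :
  fast_decay c -> exists l, Csum (fun n => c n * z ^ n) l.
Proof.
intros Hc. destruct (fast_decay_geom c (Cmod z) Hc (Cmod_ge_0 z)) as [M [HM H]].
apply (Csum_exists _ (fun n => M * (1 / 2) ^ n)%R).
- eexists. apply is_series_geom_half.
- intros n. rewrite Cmod_mult, Cmod_pow. apply H.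
Qed.

Lemma CSeries_fast_decay c z :
  fast_decay c -> Csum (fun n => c n * z ^ n) (CSeries (fun n => c n * z ^ n)).
Proof.
intros Hc. destruct (fast_decay_Csum c z Hc) as [l Hl]. now rewrite (CSeries_Csum _ _ Hl).
Qed.

(** Defined by a power series rather than by differentiability, so that a root can be divided out on
    the coefficients. *)
Definition entire (f : C -> C) : Prop :=
  exists c, fast_decay c /\ forall z, Csum (fun n => c n * z ^ n) (f z).

Lemma entire_ext f g : (forall z, f z = g z) -> entire f -> entire g.
Proof. intros E [c [Hc H]]. exists c. split; [easy|]. intros z. now rewrite <- E. Qed.

Lemma entire_const (a : C) : entire (fun _ => a).
Proof.
exists (fun n => match n with O => a | S _ => RtoC 0 end). split.
- intros rho Hr. exists (Cmod a). intros [|n]; simpl.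
  + lra.
  + rewrite Cmod_0, Rmult_0_l. apply Cmod_ge_0.
- intros z. eapply Csum_eq.
  + apply (Csum_unshift (fun n => match n with O => a | S _ => RtoC 0 end * z ^ n)).
    apply (Csum_ext (fun _ => RtoC 0)); [intros n; ring | apply Csum_zero].
  + simpl. ring.
Qed.

Lemma entire_lin (a b : C) f g :
  entire f -> entire g -> entire (fun z => a * f z + b * g z).
Proof.
intros [c [Hc Hf]] [d [Hd Hg]]. exists (fun n => a * c n + b * d n). split.
- intros rho Hr. destruct (Hc rho Hr) as [M HM], (Hd rho Hr) as [N HN].
  exists (Cmod a * M + Cmod b * N)%R. intros n.
  apply Rle_trans with ((Cmod a * Cmod (c n) + Cmod b * Cmod (d n)) * rho ^ n)%R.
  + apply Rmult_le_compat_r; [apply pow_le; lra|].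
    rewrite <- !Cmod_mult. apply Cmod_triangle.
  + pose proof (Rmult_le_compat_l _ _ _ (Cmod_ge_0 a) (HM n)).
    pose proof (Rmult_le_compat_l _ _ _ (Cmod_ge_0 b) (HN n)). lra.
- intros z. apply (Csum_ext (fun n => a * (c n * z ^ n) + b * (d n * z ^ n))).
  + intros n. ring.
  + apply Csum_plus; now apply Csum_scal.
Qed.

Lemma entire_scal (a : C) f : entire f -> entire (fun z => a * f z).
Proof.
intros H. apply (entire_ext (fun z => a * f z + 0 * f z)); [intros z; ring|].
now apply entire_lin.
Qed.

Lemma entire_minus f g : entire f -> entire g -> entire (fun z => f z - g z).
Proof.
intros Hf Hg. apply (entire_ext (fun z => 1 * f z + (- (1)) * g z)); [intros z; ring|].
now apply entire_lin.
Qed.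

Lemma entire_mul_id f : entire f -> entire (fun z => z * f z).
Proof.
intros [c [Hc Hf]]. exists (fun n => match n with O => RtoC 0 | S k => c k end). split.
- intros rho Hr. destruct (Hc rho Hr) as [M HM]. exists (Rmax 0 (rho * M)). intros [|n].
  + rewrite Cmod_0, Rmult_0_l. apply Rmax_l.
  + apply Rle_trans with (2 := Rmax_r _ _). simpl.
    replace (Cmod (c n) * (rho * rho ^ n))%R with (rho * (Cmod (c n) * rho ^ n))%R by ring.
    apply Rmult_le_compat_l; [lra | apply HM].
- intros z. replace (z * f z) with (z * f z + 0 * z ^ 0) by (simpl; ring).
  apply (Csum_unshift (fun n => match n with O => RtoC 0 | S k => c k end * z ^ n)).
  apply (Csum_ext (fun n => z * (c n * z ^ n))). { intros n. simpl. ring. }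
  now apply Csum_scal.
Qed.

Lemma entire_mul_pow f m : entire f -> entire (fun z => z ^ m * f z).
Proof.
intros Hf. induction m as [|m IH].
- apply (entire_ext f); [intros z; simpl; ring | easy].
- apply (entire_ext (fun z => z * (z ^ m * f z))); [intros z; simpl; ring|].
  now apply entire_mul_id.
Qed.

Lemma entire_sqr f : entire f -> entire (fun z => f (z * z)).
Proof.
intros [c [Hc Hf]].
exists (fun k => if Nat.even k then c (Nat.div2 k) else RtoC 0). split.
- intros rho Hr. destruct (Hc (rho * rho)%R) as [M HM]; [nra|].
  exists M. intros n.
  destruct (Nat.Even_or_Odd n) as [[m ->]|[m ->]].
  + rewrite Nat.even_even, Nat.div2_double, pow_mult. simpl (rho ^ 2)%R. rewrite Rmult_1_r. apply HM.
  + rewrite Nat.even_odd, Cmod_0, Rmult_0_l.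
    apply Rle_trans with (2 := HM O). rewrite pow_O, Rmult_1_r. apply Cmod_ge_0.
- intros z. apply (Csum_ext (fun k => if Nat.even k then c (Nat.div2 k) * (z * z) ^ Nat.div2 k else RtoC 0)).
  + intros n. destruct (Nat.Even_or_Odd n) as [[m ->]|[m ->]].
    * rewrite Nat.even_even, Nat.div2_double. rewrite Cpow_mult_r. simpl (z ^ 2). f_equal. f_equal. ring.
    * rewrite Nat.even_odd. ring.
  + now apply (Csum_double (fun k => c k * (z * z) ^ k)).
Qed.

(* The quotient of [sum c_n z^n] by [z - p] has coefficients [d_j = sum_i c_(j+1+i) p^i],
   because [d_j = c_(j+1) + p d_(j+1)]. *)
Lemma entire_div_root f p :
  entire f -> f p = 0 -> exists g, entire g /\ forall z, f z = (z - p) * g z.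
Proof.
intros [c [Hc Hf]] Hp.
assert (Hb : forall rho : R, (0 < rho)%R -> exists M : R, (0 <= M)%R /\
  forall j i, (Cmod (c (S j + i)%nat * p ^ i) * rho ^ j <= M * (1 / 2) ^ i)%R).
{ intros rho Hr. pose proof (Cmod_ge_0 p) as Hpp.
  (* A single radius, at least 1, dominating both [|p|] and [rho]: it bounds [|p|^i rho^j] by
     [s^(j+1+i)] and leaves a geometric factor in [i]. *)
  set (s := (Cmod p + rho + 1)%R).
  destruct (fast_decay_geom c s Hc) as [M [HM H]]; [unfold s; lra|].
  exists M. split; [easy|]. intros j i. specialize (H (S j + i)%nat).
  assert (h1 : (Cmod p ^ i <= s ^ i)%R) by (apply pow_incr; unfold s; lra).
  assert (h2 : (rho ^ j <= s ^ S j)%R).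
  { apply Rle_trans with (s ^ j)%R; [apply pow_incr; unfold s; lra|].
    apply Rle_pow; [unfold s; lra | lia]. }
  assert (h3 : ((1 / 2) ^ (S j + i) <= (1 / 2) ^ i)%R).
  { rewrite pow_add. assert (((1 / 2) ^ S j <= 1)%R).
    { rewrite <- (pow1 (S j)) at 2. apply pow_incr. lra. }
    assert (0 < (1 / 2) ^ i)%R by (apply pow_lt; lra). nra. }
  rewrite Cmod_mult, Cmod_pow.
  apply Rle_trans with (Cmod (c (S j + i)%nat) * s ^ (S j + i))%R.
  - rewrite pow_add, Rmult_assoc. apply Rmult_le_compat_l; [apply Cmod_ge_0|].
    rewrite Rmult_comm. apply Rmult_le_compat; try easy; apply pow_le; lra.
  - apply Rle_trans with (1 := H). now apply Rmult_le_compat_l. }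
assert (Hd : forall j, Csum (fun i => c (S j + i)%nat * p ^ i) (CSeries (fun i => c (S j + i)%nat * p ^ i))).
{ intros j. destruct (Hb 1%R Rlt_0_1) as [M [_ HM]].
  destruct (Csum_exists (fun i => c (S j + i)%nat * p ^ i) (fun i => M * (1 / 2) ^ i)%R) as [l Hl].
  - eexists. apply is_series_geom_half.
  - intros i. specialize (HM j i). now rewrite pow1, Rmult_1_r in HM.
  - now rewrite (CSeries_Csum _ _ Hl). }
set (d := fun j => CSeries (fun i => c (S j + i)%nat * p ^ i)) in *.
assert (Hdd : fast_decay d).
{ intros rho Hr. destruct (Hb rho Hr) as [M [HM H]]. exists (2 * M)%R. intros j.
  assert (hr : (0 < rho ^ j)%R) by now apply pow_lt.
  apply (proj2 (Rle_div_r _ _ _ hr)).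
  apply (Csum_Cmod_le _ _ (fun i => (M / rho ^ j) * (1 / 2) ^ i)%R _ (Hd j)).
  - replace (2 * M / rho ^ j)%R with (2 * (M / rho ^ j))%R by (field; lra). apply is_series_geom_half.
  - intros i. specialize (H j i).
    replace (M / rho ^ j * (1 / 2) ^ i)%R with (M * (1 / 2) ^ i / rho ^ j)%R by (field; lra).
    now apply (proj1 (Rle_div_r _ _ _ hr)). }
assert (Hrec : forall j, d j = c (S j) + p * d (S j)).
{ intros j. apply (Csum_unique _ _ _ (Hd j)).
  eapply Csum_eq.
  - apply Csum_unshift. apply (Csum_ext (fun i => p * (c (S (S j) + i)%nat * p ^ i))).
    + intros i. simpl. replace (j + S i)%nat with (S (j + i)) by lia. ring.
    + apply Csum_scal, Hd.
  - simpl. rewrite Nat.add_0_r. unfold d. simpl. ring. }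
(* The recurrence at the index before the first: its value is [f p], and here the root enters. *)
assert (H0 : c O + p * d O = 0).
{ rewrite <- Hp. eapply Csum_unique; [|apply Hf].
  eapply Csum_eq.
  - apply Csum_unshift. apply (Csum_ext (fun i => p * (c (1 + i)%nat * p ^ i))).
    + intros i. simpl. ring.
    + apply Csum_scal, (Hd O).
  - simpl. unfold d. simpl. ring. }
exists (fun z => CSeries (fun j => d j * z ^ j)).
assert (Hg : forall z, Csum (fun j => d j * z ^ j) (CSeries (fun j => d j * z ^ j))).
{ intros z. now apply CSeries_fast_decay. }
split; [now exists d|].
intros z. apply (Csum_unique (fun n => c n * z ^ n)); [apply Hf|].
eapply Csum_eq.
- apply Csum_unshift.
  apply (Csum_ext (fun n => z * (d n * z ^ n) - p * (d (S n) * z ^ S n))).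
  + intros n. rewrite (Hrec n). simpl. ring.
  + apply Csum_minus; apply Csum_scal; [apply Hg|].
    apply (Csum_shift (fun n => d n * z ^ n)).
    apply (Csum_eq _ _ ((CSeries (fun j => d j * z ^ j) - d O) + d O * z ^ 0)) with (1 := Hg z).
    simpl. ring.
- simpl. replace (c O) with (- (p * d O)); [ring|].
  replace (c O) with (c O + p * d O - p * d O) by ring. rewrite H0. ring.
Qed.

(** The quadratic remainder needed for termwise differentiation. The constant is crude, but fast
    decay of the coefficients absorbs any [INR n ^ 2 * rho ^ n]. *)
Lemma Cpow_taylor1 (z p : C) (rho : R) n :
  (1 <= rho)%R -> (Cmod z <= rho)%R -> (Cmod p <= rho)%R ->
  (Cmod (z ^ n - p ^ n - INR n * p ^ pred n * (z - p)) <= INR n ^ 2 * rho ^ n * Cmod (z - p) ^ 2)%R.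
Proof.
intros Hr Hz Hp. induction n as [|n IH].
- simpl. replace (1 - 1 - 0 * 1 * (z - p)) with (RtoC 0) by ring. rewrite Cmod_0. lra.
- replace (z ^ S n - p ^ S n - INR (S n) * p ^ pred (S n) * (z - p)) with
    (z * (z ^ n - p ^ n - INR n * p ^ pred n * (z - p)) + INR n * p ^ pred n * ((z - p) * (z - p))).
  + apply Rle_trans with (1 := Cmod_triangle _ _).
    rewrite !Cmod_mult, Cmod_R, Cmod_pow, (Rabs_pos_eq (INR n)) by apply pos_INR.
    rewrite S_INR. set (e := Cmod (z - p)). set (N := INR n).
    assert (HN : (0 <= N)%R) by apply pos_INR.
    assert (He : (0 <= e)%R) by apply Cmod_ge_0.
    assert (hp : (Cmod p ^ pred n <= rho ^ S n)%R).
    { apply Rle_trans with (rho ^ pred n)%R.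
      - apply pow_incr. split; [apply Cmod_ge_0 | easy].
      - apply Rle_pow; [easy | lia]. }
    fold e N in IH.
    assert (h1 : (Cmod z * Cmod (z ^ n - p ^ n - RtoC N * p ^ pred n * (z - p)) <= rho * (N ^ 2 * rho ^ n * e ^ 2))%R).
    { apply Rmult_le_compat; try easy; apply Cmod_ge_0. }
    assert (h2 : (N * Cmod p ^ pred n * (e * e) <= N * rho ^ S n * (e * e))%R).
    { apply Rmult_le_compat_r; [nra|]. now apply Rmult_le_compat_l. }
    apply Rle_trans with (1 := Rplus_le_compat _ _ _ _ h1 h2).
    assert (h3 : (0 <= rho ^ S n * (e * e))%R).
    { apply Rmult_le_pos; [apply pow_le; lra | nra]. }
    replace (rho * (N ^ 2 * rho ^ n * e ^ 2) + N * rho ^ S n * (e * e))%R with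
      ((N ^ 2 + N) * (rho ^ S n * (e * e)))%R by (simpl; ring).
    replace ((N + 1) ^ 2 * rho ^ S n * e ^ 2)%R with ((N + 1) ^ 2 * (rho ^ S n * (e * e)))%R by (simpl; ring).
    apply Rmult_le_compat_r; nra.
  + destruct n as [|n]; [simpl; ring|].
    rewrite (S_INR (S n)), RtoC_plus. simpl pred. rewrite !Cpow_S. ring.
Qed.

Lemma Cpow_derive n (z : C) : Cder (fun x => x ^ n) z (INR n * z ^ pred n).
Proof.
induction n as [|n IH].
- simpl. apply (Cder_eq _ _ 0); [apply Cder_const | ring].
- apply (Cder_ext (fun x => x * x ^ n)); [easy|].
  eapply Cder_eq; [apply Cder_mult; [apply Cder_id | apply IH]|].
  rewrite S_INR, RtoC_plus. destruct n as [|n]; simpl; ring.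
Qed.

Lemma INR_le_pow2 n : (INR n <= 2 ^ n)%R.
Proof.
induction n as [|n IH]; [simpl; lra|]. rewrite S_INR. simpl.
assert (1 <= 2 ^ n)%R by (apply pow_R1_Rle; lra). lra.
Qed.

Lemma Csum_derive c f g :
  fast_decay c -> (forall z, Csum (fun n => c n * z ^ n) (f z)) ->
  (forall z, Csum (fun n => INR (S n) * c (S n) * z ^ n) (g z)) ->
  forall z, Cder f z (g z).
Proof.
intros Hc Hf Hg.
intros p. apply Cder_Cmod. intros eps He.
set (rho := (Cmod p + 1)%R).
assert (Hr : (1 <= rho)%R) by (pose proof (Cmod_ge_0 p); unfold rho; lra).
(* The extra [4 ^ n] absorbs the factor [INR n ^ 2] of [Cpow_taylor1]. *)
destruct (fast_decay_geom c (4 * rho)%R Hc) as [M [HM H]]; [lra|].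
exists (Rmin 1 (eps / (2 * M + 1))). split.
{ apply Rmin_pos; [lra|]. apply Rdiv_lt_0_compat; lra. }
intros z Hz.
assert (Hz1 := Rlt_le_trans _ _ _ Hz (Rmin_l _ _)).
assert (Hz2 := Rlt_le_trans _ _ _ Hz (Rmin_r _ _)).
assert (Hzr : (Cmod z <= rho)%R).
{ replace z with (p + (z - p)) by ring. apply Rle_trans with (1 := Cmod_triangle _ _). unfold rho; lra. }
set (e := Cmod (z - p)) in *.
assert (He0 : (0 <= e)%R) by apply Cmod_ge_0.
apply Rle_trans with (2 * (M * e ^ 2))%R.
- apply (Csum_Cmod_le (fun n => c n * (z ^ n - p ^ n - INR n * p ^ pred n * (z - p))) _
    (fun n => M * e ^ 2 * (1 / 2) ^ n)%R).
  + apply (Csum_ext (fun n => c n * z ^ n - c n * p ^ n - (z - p) * (INR n * c n * p ^ pred n))).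
    { intros n. ring. }
    eapply Csum_eq.
    * apply Csum_minus; [apply Csum_minus; apply Hf|]. apply Csum_scal.
      apply (Csum_unshift (fun n => INR n * c n * p ^ pred n)). apply Hg.
    * cbv beta. change (INR 0) with 0%R. ring.
  + apply is_series_geom_half.
  + intros n. rewrite Cmod_mult.
    apply Rle_trans with (Cmod (c n) * (INR n ^ 2 * rho ^ n * e ^ 2))%R.
    { apply Rmult_le_compat_l; [apply Cmod_ge_0|]. apply Cpow_taylor1; try easy. unfold rho; lra. }
    assert (h1 : (INR n ^ 2 <= 4 ^ n)%R).
    { replace 4%R with (2 * 2)%R by ring. rewrite Rpow_mult_distr. simpl. rewrite Rmult_1_r.
      pose proof (INR_le_pow2 n). pose proof (pos_INR n). nra. }
    specialize (H n). rewrite Rpow_mult_distr in H.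
    assert (h2 : (0 <= rho ^ n * e ^ 2)%R).
    { apply Rmult_le_pos; [apply pow_le; lra | apply pow_le; easy]. }
    pose proof (Cmod_ge_0 (c n)).
    apply Rle_trans with (Cmod (c n) * (4 ^ n * (rho ^ n * e ^ 2)))%R.
    { apply Rmult_le_compat_l; [easy|]. rewrite Rmult_assoc. now apply Rmult_le_compat_r. }
    assert (h3 : (0 <= e ^ 2)%R) by now apply pow_le.
    pose proof (Rmult_le_compat_r _ _ _ h3 H). lra.
- apply Rmult_lt_compat_r with (r := (2 * M + 1)%R) in Hz2; [|lra].
  replace (eps / (2 * M + 1) * (2 * M + 1))%R with eps in Hz2 by (field; lra).
  simpl. nra.
Qed.

Lemma entire_derive f :
  entire f -> exists f', entire f' /\ forall z, Cder f z (f' z).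
Proof.
intros [c [Hc Hf]].
set (d := fun n => INR (S n) * c (S n)).
assert (Hd : fast_decay d).
{ intros rho Hr. destruct (Hc (2 * (rho + 1))%R) as [M HM]; [lra|]. exists M. intros n.
  apply Rle_trans with (2 := HM (S n)). unfold d.
  rewrite Cmod_mult, Cmod_R, Rabs_pos_eq by apply pos_INR.
  rewrite Rpow_mult_distr.
  assert (h : (rho ^ n <= (rho + 1) ^ S n)%R).
  { apply Rle_trans with ((rho + 1) ^ n)%R; [apply pow_incr; lra | apply Rle_pow; [lra | lia]]. }
  replace (INR (S n) * Cmod (c (S n)) * rho ^ n)%R with (Cmod (c (S n)) * (INR (S n) * rho ^ n))%R by ring.
  apply Rmult_le_compat_l; [apply Cmod_ge_0|].
  apply Rmult_le_compat; try easy.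
  - apply pos_INR.
  - apply pow_le; lra.
  - apply INR_le_pow2. }
assert (Hg : forall z, Csum (fun j => d j * z ^ j) (CSeries (fun j => d j * z ^ j))).
{ intros z. now apply CSeries_fast_decay. }
exists (fun z => CSeries (fun j => d j * z ^ j)). split; [now exists d|].
exact (Csum_derive c f _ Hc Hf Hg).
Qed.

Lemma entire_cont f z : entire f -> cont f z.
Proof. intros H. destruct (entire_derive f H) as [f' [_ H']]. exact (Cder_cont _ _ _ (H' z)). Qed.

(** * Bessel functions *)

(* [J_n(z) = (z/2)^n phi_n(z^2)] *)
Definition phi_coef (n m : nat) : R := ((- (1)) ^ m / (INR (fact m) * INR (fact (m + n)) * 4 ^ m))%R.
Definition phi (n : nat) (s : C) : C := CSeries (fun m => phi_coef n m * s ^ m).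

Lemma phi_coef_denom n m : (INR (fact m) * INR (fact (m + n)) * 4 ^ m <> 0)%R.
Proof.
repeat apply Rmult_integral_contrapositive_currified; try apply INR_fact_neq_0.
apply pow_nonzero; lra.
Qed.

Lemma phi_coef_fast n : fast_decay (fun m => phi_coef n m).
Proof.
intros rho Hr.
destruct (maj_by_pos (fun m => rho ^ m / INR (fact m))%R) as [M [HM H]].
{ exists 0%R. apply cv_speed_pow_fact. }
exists M. intros m. rewrite Cmod_R. apply Rle_trans with (2 := H m).
unfold phi_coef. rewrite <- (Rabs_pos_eq (rho ^ m)) at 1 by (apply pow_le; lra).
rewrite <- Rabs_mult. unfold Rdiv. rewrite !Rabs_mult, pow_1_abs, !Rabs_inv, !Rabs_mult.
pose proof (INR_fact_lt_0 m) as h1. pose proof (INR_fact_lt_0 (m + n)) as h2.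
assert (h3 : (1 <= 4 ^ m)%R) by (apply pow_R1_Rle; lra).
assert (h4 : (1 <= INR (fact (m + n)))%R) by (apply (le_INR 1), lt_O_fact).
rewrite !(Rabs_pos_eq _ (Rlt_le _ _ h1)), !(Rabs_pos_eq _ (Rlt_le _ _ h2)), (Rabs_pos_eq (4 ^ m)) by lra.
assert (h5 : (0 <= rho ^ m)%R) by (apply pow_le; lra).
rewrite ?(Rabs_pos_eq _ h5), Rmult_1_l, Rmult_comm. apply Rmult_le_compat_l; [easy|].
apply Rinv_le_contravar; [easy|].
rewrite Rmult_assoc. rewrite <- (Rmult_1_r (INR (fact m))) at 1.
apply Rmult_le_compat_l; nra.
Qed.

Lemma phi_Csum n s : Csum (fun m => phi_coef n m * s ^ m) (phi n s).
Proof. apply (CSeries_fast_decay (fun m => phi_coef n m)), phi_coef_fast. Qed.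

Lemma phi_entire n : entire (phi n).
Proof. exists (fun m => phi_coef n m). split; [apply phi_coef_fast | apply phi_Csum]. Qed.

Lemma phi_derive n s : Cder (phi n) s (- / 4 * phi (S n) s).
Proof.
apply (Csum_derive (fun m => phi_coef n m) _ (fun s => - / 4 * phi (S n) s)).
- apply phi_coef_fast.
- apply phi_Csum.
- intros z. apply (Csum_ext (fun m => - / 4 * (phi_coef (S n) m * z ^ m))).
  + intros m. rewrite !Cmult_assoc. f_equal.
    replace (- / 4) with (RtoC (- / 4)) by (rewrite RtoC_opp, RtoC_inv; easy).
    rewrite <- !RtoC_mult. f_equal. unfold phi_coef.
    replace (S m + n)%nat with (m + S n)%nat by lia.
    rewrite (fact_simpl m), mult_INR. simpl pow.
    field. repeat split; try apply INR_fact_neq_0; [apply pow_nonzero; lra|].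
    apply not_0_INR. lia.
  + apply Csum_scal, phi_Csum.
Qed.

(** The three-term recurrence of [J] freed of powers of [z]. With [phi_derive] it also yields the
    derivative formula, and Bessel's equation follows from these two. *)
Lemma phi_rec n s : phi n s + s / 4 * phi (S (S n)) s = INR (S n) * phi (S n) s.
Proof.
apply (Csum_unique (fun m => INR (S n) * (phi_coef (S n) m * s ^ m))); [|apply Csum_scal, phi_Csum].
assert (H : Csum (fun m => match m with O => RtoC 0 | S k => s / 4 * (phi_coef (S (S n)) k * s ^ k) end)
  (s / 4 * phi (S (S n)) s)).
{ eapply Csum_eq.
  - apply (Csum_unshift (fun m => match m with O => RtoC 0 | S k => s / 4 * (phi_coef (S (S n)) k * s ^ k) end)).
    apply Csum_scal, phi_Csum.
  - simpl. ring. }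
refine (Csum_ext _ _ _ _ (Csum_plus _ _ _ _ (phi_Csum n s) H)).
intros [|k]; cbv beta iota.
- simpl (s ^ 0). rewrite Cplus_0_r, !Cmult_1_r, <- RtoC_mult. f_equal. unfold phi_coef.
  rewrite !Nat.add_0_l, (fact_simpl n), mult_INR. simpl. field. split; [apply INR_fact_neq_0|].
  change (INR (S n) <> 0)%R. apply not_0_INR. lia.
- rewrite Cpow_S.
  replace (phi_coef n (S k) * (s * s ^ k) + s / 4 * (phi_coef (S (S n)) k * s ^ k)) with
    ((RtoC (phi_coef n (S k)) + RtoC (phi_coef (S (S n)) k) / RtoC 4) * (s * s ^ k)) by field.
  rewrite (Cmult_assoc (INR (S n))). f_equal. rewrite <- RtoC_div, <- RtoC_plus, <- RtoC_mult by lra. f_equal.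
  unfold phi_coef. replace (S k + S n)%nat with (S (S (k + n))) by lia.
  replace (k + S (S n))%nat with (S (S (k + n))) by lia. replace (S k + n)%nat with (S (k + n)) by lia.
  rewrite (fact_simpl (S (k + n))), (fact_simpl k), !mult_INR. simpl pow.
  replace (INR (S (S (k + n)))) with (INR (S n) + INR (S k))%R by (rewrite <- plus_INR; f_equal; lia).
  assert (INR (S n) + INR (S k) <> 0)%R.
  { rewrite <- plus_INR. apply not_0_INR. lia. }
  assert (INR (S k) <> 0)%R by (apply not_0_INR; lia).
  field. repeat split; try easy; try apply INR_fact_neq_0. apply pow_nonzero; lra.
Qed.

Lemma phi_0 n : phi n 0 = (/ INR (fact n))%R.
Proof.
apply (Csum_unique _ _ _ (phi_Csum n 0)). eapply Csum_eq.
- apply Csum_unshift. apply (Csum_ext (fun m => 0 * (phi_coef n m * 0 ^ m))).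
  + intros m. simpl. ring.
  + apply Csum_scal, phi_Csum.
- simpl. rewrite Cmult_0_l, Cplus_0_l, Cmult_1_r. f_equal. unfold phi_coef. simpl. field.
  apply INR_fact_neq_0.
Qed.

Lemma phi_real n (x : R) : Im (phi n x) = 0%R.
Proof.
destruct (Csum_Re_Im _ _ (phi_Csum n x)) as [_ H].
apply (filterlim_locally_unique (F := eventually) (sum_n (fun m => Im (phi_coef n m * x ^ m)))); [exact H|].
apply (filterlim_ext (fun _ => 0%R)); [|apply filterlim_const].
intros k. symmetry. induction k as [|k IH]; rewrite ?sum_O, ?sum_Sn, ?IH.
- rewrite <- RtoC_pow, <- RtoC_mult. easy.
- rewrite <- RtoC_pow, <- RtoC_mult. apply (plus_zero_l (G := R_AbelianGroup)).
Qed.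

Lemma BesselJ_nat_phi n z : BesselJ_nat n z = (z / 2) ^ n * phi n (z * z).
Proof.
apply CSeries_Csum.
apply (Csum_ext (fun m => (z / 2) ^ n * (phi_coef n m * (z * z) ^ m))).
- intros m. unfold phi_coef.
  rewrite Cpow_add_r, Cpow_mult_r. simpl ((z / 2) ^ 2).
  replace (z / 2 * (z / 2 * 1)) with (z * z * / 4) by field.
  rewrite (Cpow_mult_l (z * z)), Cpow_inv by (intros h; apply RtoC_inj in h; lra).
  rewrite RtoC_div, !RtoC_mult, !RtoC_pow, RtoC_opp by apply phi_coef_denom.
  field. repeat split; rewrite <- ?RtoC_pow; intros h; apply RtoC_inj in h; revert h; try apply INR_fact_neq_0.
  apply pow_nonzero; lra.
- apply Csum_scal, phi_Csum.
Qed.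

Lemma BesselJ_nat_derive_S n z :
  Cder (BesselJ_nat (S n)) z ((BesselJ_nat n z - BesselJ_nat (S (S n)) z) / 2).
Proof.
apply (Cder_ext (fun x => (/ 2 * x) ^ S n * phi (S n) (x * x))).
{ intros x. rewrite BesselJ_nat_phi. f_equal. f_equal. field. }
eapply Cder_eq.
- apply Cder_mult.
  + apply (Cder_comp (fun x => x ^ S n) (fun x => / 2 * x)); [apply Cpow_derive|].
    apply Cder_scal, Cder_id.
  + apply (Cder_comp (phi (S n)) (fun x => x * x)); [apply phi_derive | apply Cder_sqr].
- cbv beta. rewrite !BesselJ_nat_phi. simpl pred.
  replace (/ 2 * z) with (z / 2) by field. rewrite !Cpow_S.
  replace (phi n (z * z)) with (INR (S n) * phi (S n) (z * z) - z * z / 4 * phi (S (S n)) (z * z))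
    by (rewrite <- phi_rec; ring).
  field.
Qed.

Lemma BesselJ_nat_derive_0 z : Cder (BesselJ_nat 0) z (- BesselJ_nat 1 z).
Proof.
apply (Cder_ext (fun x => phi 0 (x * x))).
{ intros x. rewrite BesselJ_nat_phi. simpl. ring. }
eapply Cder_eq.
- apply (Cder_comp (phi 0) (fun x => x * x)); [apply phi_derive | apply Cder_sqr].
- cbv beta. rewrite BesselJ_nat_phi. simpl. field.
Qed.

Lemma BesselJ_nat_rec n z :
  z * (BesselJ_nat n z + BesselJ_nat (S (S n)) z) = 2 * INR (S n) * BesselJ_nat (S n) z.
Proof.
rewrite !BesselJ_nat_phi, !Cpow_S.
replace (2 * INR (S n) * (z / 2 * (z / 2) ^ n * phi (S n) (z * z))) with
  (2 * (z / 2 * (z / 2) ^ n) * (INR (S n) * phi (S n) (z * z))) by ring.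
rewrite <- phi_rec. field.
Qed.

Lemma BesselJ_of_nat n z : BesselJ (Z.of_nat n) z = BesselJ_nat n z.
Proof.
unfold BesselJ. rewrite (proj2 (Z.leb_le _ _)) by lia. now rewrite Nat2Z.id.
Qed.

Lemma BesselJ_opp_nat n z : BesselJ (- Z.of_nat n) z = (- (1)) ^ n * BesselJ_nat n z.
Proof.
destruct n as [|n].
- rewrite (BesselJ_of_nat 0). simpl. ring.
- unfold BesselJ. rewrite (proj2 (Z.leb_gt _ _)) by lia.
  now rewrite Z.opp_involutive, Nat2Z.id.
Qed.

Lemma BesselJ_nat_Cder_ext (n : Z) (m : nat) (c : C) z l :
  (forall x, BesselJ n x = c * BesselJ_nat m x) ->
  Cder (BesselJ_nat m) z l -> Cder (BesselJ n) z (c * l).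
Proof.
intros E H. apply (Cder_ext (fun x => c * BesselJ_nat m x)); [intros x; now rewrite E|].
now apply Cder_scal.
Qed.

Lemma BesselJ_derive (n : Z) z :
  Cder (BesselJ n) z ((BesselJ (n - 1) z - BesselJ (n + 1) z) / 2).
Proof.
destruct (Z.lt_trichotomy n 0) as [H|[->|H]].
- destruct (Z_of_nat_complete (- n - 1)) as [m Hm]; [lia|].
  assert (E : n = (- Z.of_nat (S m))%Z) by lia. clear H Hm. subst n.
  eapply Cder_eq.
  + apply (BesselJ_nat_Cder_ext _ (S m) ((- (1)) ^ S m)); [apply BesselJ_opp_nat|].
    apply BesselJ_nat_derive_S.
  + replace (- Z.of_nat (S m) - 1)%Z with (- Z.of_nat (S (S m)))%Z by lia.
    replace (- Z.of_nat (S m) + 1)%Z with (- Z.of_nat m)%Z by lia.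
    rewrite !BesselJ_opp_nat, !Cpow_S. field.
- eapply Cder_eq.
  + apply (BesselJ_nat_Cder_ext _ 0 1); [intros x; rewrite (BesselJ_of_nat 0); ring|].
    apply BesselJ_nat_derive_0.
  + change (0 - 1)%Z with (- Z.of_nat 1)%Z. change (0 + 1)%Z with (Z.of_nat 1).
    rewrite BesselJ_opp_nat, BesselJ_of_nat. simpl. field.
- destruct (Z_of_nat_complete (n - 1)) as [m Hm]; [lia|].
  assert (E : n = Z.of_nat (S m)) by lia. clear H Hm. subst n.
  eapply Cder_eq.
  + apply (BesselJ_nat_Cder_ext _ (S m) 1); [intros x; rewrite BesselJ_of_nat; ring|].
    apply BesselJ_nat_derive_S.
  + replace (Z.of_nat (S m) - 1)%Z with (Z.of_nat m)%Z by lia.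
    replace (Z.of_nat (S m) + 1)%Z with (Z.of_nat (S (S m)))%Z by lia.
    rewrite !BesselJ_of_nat. field.
Qed.

Lemma BesselJ_rec (n : Z) z :
  z * (BesselJ (n - 1) z + BesselJ (n + 1) z) = 2 * IZR n * BesselJ n z.
Proof.
destruct (Z.lt_trichotomy n 0) as [H|[->|H]].
- destruct (Z_of_nat_complete (- n - 1)) as [m Hm]; [lia|].
  assert (E : n = (- Z.of_nat (S m))%Z) by lia. clear H Hm. subst n.
  replace (- Z.of_nat (S m) - 1)%Z with (- Z.of_nat (S (S m)))%Z by lia.
  replace (- Z.of_nat (S m) + 1)%Z with (- Z.of_nat m)%Z by lia.
  rewrite opp_IZR, <- INR_IZR_INZ, RtoC_opp.
  rewrite !BesselJ_opp_nat, !Cpow_S.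
  replace (2 * - INR (S m) * (- (1) * (- (1)) ^ m * BesselJ_nat (S m) z)) with
    ((- (1)) ^ m * (2 * INR (S m) * BesselJ_nat (S m) z)) by ring.
  rewrite <- BesselJ_nat_rec. ring.
- change (0 - 1)%Z with (- Z.of_nat 1)%Z. change (0 + 1)%Z with (Z.of_nat 1).
  rewrite BesselJ_opp_nat, BesselJ_of_nat. simpl. ring.
- destruct (Z_of_nat_complete (n - 1)) as [m Hm]; [lia|].
  assert (E : n = Z.of_nat (S m)) by lia. clear H Hm. subst n.
  replace (Z.of_nat (S m) - 1)%Z with (Z.of_nat m)%Z by lia.
  replace (Z.of_nat (S m) + 1)%Z with (Z.of_nat (S (S m)))%Z by lia.
  rewrite <- INR_IZR_INZ, !BesselJ_of_nat. apply BesselJ_nat_rec.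
Qed.

Lemma dJ_BesselJ (n : Z) z : dJ n z = (BesselJ (n - 1) z - BesselJ (n + 1) z) / 2.
Proof. apply is_C_derive_unique, BesselJ_derive. Qed.

Lemma BesselJ_Cder (n : Z) z : Cder (BesselJ n) z (dJ n z).
Proof. rewrite dJ_BesselJ. apply BesselJ_derive. Qed.

Lemma dJ_derive (n : Z) z :
  Cder (dJ n) z ((BesselJ (n - 2) z - 2 * BesselJ n z + BesselJ (n + 2) z) / 4).
Proof.
apply (Cder_ext (fun x => / 2 * (BesselJ (n - 1) x - BesselJ (n + 1) x))).
{ intros x. rewrite dJ_BesselJ. field. }
eapply Cder_eq; [apply Cder_scal, Cder_minus; apply BesselJ_derive|].
replace (n - 1 - 1)%Z with (n - 2)%Z by lia. replace (n - 1 + 1)%Z with n by lia.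
replace (n + 1 - 1)%Z with n by lia. replace (n + 1 + 1)%Z with (n + 2)%Z by lia.
field.
Qed.

Lemma ddJ_BesselJ (n : Z) z :
  ddJ n z = (BesselJ (n - 2) z - 2 * BesselJ n z + BesselJ (n + 2) z) / 4.
Proof. apply is_C_derive_unique, dJ_derive. Qed.

Lemma dJ_Cder (n : Z) z : Cder (dJ n) z (ddJ n z).
Proof. rewrite ddJ_BesselJ. apply dJ_derive. Qed.

Lemma Bessel_ode (n : Z) z :
  z * z * ddJ n z + z * dJ n z + (z * z - IZR n * IZR n) * BesselJ n z = 0.
Proof.
rewrite ddJ_BesselJ, dJ_BesselJ.
pose proof (BesselJ_rec n z) as h0.
pose proof (BesselJ_rec (n - 1) z) as h1. pose proof (BesselJ_rec (n + 1) z) as h2.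
replace (n - 1 - 1)%Z with (n - 2)%Z in h1 by lia. replace (n - 1 + 1)%Z with n in h1 by lia.
replace (n + 1 - 1)%Z with n in h2 by lia. replace (n + 1 + 1)%Z with (n + 2)%Z in h2 by lia.
rewrite minus_IZR, RtoC_minus in h1. rewrite plus_IZR, RtoC_plus in h2.
set (a := BesselJ (n - 2) z) in *. set (b := BesselJ (n - 1) z) in *.
set (c := BesselJ n z) in *. set (d := BesselJ (n + 1) z) in *. set (e := BesselJ (n + 2) z) in *.
set (N := RtoC (IZR n)) in *.
(* The left side is a combination of the three-term recurrences at the orders [n - 1], [n + 1] and
   [n]. *)
replace (z * z * ((a - 2 * c + e) / 4) + z * ((b - d) / 2) + (z * z - N * N) * c) with
  (/ 4 * (z * (z * (a + c) - 2 * (N - 1) * b) + z * (z * (c + e) - 2 * (N + 1) * d)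
   + 2 * N * (z * (b + d) - 2 * N * c))) by field.
rewrite h0, h1, h2. ring.
Qed.

Lemma BesselJ_nat_entire n : entire (BesselJ_nat n).
Proof.
apply (entire_ext (fun z => z ^ n * ((/ 2) ^ n * phi n (z * z)))).
- intros z. rewrite BesselJ_nat_phi. unfold Cdiv. rewrite Cpow_mult_l. ring.
- apply entire_mul_pow, entire_scal, (entire_sqr (phi n)), phi_entire.
Qed.

Lemma BesselJ_entire (n : Z) : entire (BesselJ n).
Proof.
destruct (Z_le_gt_dec 0 n) as [H|H].
- rewrite <- (Z2Nat.id n H).
  apply (entire_ext (BesselJ_nat (Z.to_nat n))); [intros z; now rewrite BesselJ_of_nat|].
  apply BesselJ_nat_entire.
- replace n with (- Z.of_nat (Z.to_nat (- n)))%Z by lia.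
  eapply entire_ext; [intros z; symmetry; apply BesselJ_opp_nat|].
  apply entire_scal, BesselJ_nat_entire.
Qed.

Lemma dJ_entire (n : Z) : entire (dJ n).
Proof.
apply (entire_ext (fun x => / 2 * (BesselJ (n - 1) x - BesselJ (n + 1) x))).
{ intros x. rewrite dJ_BesselJ. field. }
apply entire_scal, entire_minus; apply BesselJ_entire.
Qed.

Lemma BesselJ_nat_opp n z : BesselJ_nat n (- z) = (- (1)) ^ n * BesselJ_nat n z.
Proof.
rewrite !BesselJ_nat_phi. replace (- z * - z) with (z * z) by ring.
replace (- z / 2) with (- (1) * (z / 2)) by field. rewrite Cpow_mult_l. ring.
Qed.

Lemma Bessel_parity (n : nat) : exists s : C, (s = 1 \/ s = - (1)) /\ forall z,
  BesselJ (Z.of_nat n) (- z) = s * BesselJ (Z.of_nat n) z /\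
  dJ (Z.of_nat n) (- z) = - s * dJ (Z.of_nat n) z /\
  ddJ (Z.of_nat n) (- z) = s * ddJ (Z.of_nat n) z.
Proof.
set (N := Z.of_nat n). exists ((- (1)) ^ n). split.
{ induction n as [|n [IH|IH]]; simpl; rewrite ?IH.
  - now left.
  - right. ring.
  - left. ring. }
set (s := (- (1)) ^ n).
assert (H0 : forall z, BesselJ N (- z) = s * BesselJ N z).
{ intros z. unfold N. rewrite !BesselJ_of_nat. apply BesselJ_nat_opp. }
assert (Hopp : forall z, Cder (fun x => - x) z (- (1))) by (intros z; apply Cder_opp, Cder_id).
assert (H1 : forall z, dJ N (- z) = - s * dJ N z).
{ intros z. assert (h : - dJ N (- z) = s * dJ N z).
  { apply (Cder_unique (fun x => BesselJ N (- x)) z).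
    - eapply Cder_eq; [apply (Cder_comp (BesselJ N) (fun x => - x)); [apply BesselJ_Cder | apply Hopp]|]. ring.
    - apply (Cder_ext (fun x => s * BesselJ N x)); [easy|]. apply Cder_scal, BesselJ_Cder. }
  replace (dJ N (- z)) with (- - dJ N (- z)) by ring. rewrite h. ring. }
intros z. split; [easy|]. split; [easy|].
assert (h : - ddJ N (- z) = - s * ddJ N z).
{ apply (Cder_unique (fun x => dJ N (- x)) z).
  - eapply Cder_eq; [apply (Cder_comp (dJ N) (fun x => - x)); [apply dJ_Cder | apply Hopp]|]. ring.
  - apply (Cder_ext (fun x => - s * dJ N x)); [easy|]. apply Cder_scal, dJ_Cder. }
replace (ddJ N (- z)) with (- - ddJ N (- z)) by ring. rewrite h. ring.
Qed.

Lemma BesselJ_nat_real n (x : R) : Im (BesselJ_nat n x) = 0%R.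
Proof.
rewrite BesselJ_nat_phi. rewrite <- RtoC_mult.
replace (RtoC x / 2) with (RtoC (x / 2)) by (apply RtoC_div; lra).
rewrite <- RtoC_pow. rewrite im_scal_l, phi_real. ring.
Qed.

Lemma BesselJ_real (n : nat) (x : R) :
  Im (BesselJ (Z.of_nat n) x) = 0%R /\ Im (dJ (Z.of_nat n) x) = 0%R.
Proof.
split; [rewrite BesselJ_of_nat; apply BesselJ_nat_real|].
rewrite dJ_BesselJ. unfold Cdiv. replace (/ 2) with (RtoC (/ 2)) by (apply RtoC_inv; lra).
rewrite Cmult_comm, im_scal_l.
replace (Z.of_nat n + 1)%Z with (Z.of_nat (S n)) by lia. rewrite BesselJ_of_nat.
assert (h : Im (BesselJ (Z.of_nat n - 1) x) = 0%R).
{ destruct n as [|n].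
  - change (Z.of_nat 0 - 1)%Z with (- Z.of_nat 1)%Z. rewrite BesselJ_opp_nat.
    replace ((- (1)) ^ 1) with (RtoC (Ropp 1)) by (rewrite RtoC_opp; simpl; ring).
    rewrite im_scal_l, BesselJ_nat_real. ring.
  - replace (Z.of_nat (S n) - 1)%Z with (Z.of_nat n) by lia. rewrite BesselJ_of_nat. apply BesselJ_nat_real. }
unfold Cminus. rewrite im_plus, im_opp, h, BesselJ_nat_real. ring.
Qed.

Lemma BesselJ_zero_order (n : nat) : exists g, entire g /\ g 0 <> 0 /\
  forall z, BesselJ (Z.of_nat n) z = z ^ n * g z.
Proof.
exists (fun z => (/ 2) ^ n * phi n (z * z)). split; [|split].
- apply entire_scal, (entire_sqr (phi n)), phi_entire.
- rewrite Cmult_0_l, phi_0. apply Cmult_neq_0.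
  + apply Cpow_nz. intros h. apply (f_equal (fun c => c * 2)) in h.
    rewrite Cinv_l in h; [|intros h'; apply RtoC_inj in h'; lra].
    rewrite Cmult_0_l in h. apply RtoC_inj in h. lra.
  + intros h. apply RtoC_inj in h. revert h. apply Rinv_neq_0_compat, INR_fact_neq_0.
- intros z. rewrite BesselJ_of_nat, BesselJ_nat_phi. unfold Cdiv. rewrite Cpow_mult_l. ring.
Qed.

(** For order at least 1 this gives the exact order of the pole of [1 / J'] at 0, and the cofactor
    [g] whose reciprocal supplies its Laurent coefficients. *)
Lemma dJ_zero_order (n : nat) : exists g, entire g /\ g 0 <> 0 /\
  forall z, dJ (Z.of_nat (S n)) z = z ^ n * g z.
Proof.
destruct (BesselJ_zero_order n) as [g [Hg [Hg0 E]]].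
destruct (BesselJ_zero_order (S (S n))) as [h [Hh [_ Eh]]].
exists (fun z => / 2 * g z + (- / 2) * (z * (z * h z))). split; [|split].
- apply entire_lin; [easy|]. now do 2 apply entire_mul_id.
- replace (/ 2 * g 0 + - / 2 * (0 * (0 * h 0))) with (/ 2 * g 0) by ring.
  intros h0. apply Hg0. replace (g 0) with (2 * (/ 2 * g 0)) by field. rewrite h0. ring.
- intros z. rewrite dJ_BesselJ.
  replace (Z.of_nat (S n) - 1)%Z with (Z.of_nat n) by lia.
  replace (Z.of_nat (S n) + 1)%Z with (Z.of_nat (S (S n))) by lia.
  rewrite E, Eh, !Cpow_S. field.
Qed.

(** For order 0 the origin is a simple zero of [J'] with [J'' = - 1/2]; the residue [1 / (- 1/2)] is
    the [-2] in both [A0_num] and [A0_den]. *)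
Lemma Bessel0_at_0 : BesselJ 0 0 = 1 /\ dJ 0 0 = 0 /\ ddJ 0 0 = - / 2.
Proof.
assert (h0 : BesselJ_nat 0 0 = 1).
{ rewrite BesselJ_nat_phi, Cmult_0_l, phi_0. simpl. rewrite Rinv_1. ring. }
assert (hS : forall n, BesselJ_nat (S n) 0 = 0).
{ intros n. rewrite BesselJ_nat_phi. simpl. field. }
split; [|split].
- now rewrite (BesselJ_of_nat 0).
- rewrite dJ_BesselJ. change (0 - 1)%Z with (- Z.of_nat 1)%Z. change (0 + 1)%Z with (Z.of_nat 1).
  rewrite BesselJ_opp_nat, BesselJ_of_nat, hS. field.
- rewrite ddJ_BesselJ. change (0 - 2)%Z with (- Z.of_nat 2)%Z. change (0 + 2)%Z with (Z.of_nat 2).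
  rewrite BesselJ_opp_nat, BesselJ_of_nat, (BesselJ_of_nat 0), hS, h0. field.
Qed.

(** * Integrals over squares *)

Local Open Scope R_scope.

Lemma Rder_mult (f g : R -> R) x a b :
  is_derive f x a -> is_derive g x b -> is_derive (fun t => f t * g t) x (a * g x + f x * b).
Proof.
intros Hf Hg. apply (is_derive_mult (K := R_AbsRing) f g x a b Hf Hg). intros; apply Rmult_comm.
Qed.

Lemma Rder_plus (f g : R -> R) x a b :
  is_derive f x a -> is_derive g x b -> is_derive (fun t => f t + g t) x (a + b).
Proof. exact (is_derive_plus (K := R_AbsRing) (V := R_NormedModule) f g x a b). Qed.

Lemma Rder_minus (f g : R -> R) x a b :
  is_derive f x a -> is_derive g x b -> is_derive (fun t => f t - g t) x (a - b).
Proof. exact (is_derive_minus (K := R_AbsRing) (V := R_NormedModule) f g x a b). Qed.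

Lemma Rder_id (x : R) : is_derive (fun t => t) x 1.
Proof. apply (is_derive_id (K := R_AbsRing)). Qed.

Lemma Rder_const (c x : R) : is_derive (fun _ => c) x 0.
Proof. apply (is_derive_const (K := R_AbsRing) (V := R_NormedModule)). Qed.

Lemma Rder_exp_scal (c x : R) : is_derive (fun t => exp (c * t)) x (c * exp (c * x)).
Proof. auto_derive; [easy | ring]. Qed.

Local Open Scope C_scope.

Definition CInt (f : R -> C) : C :=
  (RInt (fun t => Re (f t)) (-1) 1, RInt (fun t => Im (f t)) (-1) 1).

Definition Ccont_on (f : R -> C) : Prop :=
  forall t : R, (-1 <= t <= 1)%R -> continuous (T := R_UniformSpace) (U := C_UniformSpace) f t.

Lemma ex_RInt_Re f : Ccont_on f -> ex_RInt (fun t => Re (f t)) (-1) 1.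
Proof.
intros H. apply (ex_RInt_continuous (V := R_CompleteNormedModule)). intros t Ht.
rewrite Rmin_left, Rmax_right in Ht by lra. now apply continuous_Re, H.
Qed.

Lemma ex_RInt_Im f : Ccont_on f -> ex_RInt (fun t => Im (f t)) (-1) 1.
Proof.
intros H. apply (ex_RInt_continuous (V := R_CompleteNormedModule)). intros t Ht.
rewrite Rmin_left, Rmax_right in Ht by lra. now apply continuous_Im, H.
Qed.

Lemma CInt_ext f g : (forall t : R, (-1 <= t <= 1)%R -> f t = g t) -> CInt f = CInt g.
Proof.
intros H. unfold CInt. f_equal; apply RInt_ext; intros t Ht;
rewrite Rmin_left, Rmax_right in Ht by lra; rewrite H; easy || lra.
Qed.

Lemma CInt_plus f g : Ccont_on f -> Ccont_on g -> CInt (fun t => f t + g t) = CInt f + CInt g.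
Proof.
intros Hf Hg. unfold CInt, Cplus. simpl. f_equal.
- apply (RInt_plus (V := R_CompleteNormedModule) (fun t => Re (f t)) (fun t => Re (g t)) (-1) 1);
  now apply ex_RInt_Re.
- apply (RInt_plus (V := R_CompleteNormedModule) (fun t => Im (f t)) (fun t => Im (g t)) (-1) 1);
  now apply ex_RInt_Im.
Qed.

Lemma CInt_scal (c : C) f : Ccont_on f -> CInt (fun t => c * f t) = c * CInt f.
Proof.
intros Hf. pose proof (ex_RInt_Re f Hf) as h1. pose proof (ex_RInt_Im f Hf) as h2.
unfold CInt, Cmult. simpl. f_equal.
- eapply eq_trans.
  + apply (RInt_minus (V := R_CompleteNormedModule)
      (fun t => scal (fst c) (Re (f t))) (fun t => scal (snd c) (Im (f t))));
    now apply (ex_RInt_scal (V := R_NormedModule)).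
  + rewrite !(RInt_scal (V := R_CompleteNormedModule)) by easy. reflexivity.
- eapply eq_trans.
  + apply (RInt_plus (V := R_CompleteNormedModule)
      (fun t => scal (fst c) (Im (f t))) (fun t => scal (snd c) (Re (f t))));
    now apply (ex_RInt_scal (V := R_NormedModule)).
  + rewrite !(RInt_scal (V := R_CompleteNormedModule)) by easy. reflexivity.
Qed.

(** The two components are bounded separately, whence the factor 2. *)
Lemma CInt_Cmod_le f (B : R -> R) (I : R) :
  Ccont_on f -> is_RInt B (-1) 1 I -> (forall t : R, (-1 <= t <= 1)%R -> (Cmod (f t) <= B t)%R) ->
  (Cmod (CInt f) <= 2 * I)%R.
Proof.
intros Hf HB H.
assert (hRe : (Rabs (RInt (fun t => Re (f t)) (-1) 1) <= I)%R).
{ apply (norm_RInt_le (V := R_NormedModule) (fun t => Re (f t)) B (-1) 1); [lra| |now apply (RInt_correct (V := R_CompleteNormedModule)), ex_RInt_Re|easy].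
  intros t Ht. apply Rle_trans with (2 := H t Ht). apply re_le_Cmod. }
assert (hIm : (Rabs (RInt (fun t => Im (f t)) (-1) 1) <= I)%R).
{ apply (norm_RInt_le (V := R_NormedModule) (fun t => Im (f t)) B (-1) 1); [lra| |now apply (RInt_correct (V := R_CompleteNormedModule)), ex_RInt_Im|easy].
  intros t Ht. apply Rle_trans with (2 := H t Ht).
  apply Rle_trans with (2 := Rmax_Cmod _). apply Rmax_r. }
set (x := RInt (fun t => Re (f t)) (-1) 1) in *. set (y := RInt (fun t => Im (f t)) (-1) 1) in *.
change (CInt f) with ((x, y) : C).
replace ((x, y) : C) with (RtoC x + Ci * RtoC y) by (unfold Cplus, Cmult, Ci, RtoC; simpl; f_equal; ring).
apply Rle_trans with (1 := Cmod_triangle _ _). rewrite Cmod_mult, Cmod_Ci, !Cmod_R. lra.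
Qed.

(* The side of the square [|Re|, |Im| <= rho] whose midpoint is [rho u], for [u] a fourth root of unity. *)
Definition side (rho : R) (u : C) (t : R) : C := rho * u + t * (rho * u * Ci).

Definition unit4 (u : C) : Prop := u = 1 \/ u = Ci \/ u = - (1) \/ u = - Ci.

Definition on_square (rho : R) (z : C) : Prop :=
  exists u t, unit4 u /\ (-1 <= t <= 1)%R /\ z = side rho u t.

(** All four sides share the parameter [t], so the closed counterclockwise contour is one integral
    over [[-1, 1]]; [rho * u * Ci] is the derivative of [side rho u]. *)
Definition contour_term (rho : R) (h : C -> C) (t : R) : C :=
  (h (side rho 1 t) * (rho * 1 * Ci) + h (side rho Ci t) * (rho * Ci * Ci))
  + (h (side rho (- (1)) t) * (rho * - (1) * Ci) + h (side rho (- Ci) t) * (rho * - Ci * Ci)).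

Definition contour (rho : R) (h : C -> C) : C := CInt (contour_term rho h).

Lemma continuous_affine (a b : C) (t : R) :
  continuous (T := R_UniformSpace) (U := C_UniformSpace) (fun t : R => a + t * b) t.
Proof.
apply continuous_Cplus; [apply continuous_Cconst|].
apply continuous_Cmult; [|apply continuous_Cconst].
apply continuous_RtoC, continuous_id.
Qed.

Lemma unit4_on_square rho u t : unit4 u -> (-1 <= t <= 1)%R -> on_square rho (side rho u t).
Proof. intros Hu Ht. now exists u, t. Qed.

Lemma Ci_sqr : Ci * Ci = - (1).
Proof. unfold Ci, Cmult, Copp. simpl. f_equal; ring. Qed.

Lemma unit4_1 : unit4 1. Proof. now left. Qed.
Lemma unit4_i : unit4 Ci. Proof. now right; left. Qed.
Lemma unit4_m1 : unit4 (- (1)). Proof. now right; right; left. Qed.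
Lemma unit4_mi : unit4 (- Ci). Proof. now right; right; right. Qed.

Lemma contour_term_cont rho h : (forall z, on_square rho z -> cont h z) -> Ccont_on (contour_term rho h).
Proof.
intros H t Ht.
assert (A : forall u b, unit4 u ->
  continuous (T := R_UniformSpace) (U := C_UniformSpace) (fun t : R => h (side rho u t) * b) t).
{ intros u b Hu. apply continuous_Cmult; [|apply continuous_Cconst].
  apply (continuous_comp (U := R_UniformSpace) (V := C_UniformSpace) (W := C_UniformSpace) (side rho u) h); [apply continuous_affine|].
  apply H. now apply unit4_on_square. }
apply continuous_Cplus; apply continuous_Cplus; apply A;
[apply unit4_1|apply unit4_i|apply unit4_m1|apply unit4_mi].
Qed.

Lemma contour_ext rho h g : (forall z, on_square rho z -> h z = g z) -> contour rho h = contour rho g.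
Proof.
intros H. apply CInt_ext. intros t Ht. unfold contour_term.
rewrite !H; [easy|..]; apply unit4_on_square; try easy;
[apply unit4_mi|apply unit4_m1|apply unit4_i|apply unit4_1].
Qed.

Lemma contour_plus rho h g :
  (forall z, on_square rho z -> cont h z) -> (forall z, on_square rho z -> cont g z) ->
  contour rho (fun z => h z + g z) = contour rho h + contour rho g.
Proof.
intros Hh Hg. unfold contour.
rewrite <- CInt_plus by (now apply contour_term_cont).
apply CInt_ext. intros t Ht. unfold contour_term. ring.
Qed.

Lemma contour_scal rho c h :
  (forall z, on_square rho z -> cont h z) -> contour rho (fun z => c * h z) = c * contour rho h.
Proof.
intros Hh. unfold contour.
rewrite <- CInt_scal by (now apply contour_term_cont).
apply CInt_ext. intros t Ht. unfold contour_term. ring.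
Qed.

Lemma contour_minus rho h g :
  (forall z, on_square rho z -> cont h z) -> (forall z, on_square rho z -> cont g z) ->
  contour rho (fun z => h z - g z) = contour rho h - contour rho g.
Proof.
intros Hh Hg.
rewrite (contour_ext rho _ (fun z => h z + (- (1)) * g z)) by (intros; ring).
rewrite contour_plus; [rewrite contour_scal by easy; ring|easy|].
intros z Hz. apply continuous_Cmult; [apply continuous_Cconst | now apply Hg].
Qed.

Lemma contour_Cmod_le rho h (B : R -> R) I :
  (0 <= rho)%R -> (forall z, on_square rho z -> cont h z) -> is_RInt B (-1) 1 I ->
  (forall u t, unit4 u -> (-1 <= t <= 1)%R -> (Cmod (h (side rho u t)) <= B t)%R) ->
  (Cmod (contour rho h) <= 8 * rho * I)%R.
Proof.
intros Hr Hh HB H.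
replace (8 * rho * I)%R with (2 * (4 * rho * I))%R by ring.
apply (CInt_Cmod_le _ (fun t => 4 * rho * B t)%R).
- now apply contour_term_cont.
- exact (is_RInt_scal (V := R_NormedModule) B (-1) 1 (4 * rho)%R I HB).
- intros t Ht. unfold contour_term.
  assert (A : forall u, unit4 u -> (Cmod (h (side rho u t) * (rho * u * Ci)) <= rho * B t)%R).
  { intros u Hu. rewrite !Cmod_mult, Cmod_Ci, Cmod_R, Rabs_pos_eq by easy.
    replace (Cmod u) with 1%R.
    - pose proof (H u t Hu Ht). nra.
    - destruct Hu as [->|[->|[->| ->]]]; rewrite ?Cmod_opp, ?Cmod_1, ?Cmod_Ci; easy. }
  pose proof (A _ unit4_1). pose proof (A _ unit4_i). pose proof (A _ unit4_m1). pose proof (A _ unit4_mi).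
  apply Rle_trans with (1 := Cmod_triangle _ _).
  eapply Rle_trans; [apply Rplus_le_compat; apply Cmod_triangle|]. lra.
Qed.

Lemma contour_exact rho H h :
  (forall z, on_square rho z -> Cder H z (h z)) -> (forall z, on_square rho z -> cont h z) ->
  contour rho h = 0.
Proof.
intros HH Hh.
set (F := fun t : R => (H (side rho 1 t) + H (side rho Ci t)) + (H (side rho (- (1)) t) + H (side rho (- Ci) t))).
assert (HF : F 1%R = F (-1)%R).
(* The end of side [u] is the start of side [Ci * u], so the corner values cancel around the
   square. *)
{ assert (E : forall u, side rho (Ci * u) (-1) = side rho u 1).
  { intros u. unfold side. replace (RtoC (-1)) with (- (1)) by (rewrite <- RtoC_opp; f_equal; lra).
    replace (- (1) * (rho * (Ci * u) * Ci)) with (- (Ci * Ci) * (rho * u)) by ring.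
    rewrite Ci_sqr. ring. }
  unfold F. rewrite <- !E.
  replace (Ci * 1) with Ci by ring. replace (Ci * - Ci) with (- (Ci * Ci)) by ring.
  replace (Ci * - (1)) with (- Ci) by ring. rewrite Ci_sqr. replace (- - (1)) with (RtoC 1) by ring. ring. }
assert (HD : forall u t, unit4 u -> (-1 <= t <= 1)%R ->
  is_derive (fun t : R => Re (H (side rho u t))) t (Re (h (side rho u t) * (rho * u * Ci))) /\
  is_derive (fun t : R => Im (H (side rho u t))) t (Im (h (side rho u t) * (rho * u * Ci)))).
{ intros u t Hu Ht. apply (Cder_path H (rho * u) (rho * u * Ci) t). apply HH. now apply unit4_on_square. }
pose proof (contour_term_cont rho h Hh) as Hc.
assert (A : forall pr, pr = Re \/ pr = Im -> is_RInt (fun t => pr (contour_term rho h t)) (-1) 1 0%R).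
{ intros pr Hpr. replace 0%R with (minus (pr (F 1%R)) (pr (F (-1)%R))).
  2:{ rewrite HF. apply (minus_eq_zero (G := R_AbelianGroup)). }
  apply (is_RInt_derive (V := R_CompleteNormedModule) (fun t => pr (F t)));
  intros t Ht; rewrite Rmin_left, Rmax_right in Ht by lra.
  - destruct Hpr as [-> | ->]; apply Rder_plus; apply Rder_plus; apply HD; try easy;
    first [apply unit4_1|apply unit4_i|apply unit4_m1|apply unit4_mi].
  - destruct Hpr as [-> | ->]; [apply continuous_Re | apply continuous_Im]; now apply Hc. }
apply (f_equal2 (@pair R R)); apply is_RInt_unique; apply A; [now left | now right].
Qed.

(* Clamping makes the integrand of a parametric integral over [-1,1] continuous past the end points,
   as [is_derive_RInt_param] demands. *)
Definition clamp (t : R) : R := ((Rabs (t + 1) - Rabs (t - 1)) / 2)%R.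

Lemma clamp_id t : (-1 <= t <= 1)%R -> clamp t = t.
Proof. intros H. unfold clamp. rewrite (Rabs_pos_eq (t + 1)), (Rabs_left1 (t - 1)) by lra. field. Qed.

Lemma clamp_range t : (-1 <= clamp t <= 1)%R.
Proof. unfold clamp. unfold Rabs. destruct (Rcase_abs (t + 1)), (Rcase_abs (t - 1)); lra. Qed.

Lemma clamp_continuous t : continuous clamp t.
Proof.
unfold clamp. apply (continuous_mult (K := R_AbsRing)); [|apply continuous_const].
apply (continuous_minus (V := R_NormedModule)); apply continuous_Rabs_comp.
- apply (continuous_plus (V := R_NormedModule)); [apply continuous_id | apply continuous_const].
- apply (continuous_minus (V := R_NormedModule)); [apply continuous_id | apply continuous_const].
Qed.

Lemma is_derive_Re_scal_r (f : R -> C) s (l b : C) :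
  is_derive (fun s => Re (f s)) s (Re l) -> is_derive (fun s => Im (f s)) s (Im l) ->
  is_derive (fun s => Re (f s * b)) s (Re (l * b)) /\ is_derive (fun s => Im (f s * b)) s (Im (l * b)).
Proof.
intros H1 H2. split.
- apply (is_derive_ext (fun s => Re b * Re (f s) - Im b * Im (f s))%R).
  { intros t. destruct (f t), b. simpl. ring. }
  replace (Re (l * b)) with (Re b * Re l - Im b * Im l)%R by (destruct l, b; simpl; ring).
  apply Rder_minus; now apply is_derive_scal.
- apply (is_derive_ext (fun s => Im b * Re (f s) + Re b * Im (f s))%R).
  { intros t. destruct (f t), b. simpl. ring. }
  replace (Im (l * b)) with (Im b * Re l + Re b * Im l)%R by (destruct l, b; simpl; ring).
  apply Rder_plus; now apply is_derive_scal.
Qed.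

(** * Differentiation of a contour integral in a parameter *)

Section Param.
Variables (rho : R) (k kd : R -> C -> C) (s0 : R) (eps : posreal).
Hypothesis Hder : forall s z, (Rabs (s - s0) < eps)%R -> on_square rho z ->
  is_derive (fun s => Re (k s z)) s (Re (kd s z)) /\ is_derive (fun s => Im (k s z)) s (Im (kd s z)).
Hypothesis Hcont : forall s z, (Rabs (s - s0) < eps)%R -> on_square rho z -> cont (k s) z.
Hypothesis Hjoint : forall z, on_square rho z ->
  continuous (T := prod_UniformSpace R_UniformSpace C_UniformSpace) (U := C_UniformSpace)
    (fun p => kd (fst p) (snd p)) (s0, z).

Let on_clamp u t : unit4 u -> on_square rho (side rho u (clamp t)).
Proof. intros Hu. apply unit4_on_square; [easy | apply clamp_range]. Qed.

Let term_derive s t : (Rabs (s - s0) < eps)%R -> forall pr, pr = Re \/ pr = Im ->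
  is_derive (fun s => pr (contour_term rho (k s) (clamp t))) s (pr (contour_term rho (kd s) (clamp t))).
Proof.
intros Hs.
assert (A : forall u b, unit4 u ->
  is_derive (fun s => Re (k s (side rho u (clamp t)) * b)) s (Re (kd s (side rho u (clamp t)) * b)) /\
  is_derive (fun s => Im (k s (side rho u (clamp t)) * b)) s (Im (kd s (side rho u (clamp t)) * b))).
{ intros u b Hu. apply is_derive_Re_scal_r; now apply Hder, on_clamp. }
intros pr [-> | ->]; apply Rder_plus; apply Rder_plus; apply A;
first [apply unit4_1|apply unit4_i|apply unit4_m1|apply unit4_mi].
Qed.

Let term_continuous t :
  continuous (T := prod_UniformSpace R_UniformSpace R_UniformSpace) (U := C_UniformSpace)
    (fun p => contour_term rho (kd (fst p)) (clamp (snd p))) (s0, t).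
Proof.
set (U := prod_UniformSpace R_UniformSpace R_UniformSpace).
assert (Hcl : continuous (T := U) (fun p => clamp (snd p)) (s0, t)).
{ apply (continuous_comp (U := U) (V := R_UniformSpace) snd clamp); [apply continuous_snd | apply clamp_continuous]. }
assert (A : forall u b, unit4 u -> continuous (T := U) (U := C_UniformSpace)
  (fun p => kd (fst p) (side rho u (clamp (snd p))) * b) (s0, t)).
{ intros u b Hu. apply continuous_Cmult; [|apply continuous_Cconst].
  apply (continuous_comp (U := U) (V := prod_UniformSpace R_UniformSpace C_UniformSpace) (W := C_UniformSpace)
    (fun p => (fst p, side rho u (clamp (snd p)))) (fun p => kd (fst p) (snd p))).
  - apply continuous_pair.
    + apply continuous_fst.
    + apply (continuous_comp (U := U) (V := R_UniformSpace) (W := C_UniformSpace)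
        (fun p => clamp (snd p)) (side rho u)); [exact Hcl | apply continuous_affine].
  - apply Hjoint. now apply on_clamp. }
apply continuous_Cplus; apply continuous_Cplus; apply A;
[apply unit4_1|apply unit4_i|apply unit4_m1|apply unit4_mi].
Qed.

Lemma contour_param pr : pr = Re \/ pr = Im ->
  is_derive (fun s => pr (contour rho (k s))) s0 (pr (contour rho (kd s0))).
Proof.
intros Hpr.
assert (Hloc : locally s0 (fun s => Rabs (s - s0) < eps)%R) by now exists eps.
assert (He : (Rabs (s0 - s0) < eps)%R) by (rewrite Rminus_diag, Rabs_R0; apply cond_pos).
assert (Hint : forall h, pr (contour rho h) = RInt (fun t => pr (contour_term rho h (clamp t))) (-1) 1).
{ intros h. transitivity (RInt (fun t => pr (contour_term rho h t)) (-1) 1).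
  - now destruct Hpr as [-> | ->].
  - apply RInt_ext. intros t Ht. rewrite Rmin_left, Rmax_right in Ht by lra. now rewrite clamp_id by lra. }
apply (is_derive_ext (fun s => RInt (fun t => pr (contour_term rho (k s) (clamp t))) (-1) 1)).
{ intros s. symmetry. apply Hint. }
replace (pr (contour rho (kd s0))) with
  (RInt (fun t => Derive (fun s => pr (contour_term rho (k s) (clamp t))) s0) (-1) 1).
2:{ rewrite Hint. apply RInt_ext. intros t Ht. exact (is_derive_unique _ _ _ (term_derive s0 t He pr Hpr)). }
apply is_derive_RInt_param.
- revert Hloc. apply filter_imp. intros s Hs t _. eexists. exact (term_derive s t Hs pr Hpr).
- intros t Ht.
  apply (continuity_2d_pt_ext_loc (fun u v => pr (contour_term rho (kd u) (clamp v)))).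
  + exists eps. intros u v Hu _. symmetry. apply is_derive_unique. exact (term_derive u v Hu pr Hpr).
  + apply continuity_2d_pt_filterlim. pose proof (term_continuous t) as h.
    destruct Hpr as [-> | ->]; [exact (continuous_Re _ _ h) | exact (continuous_Im _ _ h)].
- revert Hloc. apply filter_imp. intros s Hs.
  assert (Hc : Ccont_on (contour_term rho (k s))).
  { apply contour_term_cont. intros z Hz. now apply Hcont. }
  apply (ex_RInt_ext (fun t => pr (contour_term rho (k s) t))).
  + intros t Ht. rewrite Rmin_left, Rmax_right in Ht by lra. now rewrite clamp_id by lra.
  + destruct Hpr as [-> | ->]; [now apply ex_RInt_Re | now apply ex_RInt_Im].
Qed.

End Param.

(** By the mean value theorem the integral is constant once its derivative, the integral of [kd s],
    vanishes. The margin [eps] gives two-sided derivatives at both ends of [[0, 1]]. *)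
Lemma contour_homotopy rho (k kd : R -> C -> C) (eps : posreal) :
  (forall s z, (- eps < s < 1 + eps)%R -> on_square rho z ->
    is_derive (fun s => Re (k s z)) s (Re (kd s z)) /\ is_derive (fun s => Im (k s z)) s (Im (kd s z))) ->
  (forall s z, (- eps < s < 1 + eps)%R -> on_square rho z -> cont (k s) z) ->
  (forall s z, (0 <= s <= 1)%R -> on_square rho z ->
    continuous (T := prod_UniformSpace R_UniformSpace C_UniformSpace) (U := C_UniformSpace)
    (fun p => kd (fst p) (snd p)) (s, z)) ->
  (forall s, (0 <= s <= 1)%R -> contour rho (kd s) = 0) ->
  contour rho (k 0%R) = contour rho (k 1%R).
Proof.
intros H1 H2 H3 H4.
assert (A : forall pr, pr = Re \/ pr = Im -> pr (contour rho (k 0%R)) = pr (contour rho (k 1%R))).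
{ intros pr Hpr.
  destruct (MVT_cor2 (fun s => pr (contour rho (k s))) (fun _ => 0%R) 0 1) as [c [Hc _]]; [lra| |lra].
  intros s Hs. apply is_derive_Reals.
  replace 0%R with (pr (contour rho (kd s))) by (rewrite H4 by easy; now destruct Hpr as [-> | ->]).
  apply (contour_param rho k kd s eps); [..|easy].
  - intros s' z Hs'. apply H1. apply Rabs_def2 in Hs'. lra.
  - intros s' z Hs'. apply H2. apply Rabs_def2 in Hs'. lra.
  - intros z Hz. now apply H3. }
apply C_eq_Re_Im; apply A; [now left | now right].
Qed.

(** * Cauchy's formula on squares *)

Definition in_square (r : R) (z : C) : Prop := (Rabs (Re z) < r /\ Rabs (Im z) < r)%R.

(** The norm whose balls are the squares: its triangle inequality keeps deformed arguments inside a
    square and deformed poles off its boundary. *)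
Definition supnorm (z : C) : R := Rmax (Rabs (Re z)) (Rabs (Im z)).

Lemma in_square_supnorm r z : in_square r z <-> (supnorm z < r)%R.
Proof. unfold in_square, supnorm. split; [intros []; now apply Rmax_lub_lt|]. intros H.
split; apply Rle_lt_trans with (2 := H); [apply Rmax_l | apply Rmax_r]. Qed.

Lemma supnorm_pos z : (0 <= supnorm z)%R.
Proof. apply Rle_trans with (2 := Rmax_l _ _). apply Rabs_pos. Qed.

Lemma supnorm_triangle a b : (supnorm (a + b) <= supnorm a + supnorm b)%R.
Proof.
unfold supnorm. rewrite re_plus, im_plus.
pose proof (Rmax_l (Rabs (Re a)) (Rabs (Im a))). pose proof (Rmax_r (Rabs (Re a)) (Rabs (Im a))).
pose proof (Rmax_l (Rabs (Re b)) (Rabs (Im b))). pose proof (Rmax_r (Rabs (Re b)) (Rabs (Im b))).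
pose proof (Rabs_triang (Re a) (Re b)). pose proof (Rabs_triang (Im a) (Im b)).
apply Rmax_lub; lra.
Qed.

Lemma supnorm_scal (x : R) z : supnorm (x * z) = (Rabs x * supnorm z)%R.
Proof.
unfold supnorm. rewrite re_scal_l, im_scal_l, !Rabs_mult. apply RmaxRmult, Rabs_pos.
Qed.

Lemma supnorm_le_Cmod z : (supnorm z <= Cmod z)%R.
Proof. apply Rmax_Cmod. Qed.

Lemma supnorm_side rho u t :
  (0 <= rho)%R -> unit4 u -> (-1 <= t <= 1)%R -> supnorm (side rho u t) = rho.
Proof.
intros Hr Hu Ht.
assert (A : forall x : R, (x = rho * t \/ x = - (rho * t) -> Rabs x <= rho)%R).
{ intros x [->| ->]; apply Rabs_le; nra. }
assert (B : (Rabs rho = rho /\ Rabs (- rho) = rho)%R).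
{ rewrite Rabs_Ropp, Rabs_pos_eq; easy. }
unfold side, supnorm.
destruct Hu as [->|[->|[->| ->]]]; unfold Cplus, Cmult, Copp, Ci, RtoC, Re, Im; simpl.
- rewrite Rmax_left.
  + transitivity (Rabs rho); [f_equal; ring | apply B].
  + match goal with |- (_ <= Rabs ?x)%R => replace x with rho by ring end. rewrite (proj1 B). apply A. left. ring.
- rewrite Rmax_right.
  + transitivity (Rabs rho); [f_equal; ring | apply B].
  + match goal with |- (_ <= Rabs ?x)%R => replace x with rho by ring end. rewrite (proj1 B). apply A. right. ring.
- rewrite Rmax_left.
  + transitivity (Rabs (- rho)); [f_equal; ring | apply B].
  + match goal with |- (_ <= Rabs ?x)%R => replace x with (- rho)%R by ring end. rewrite (proj2 B). apply A. right. ring.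
- rewrite Rmax_right.
  + transitivity (Rabs (- rho)); [f_equal; ring | apply B].
  + match goal with |- (_ <= Rabs ?x)%R => replace x with (- rho)%R by ring end. rewrite (proj2 B). apply A. left. ring.
Qed.

Lemma on_square_supnorm rho z : (0 <= rho)%R -> on_square rho z -> supnorm z = rho.
Proof. intros Hr [u [t [Hu [Ht ->]]]]. now apply supnorm_side. Qed.

Lemma supnorm_neq a b : supnorm a <> supnorm b -> a - b <> 0.
Proof. intros H E. apply H. f_equal. replace a with (a - b + b) by ring. rewrite E. ring. Qed.

Lemma continuous_path_comp (h : C -> C) (p : R * C -> C) s z :
  continuous (T := prod_UniformSpace R_UniformSpace C_UniformSpace) (U := C_UniformSpace) p (s, z) ->
  cont h (p (s, z)) ->
  continuous (T := prod_UniformSpace R_UniformSpace C_UniformSpace) (U := C_UniformSpace)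
    (fun x => h (p x)) (s, z).
Proof.
intros Hp Hh. exact (continuous_comp (U := prod_UniformSpace R_UniformSpace C_UniformSpace)
  (V := C_UniformSpace) (W := C_UniformSpace) p h (s, z) Hp Hh).
Qed.

Lemma continuous_fst_RtoC (s : R) (z : C) :
  continuous (T := prod_UniformSpace R_UniformSpace C_UniformSpace) (U := C_UniformSpace)
    (fun p => RtoC (fst p)) (s, z).
Proof. apply continuous_RtoC, continuous_fst. Qed.

Lemma continuous_snd_C (s : R) (z : C) :
  continuous (T := prod_UniformSpace R_UniformSpace C_UniformSpace) (U := C_UniformSpace)
    (fun p => snd p) (s, z).
Proof. apply (continuous_snd (U := R_UniformSpace) (V := C_UniformSpace)). Qed.

Lemma cont_id z : cont (fun x : C => x) z.
Proof. apply continuous_id. Qed.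

Lemma cont_inv_sub rho (w z : C) :
  (0 <= rho)%R -> in_square rho w -> on_square rho z -> cont (fun x => / (x - w)) z.
Proof.
intros Hr Hw Hz. apply continuous_Cinv.
- Ccontinuity.
- apply supnorm_neq. rewrite (on_square_supnorm rho z) by easy. apply in_square_supnorm in Hw. lra.
Qed.

(* Shrinking the argument of [h] to [w] along [w + s (z - w)]: the [s]-derivative of the integrand is exact. *)
Lemma Cauchy_formula_aux rho r h h' w :
  (0 < rho < r)%R -> in_square rho w ->
  (forall z, in_square r z -> Cder h z (h' z) /\ cont h' z) ->
  contour rho (fun z => h z / (z - w)) = h w * contour rho (fun z => / (z - w)).
Proof.
intros [Hr0 Hr] Hw Hh.
assert (Hw' := proj1 (in_square_supnorm _ _) Hw).
assert (Hnz : forall z, on_square rho z -> z - w <> 0).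
{ intros z Hz. apply supnorm_neq. rewrite (on_square_supnorm rho z); lra || easy. }
(* For [s] within [eps] of [[0, 1]], [|1 - s| + |s| <= 1 + 2 eps], and this choice gives
   [(1 + 2 eps) rho < r]. *)
assert (He : (0 < (r - rho) / (4 * rho))%R) by (apply Rdiv_lt_0_compat; lra).
set (eps := mkposreal _ He).
assert (Hin : forall s z, (- eps < s < 1 + eps)%R -> on_square rho z -> in_square r (w + s * (z - w))).
{ intros s z Hs Hz. apply in_square_supnorm.
  replace (w + s * (z - w)) with ((1 - s)%R * w + s * z) by (rewrite RtoC_minus; ring).
  apply Rle_lt_trans with (1 := supnorm_triangle _ _). rewrite !supnorm_scal.
  rewrite (on_square_supnorm rho z) by (lra || easy).
  assert (h1 : (Rabs (1 - s) + Rabs s <= 1 + 2 * eps)%R).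
  { pose proof (cond_pos eps). unfold Rabs. destruct (Rcase_abs (1 - s)), (Rcase_abs s); lra. }
  assert (h2 : ((1 + 2 * eps) * rho < r)%R).
  { unfold eps; simpl. replace ((1 + 2 * ((r - rho) / (4 * rho))) * rho)%R with (rho + (r - rho) / 2)%R by (field; lra). lra. }
  pose proof (Rabs_pos (1 - s)). pose proof (Rabs_pos s). pose proof (supnorm_pos w). nra. }
rewrite <- contour_scal by (intros z Hz; apply (cont_inv_sub rho); easy || lra).
transitivity (contour rho ((fun (s : R) z => h (w + s * (z - w)) / (z - w)) 1%R)).
{ apply contour_ext. intros z Hz. do 2 f_equal. ring. }
rewrite <- (contour_homotopy rho (fun (s : R) z => h (w + s * (z - w)) / (z - w)) (fun s z => h' (w + s * (z - w))) eps).
- apply contour_ext. intros z Hz. unfold Cdiv. do 2 f_equal. ring.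
- intros s z Hs Hz. specialize (Hnz z Hz).
  destruct (Cder_path (fun x => / (z - w) * h x) w (z - w) s (/ (z - w) * h' (w + s * (z - w)))) as [h1 h2].
  { apply Cder_scal. apply Hh. now apply Hin. }
  replace (/ (z - w) * h' (w + s * (z - w)) * (z - w)) with (h' (w + s * (z - w))) in h1, h2 by (field; easy).
  split; [revert h1 | revert h2]; apply is_derive_ext; intros t; f_equal; unfold Cdiv; ring.
- intros s z Hs Hz. apply continuous_Cmult.
  + apply (continuous_comp (fun z => w + s * (z - w)) h).
    * Ccontinuity.
    * eapply Cder_cont. apply Hh. now apply Hin.
  + apply (cont_inv_sub rho); easy || lra.
- intros s z Hs Hz.
  apply (continuous_path_comp h' (fun p => w + fst p * (snd p - w))).
  + Ccontinuity; [apply continuous_fst_RtoC | apply continuous_snd_C].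
  + apply Hh, Hin; [|easy]. pose proof (cond_pos eps). simpl. lra.
- intros s Hs.
  assert (Hin' : forall z, on_square rho z -> in_square r (w + s * (z - w))).
  { intros z Hz. apply Hin; [|easy]. pose proof (cond_pos eps). simpl. lra. }
  assert (Hc : forall z, on_square rho z -> cont (fun z => h' (w + s * (z - w))) z).
  { intros z Hz.
    apply (continuous_comp (fun z => w + s * (z - w)) h').
    - Ccontinuity.
    - apply Hh. now apply Hin'. }
  (* The primitive [h (w + s (z - w)) / s] degenerates at [s = 0], where the integrand is the
     constant [h' w]. *)
  destruct (Req_dec s 0) as [->|Hs0].
  + apply (contour_exact rho (fun z => h' w * z)); [|exact Hc].
    intros z Hz. eapply Cder_eq; [apply Cder_scal, Cder_id|].
    replace (w + 0 * (z - w)) with w by ring. ring.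
  + assert (Hsc : RtoC s <> 0) by (intros E; apply RtoC_inj in E; easy).
    apply (contour_exact rho (fun z => / s * h (w + s * (z - w)))); [|exact Hc].
    intros z Hz. eapply Cder_eq.
    * apply Cder_scal. apply (Cder_comp h (fun z => w + s * (z - w))); [apply Hh; now apply Hin'|].
      apply Cder_plus; [apply Cder_const|]. apply Cder_scal. apply Cder_minus; [apply Cder_id | apply Cder_const].
    * field. easy.
Qed.

(** The pole is moved from 0 to [w] along [s w]: the [s]-derivative [w / (z - s w)^2] of the
    integrand has the primitive [- w / (z - s w)]. *)
Lemma contour_inv_center rho w :
  (0 < rho)%R -> in_square rho w -> contour rho (fun z => / (z - w)) = contour rho Cinv.
Proof.
intros Hr Hw. assert (Hw' := proj1 (in_square_supnorm _ _) Hw). pose proof (supnorm_pos w) as Hp.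
assert (He : (0 < (rho - supnorm w) / (2 * rho))%R) by (apply Rdiv_lt_0_compat; lra).
set (eps := mkposreal _ He).
assert (Hin : forall s z, (- eps < s < 1 + eps)%R -> on_square rho z -> z - s * w <> 0).
{ intros s z Hs Hz. apply supnorm_neq. rewrite (on_square_supnorm rho z), supnorm_scal by (lra || easy).
  assert (h1 : (Rabs s <= 1 + eps)%R) by (apply Rabs_le; lra).
  assert (h2 : ((1 + eps) * supnorm w < rho)%R).
  { unfold eps; simpl.
    replace ((1 + (rho - supnorm w) / (2 * rho)) * supnorm w)%R with
      (rho - (rho - supnorm w) * (1 - supnorm w / (2 * rho)))%R by (field; lra).
    assert (supnorm w / (2 * rho) < 1)%R by (apply Rlt_div_l; lra). nra. }
  nra. }
assert (Hc1 : forall (a : C) z, z - a <> 0 -> cont (fun x => / (x - a)) z).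
{ intros a z Ha. apply continuous_Cinv; [Ccontinuity | easy]. }
transitivity (contour rho ((fun (s : R) z => / (z - s * w)) 1%R)).
{ apply contour_ext. intros z Hz. f_equal. ring. }
rewrite <- (contour_homotopy rho (fun (s : R) z => / (z - s * w)) (fun (s : R) z => w * (/ (z - s * w) * / (z - s * w))) eps).
- apply contour_ext. intros z Hz. f_equal. ring.
- intros s z Hs Hz. specialize (Hin s z Hs Hz).
  destruct (Cder_path Cinv z (- w) s (- / ((z - s * w) * (z - s * w)))) as [h1 h2].
  { replace (z + s * - w) with (z - s * w) by ring. now apply Cder_Cinv. }
  replace (- / ((z - s * w) * (z - s * w)) * - w) with (w * (/ (z - s * w) * / (z - s * w))) in h1, h2 by (field; easy).
  split; [revert h1 | revert h2]; apply is_derive_ext; intros t; do 2 f_equal; ring.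
- intros s z Hs Hz. apply Hc1. now apply Hin.
- intros s z Hs Hz.
  assert (h0 : z - s * w <> 0). { apply Hin; [|easy]. pose proof (cond_pos eps). simpl. lra. }
  assert (h1 : continuous (T := prod_UniformSpace R_UniformSpace C_UniformSpace) (U := C_UniformSpace)
    (fun p => / (snd p - fst p * w)) (s, z)).
  { apply continuous_Cinv; [Ccontinuity | easy]; [apply continuous_snd_C | apply continuous_fst_RtoC]. }
  apply continuous_Cmult; [apply continuous_Cconst | now apply continuous_Cmult].
- intros s Hs.
  assert (h0 : forall z, on_square rho z -> z - s * w <> 0).
  { intros z Hz. apply Hin; [|easy]. pose proof (cond_pos eps). simpl. lra. }
  apply (contour_exact rho (fun z => - w * / (z - s * w))).
  + intros z Hz. specialize (h0 z Hz). eapply Cder_eq.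
    * apply Cder_scal. apply (Cder_comp Cinv (fun z => z - s * w)); [now apply Cder_Cinv|].
      apply Cder_minus; [apply Cder_id | apply Cder_const].
    * field. easy.
  + intros z Hz. apply continuous_Cmult; [apply continuous_Cconst|].
    apply continuous_Cmult; apply Hc1; now apply h0.
Qed.

Lemma RtoC_neq0 (x : R) : x <> 0%R -> RtoC x <> 0.
Proof. intros Hx h. now apply RtoC_inj in h. Qed.

Lemma C1_neq0 : RtoC 1 <> 0.
Proof. apply RtoC_neq0. lra. Qed.

Lemma Copp_neq0 (z : C) : z <> 0 -> - z <> 0.
Proof. intros Hz h. apply Hz. replace z with (- - z) by ring. rewrite h. ring. Qed.

(** On a side, [dz / z] is [Ci / (1 + t Ci) dt] whatever the direction and size of that side. This
    gives both the scale invariance and the positivity behind [kappa_neq0]. *)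
Lemma contour_term_inv (rho t : R) : (0 < rho)%R -> contour_term rho Cinv t = 4%R * (Ci / (1 + t * Ci)).
Proof.
intros Hr.
assert (Hn : 1 + t * Ci <> 0).
{ intros h. apply (f_equal Re) in h. unfold Cplus, Cmult, Ci, RtoC, Re in h. simpl in h. lra. }
assert (A : forall u : C, u <> 0 -> / side rho u t * (rho * u * Ci) = Ci / (1 + t * Ci)).
{ intros u Hu. unfold side. replace (rho * u + t * (rho * u * Ci)) with (rho * u * (1 + t * Ci)) by ring.
  assert (Hrc : RtoC rho <> 0) by (apply RtoC_neq0; lra).
  field. repeat split; cbv beta; easy. }
unfold contour_term. rewrite !A; [|apply Copp_neq0, Ci_nz|apply Copp_neq0, C1_neq0|apply Ci_nz|apply C1_neq0].
replace (RtoC 4) with (1 + 1 + 1 + 1) by (rewrite <- !RtoC_plus; f_equal; ring). ring.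
Qed.

(** The constant [2 i pi] of Cauchy's formula; the limits divide by its modulus. *)
Definition kappa : C := contour 1 Cinv.

Lemma contour_inv rho : (0 < rho)%R -> contour rho Cinv = kappa.
Proof. intros Hr. apply CInt_ext. intros t _. rewrite !contour_term_inv; lra || easy. Qed.

(** The imaginary part of the integrand is [4 / (1 + t^2)], at least 2 on [[-1, 1]]. *)
Lemma kappa_neq0 : kappa <> 0.
Proof.
intros E. apply (f_equal Im) in E.
change (RInt (fun t => Im (contour_term 1 Cinv t)) (-1) 1 = 0%R) in E.
assert (Hc : Ccont_on (contour_term 1 Cinv)).
{ apply contour_term_cont. intros z Hz. apply (continuous_Cinv (fun x => x)); [apply cont_id|].
  intros ->. apply on_square_supnorm in Hz; [|lra]. unfold supnorm in Hz. simpl in Hz.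
  rewrite Rabs_R0, Rmax_left in Hz; lra. }
assert (Ht : forall t : R, Im (contour_term 1 Cinv t) = (4 / (1 + t * t))%R).
{ intros t. rewrite contour_term_inv, im_scal_l by lra.
  unfold Cdiv, Cinv, Cplus, Cmult, Ci, RtoC, Im; simpl. field. nra. }
assert (h : (RInt (fun _ => 2) (-1) 1 <= RInt (fun t => Im (contour_term 1 Cinv t)) (-1) 1)%R).
{ apply RInt_le; [lra|apply ex_RInt_const|now apply ex_RInt_Im|].
  intros t Htt. rewrite Ht. apply Rle_div_r; nra. }
rewrite E, RInt_const in h. unfold scal in h; simpl in h; unfold mult in h; simpl in h. lra.
Qed.

Lemma Cauchy_formula rho r h h' w :
  (0 < rho < r)%R -> in_square rho w ->
  (forall z, in_square r z -> Cder h z (h' z) /\ cont h' z) ->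
  contour rho (fun z => h z / (z - w)) = h w * kappa.
Proof.
intros Hr Hw Hh. rewrite (Cauchy_formula_aux rho r h h' w) by easy.
now rewrite contour_inv_center, contour_inv by easy.
Qed.

(** * Partial fractions *)

Lemma on_square_sub_neq0 rho (p z : C) :
  (0 < rho)%R -> in_square rho p -> on_square rho z -> z - p <> 0.
Proof.
intros Hr Hp Hz. apply in_square_supnorm in Hp. apply supnorm_neq.
rewrite (on_square_supnorm rho z); lra || easy.
Qed.

Lemma in_square_0 rho : (0 < rho)%R -> in_square rho 0.
Proof. intros H. split; simpl; now rewrite Rabs_R0. Qed.

(** After splitting into partial fractions, the contributions of [p] and [w] are the same constant
    with opposite signs. Hence principal parts at simple poles inside the square drop out of
    Cauchy's integral. *)
Lemma contour_simple_pole rho (p w : C) :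
  (0 < rho)%R -> in_square rho p -> in_square rho w -> p <> w ->
  contour rho (fun z => / (z - p) * / (z - w)) = 0.
Proof.
intros Hr Hp Hw Hpw.
assert (Hd : p - w <> 0).
{ intros h. apply Hpw. replace p with (p - w + w) by ring. rewrite h. ring. }
rewrite (contour_ext rho _ (fun z => / (p - w) * (/ (z - p) - / (z - w)))).
- assert (Hc : forall a z, in_square rho a -> on_square rho z -> cont (fun x => / (x - a)) z).
  { intros a z Ha Hz. apply (cont_inv_sub rho); easy || lra. }
  rewrite contour_scal.
  + rewrite contour_minus by (intros z Hz; now apply Hc). rewrite !contour_inv_center by easy. ring.
  + intros z Hz. apply continuous_Cminus; now apply Hc.
- intros z Hz. field. repeat split; try easy; now apply (on_square_sub_neq0 rho).
Qed.

(** Induction through [1 / (z^(m+1) (z - w)) = (1 / (z^m (z - w)) - 1 / z^(m+1)) / w], whose last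
    term has a primitive as soon as [m >= 1]. *)
Lemma contour_pow_pole rho (w : C) n :
  (0 < rho)%R -> in_square rho w -> w <> 0 ->
  contour rho (fun z => / z ^ S n * / (z - w)) = 0.
Proof.
intros Hr Hw Hw0.
assert (H0 : forall z, on_square rho z -> z <> 0).
{ intros z Hz. replace z with (z - 0) by ring. apply (on_square_sub_neq0 rho); try easy. now apply in_square_0. }
assert (Hpow : forall n z, on_square rho z -> cont (fun z => / z ^ n) z).
{ intros m z Hz. apply continuous_Cinv.
  - apply entire_cont. apply (entire_ext (fun z => z ^ m * 1)); [intros; ring|].
    apply entire_mul_pow, entire_const.
  - now apply Cpow_nz, H0. }
assert (Hc : forall n z, on_square rho z -> cont (fun z => / z ^ S n * / (z - w)) z).
{ intros m z Hz. apply continuous_Cmult; [now apply Hpow|].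
  apply (cont_inv_sub rho); easy || lra. }
assert (Hp2 : forall n z, on_square rho z -> cont (fun z => / z ^ S (S n)) z).
{ intros m z Hz. now apply (Hpow (S (S m))). }
induction n as [|n IH].
- rewrite (contour_ext rho _ (fun z => / (z - 0) * / (z - w))).
  + apply contour_simple_pole; [easy|now apply in_square_0|easy|]. intros <-. now apply Hw0.
  + intros z Hz. simpl. f_equal. f_equal. ring.
- rewrite (contour_ext rho _ (fun z => / w * (/ z ^ S n * / (z - w) - / z ^ S (S n)))).
  + rewrite contour_scal.
    * rewrite contour_minus, IH by auto. clear IH.
      rewrite (contour_exact rho (fun z => - / INR (S n) * / z ^ S n)); [ring| |exact (Hp2 n)].
      intros z Hz. specialize (H0 z Hz).
      assert (Hn : RtoC (INR (S n)) <> 0).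
      { intros h. apply RtoC_inj in h. revert h. apply not_0_INR. lia. }
      eapply Cder_eq.
      -- apply Cder_scal. apply (Cder_comp Cinv (fun z => z ^ S n)); [apply Cder_Cinv; now apply Cpow_nz|].
         apply Cpow_derive.
      -- change (pred (S n)) with n. rewrite !Cpow_S. field. repeat split; try easy; now apply Cpow_nz.
    * intros z Hz. apply continuous_Cminus; [now apply Hc | now apply Hp2].
  + clear IH. intros z Hz. specialize (H0 z Hz). simpl. field.
    pose proof (on_square_sub_neq0 rho w z Hr Hw Hz). pose proof (Cpow_nz z n H0). auto.
Qed.

(** Continuity of the cofactor suffices, and continuity is what [reduced] records about [pi]. *)
Lemma Cder_root f k p : (forall z, f z = (z - p) * k z) -> cont k p -> Cder f p (k p).
Proof.
intros E Hk. apply Cder_Cmod. intros eps He.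
destruct (proj1 (cont_Cmod _ _) Hk eps He) as [d [Hd H]].
exists d. split; [easy|]. intros z Hz. specialize (H z Hz).
rewrite !E. replace ((z - p) * k z - (p - p) * k p - k p * (z - p)) with ((z - p) * (k z - k p)) by ring.
rewrite Cmod_mult. pose proof (Cmod_ge_0 (z - p)). nra.
Qed.

(* [n / f] with the principal parts at the points of [S], of sum [PP], removed: up to the factor [pi],
   which carries the zeros of [f] in [S], the remainder is [r / g]. *)
Definition reduced (n f : C -> C) (S : C -> Prop) (PP : C -> C) : Prop :=
  exists (g r pi : C -> C), entire g /\ entire r /\ (forall z, cont pi z) /\
    (forall z, f z = pi z * g z) /\
    (forall z, ~ S z -> pi z <> 0 /\ n z = f z * PP z + pi z * r z) /\
    (forall z, S z -> g z <> 0).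

Lemma reduced_ext n f S S' PP PP' :
  (forall z, S z <-> S' z) -> (forall z, PP z = PP' z) -> reduced n f S PP -> reduced n f S' PP'.
Proof.
intros HS HP [g [r [pi [H1 [H2 [H3 [H4 [H5 H6]]]]]]]]. exists g, r, pi.
repeat split; try easy.
- apply H5. now rewrite HS.
- rewrite <- HP. apply H5. now rewrite HS.
- intros z Hz. apply H6. now apply HS.
Qed.

Lemma reduced_nil n f : entire n -> entire f -> reduced n f (fun _ => False) (fun _ => 0).
Proof.
intros Hn Hf. exists f, n, (fun _ => 1).
pose proof C1_neq0 as h1.
repeat split; try easy.
- intros z. apply continuous_Cconst.
- intros z. ring.
- ring.
Qed.

(** The zero [p] moves from [g] into [pi]. The residue [a = n p / f'] is the value for which
    [r - a g1] vanishes at [p], so [z - p] divides the new remainder too. *)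
Lemma reduced_pole n f f' (S : C -> Prop) PP p :
  Cder f p f' -> f p = 0 -> f' <> 0 -> ~ S p -> reduced n f S PP ->
  reduced n f (fun z => S z \/ z = p) (fun z => PP z + n p / f' / (z - p)).
Proof.
intros Hf' Hfp Hf'0 HSp [g [r [pi [Hg [Hr [Hpi [Ef [En HS]]]]]]]].
destruct (En p HSp) as [Hpip Enp].
assert (Hgp : g p = 0).
{ replace (g p) with (/ pi p * (pi p * g p)) by (field; easy). rewrite <- Ef, Hfp. ring. }
destruct (entire_div_root g p Hg Hgp) as [g1 [Hg1 Eg]].
assert (E1 : f' = pi p * g1 p).
{ apply (Cder_unique f p); [easy|]. apply (Cder_root f (fun z => pi z * g1 z)).
  - intros z. rewrite Ef, Eg. ring.
  - apply continuous_Cmult; [apply Hpi | now apply entire_cont]. }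
assert (Hg1p : g1 p <> 0). { intros h. apply Hf'0. rewrite E1, h. ring. }
set (a := n p / f').
assert (Ha : r p - a * g1 p = 0).
{ unfold a. rewrite Enp, Hfp, E1. field. easy. }
destruct (entire_div_root (fun z => r z - a * g1 z) p) as [r1 [Hr1 Er]].
{ apply entire_minus; [easy|]. now apply entire_scal. }
{ exact Ha. }
exists g1, r1, (fun z => (z - p) * pi z). repeat split; try easy.
- intros z. apply continuous_Cmult; [|apply Hpi].
  Ccontinuity.
- intros z. rewrite Ef, Eg. ring.
- apply Cmult_neq_0.
  + intros h. apply H. right. replace z with (z - p + p) by ring. rewrite h. ring.
  + apply En. tauto.
- assert (hz : z - p <> 0).
  { intros h. apply H. right. replace z with (z - p + p) by ring. rewrite h. ring. }
  assert (hS : ~ S z) by tauto.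
  rewrite (proj2 (En z hS)).
  replace ((z - p) * pi z * r1 z) with (pi z * ((z - p) * r1 z)) by ring.
  rewrite <- Er, Ef, Eg. field. easy.
- intros z [Hz| ->]; [|easy]. intros h. apply (HS z Hz). rewrite Eg, h. ring.
Qed.

(** The quotient of the two entire functions in [reduced] extends [n / f - PP] over the points of
    [S], so Cauchy's formula applies to it at [w]. On the contour the part [PP] is split off again
    and integrates to 0. *)
Lemma reduced_Cauchy n f S PP rho r w :
  reduced n f S PP -> entire n -> entire f -> (0 < rho < r)%R -> in_square rho w -> ~ S w -> f w <> 0 ->
  (forall z, in_square r z -> f z = 0 -> S z) ->
  (forall z, S z -> in_square rho z) ->
  (forall z, on_square rho z -> cont PP z) ->
  contour rho (fun z => PP z * / (z - w)) = 0 ->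
  contour rho (fun z => n z / f z * / (z - w)) = (n w / f w - PP w) * kappa.
Proof.
intros [g [rr [pi [Hg [Hr [Hpi [Ef [En HS]]]]]]]] Hn Hf Hrho Hw HwS Hfw Hz HSin HcPP.
assert (Hg0 : forall z, in_square r z -> g z <> 0).
{ intros z Hzr h. apply (HS z); [|easy]. apply Hz; [easy|]. rewrite Ef, h. ring. }
assert (Hq : forall z, ~ S z -> g z <> 0 -> rr z / g z = n z / f z - PP z).
{ intros z HSz Hgz. destruct (En z HSz) as [hp hn]. rewrite hn, Ef. field. easy. }
assert (Hsq : forall z, on_square rho z -> in_square r z /\ ~ S z).
{ intros z Hzs. split.
  - apply in_square_supnorm. rewrite (on_square_supnorm rho z); lra || easy.
  - intros h. apply HSin in h. apply in_square_supnorm in h. rewrite (on_square_supnorm rho z) in h; lra || easy. }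
assert (Hf0 : forall z, on_square rho z -> f z <> 0).
{ intros z Hzs h. apply (Hsq z Hzs). apply Hz; [now apply Hsq | easy]. }
assert (Hwr : in_square r w).
{ apply in_square_supnorm. apply in_square_supnorm in Hw. lra. }
destruct (entire_derive g Hg) as [g' [Hg' Dg]]. destruct (entire_derive rr Hr) as [r' [Hr' Dr]].
assert (Hci : forall z, on_square rho z -> cont (fun z => / (z - w)) z).
{ intros z Hzs. apply (cont_inv_sub rho); easy || lra. }
assert (Hd : forall z, in_square r z ->
  Cder (fun z => rr z / g z) z ((r' z * g z - rr z * g' z) / (g z * g z)) /\
  cont (fun z => (r' z * g z - rr z * g' z) / (g z * g z)) z).
{ intros z Hzr. specialize (Hg0 z Hzr). split; [now apply Cder_div|].
  apply continuous_Cdiv.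
  - apply continuous_Cminus; apply continuous_Cmult; now apply entire_cont.
  - apply continuous_Cmult; now apply entire_cont.
  - now apply Cmult_neq_0. }
assert (Hc1 : forall z, on_square rho z -> cont (fun z => n z / f z * / (z - w)) z).
{ intros z Hzs. apply continuous_Cmult; [|now apply Hci].
  apply continuous_Cdiv; try now apply entire_cont. now apply Hf0. }
assert (Hc2 : forall z, on_square rho z -> cont (fun z => PP z * / (z - w)) z).
{ intros z Hzs. apply continuous_Cmult; [now apply HcPP | now apply Hci]. }
assert (He : forall z, on_square rho z -> rr z / g z / (z - w) = n z / f z * / (z - w) - PP z * / (z - w)).
{ intros z Hzs. rewrite Hq; [unfold Cdiv; ring|now apply Hsq|now apply Hg0, Hsq]. }
assert (Hqw : rr w / g w = n w / f w - PP w) by (apply Hq; [easy | now apply Hg0]).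
pose proof (Cauchy_formula rho r _ _ w Hrho Hw Hd) as HC.
intros HPP. cbv beta in HC. rewrite <- Hqw, <- HC, (contour_ext rho _ _ He), contour_minus, HPP by assumption.
ring.
Qed.

(** * Bounds for Bessel functions *)

Local Open Scope R_scope.

(** The sign is required in the open interval: Bessel's equation is singular at the origin, where it
    says nothing about the derivatives of the forms below. *)
Lemma nondecreasing_derive (f f' : R -> R) a b :
  a <= b -> (forall t, a <= t <= b -> is_derive f t (f' t)) ->
  (forall t, a < t < b -> 0 <= f' t) -> f a <= f b.
Proof.
intros [Hab| ->] Hd Hp; [|lra].
destruct (MVT_cor2 f f' a b Hab) as [c [E Hc]].
- intros c Hc. apply is_derive_Reals. now apply Hd.
- specialize (Hp c Hc). nra.
Qed.

Lemma BesselJ_neq0_near_0 (q : nat) :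
  exists d : R, 0 < d /\ forall z : C, 0 < Cmod z < d -> BesselJ (Z.of_nat q) z <> 0%C.
Proof.
destruct (BesselJ_zero_order q) as [g [Hg [Hg0 E]]].
assert (Hm := proj1 (Cmod_gt_0 _) Hg0).
destruct (proj1 (cont_Cmod _ _) (entire_cont g (RtoC 0) Hg) (Cmod (g 0%C)) Hm) as [d [Hd H]].
exists d. split; [easy|]. intros z [Hz1 Hz2]. rewrite E. apply Cmult_neq_0.
- apply Cpow_nz, Cmod_gt_0. exact Hz1.
- intros h. specialize (H z). rewrite h in H.
  replace (0 - g 0)%C with (- g 0)%C in H by ring. rewrite Cmod_opp in H.
  replace (z - 0)%C with z in H by ring. specialize (H Hz2). lra.
Qed.

Definition Cnorm2 (z : C) : R := Re z ^ 2 + Im z ^ 2.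

Lemma Cnorm2_ge0 z : 0 <= Cnorm2 z.
Proof. unfold Cnorm2. nra. Qed.

Lemma Cnorm2_Cmod z : Cnorm2 z = Cmod z ^ 2.
Proof. unfold Cnorm2. now rewrite Cmod2_alt. Qed.

Lemma Cnorm2_gt0 (z : C) : z <> 0%C -> 0 < Cnorm2 z.
Proof. intros H. rewrite Cnorm2_Cmod. apply pow_lt, Cmod_gt_0, H. Qed.

(** * Growth along rays from the origin *)

Section Ray.
Variable q : nat.
Let J := BesselJ (Z.of_nat q).
Let D := dJ (Z.of_nat q).
Let D2 := ddJ (Z.of_nat q).

(** For fixed [T] and [-1 <= x <= 1] these points form the upper side of the square of half-side
    [T]. The leading [0 +] matches the paths [a + t * b] of [Cder_path]. *)
Definition ray (x T : R) : C := (0 + T * (x + Ci))%C.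

Definition ray_form (x T : R) : R :=
  T * (1 + x ^ 2) * (Re (dJ (Z.of_nat q) (ray x T)) * Im (BesselJ (Z.of_nat q) (ray x T))
   - Im (dJ (Z.of_nat q) (ray x T)) * Re (BesselJ (Z.of_nat q) (ray x T))).

(* [ray_form] is [- Im (conj e * z J'(z) * conj J(z))] at [z = T e], [e = x + i]; in this form Bessel's
   equation, written [z (z J')' = (q^2 - z^2) J], makes its derivative a sum of squares. *)
Lemma ray_form_derive x T : exists d,
  is_derive (ray_form x) T d /\
  T * d = (INR q ^ 2 + T ^ 2 * (1 + x ^ 2)) * Cnorm2 (J (ray x T))
          + T ^ 2 * (1 + x ^ 2) * Cnorm2 (D (ray x T)).
Proof.
destruct (Cder_path J 0 (x + Ci) T _ (BesselJ_Cder _ _)) as [j1 j2].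
destruct (Cder_path D 0 (x + Ci) T _ (dJ_Cder _ _)) as [d1 d2].
pose proof (Bessel_ode (Z.of_nat q) (ray x T)) as ode.
rewrite <- INR_IZR_INZ in ode.
fold (ray x T) in j1, j2, d1, d2. fold D2 in ode, d1, d2. fold D in ode, j1, j2. fold J in ode.
(* The conjugate direction turns one factor [z] into the real number [T (1 + x^2)]; what is then
   used is the imaginary part of the equation against [conj J]. *)
apply (f_equal (fun w => ((x - Ci) * w)%C)) in ode.
eexists. split.
- unfold ray_form. fold J D.
  apply Rder_mult; [apply Rder_mult; [apply Rder_id | apply Rder_const]|].
  apply Rder_minus; apply Rder_mult; eassumption.
- clear j1 j2 d1 d2. unfold Cnorm2.
  destruct (J (ray x T)) as [a b], (D (ray x T)) as [c d], (D2 (ray x T)) as [u v].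
  pose proof (f_equal Re ode) as h1. pose proof (f_equal Im ode) as h2. clear ode.
  unfold ray, Cmult, Cminus, Cplus, Copp, Ci, RtoC, Re, Im in *. simpl in h1, h2 |- *.
  apply (f_equal (Rmult b)) in h1. apply (f_equal (Rmult a)) in h2. lra.
Qed.

Lemma ray_form_Derive x T :
  is_derive (ray_form x) T (Derive (ray_form x) T) /\
  T * Derive (ray_form x) T = (INR q ^ 2 + T ^ 2 * (1 + x ^ 2)) * Cnorm2 (J (ray x T))
          + T ^ 2 * (1 + x ^ 2) * Cnorm2 (D (ray x T)).
Proof.
destruct (ray_form_derive x T) as [d [Hd E]]. now rewrite (is_derive_unique _ _ _ Hd).
Qed.

Lemma ray_form_le x T : 0 <= T ->
  2 * ray_form x T <= T * (1 + x ^ 2) * (Cnorm2 (J (ray x T)) + Cnorm2 (D (ray x T))).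
Proof.
intros HT. unfold ray_form, Cnorm2. fold J D.
destruct (J (ray x T)) as [a b], (D (ray x T)) as [c d]. unfold Re, Im; simpl fst; simpl snd.
assert (0 <= T * (1 + x ^ 2)) by (apply Rmult_le_pos; nra).
replace (2 * (T * (1 + x ^ 2) * (c * b - d * a))) with (T * (1 + x ^ 2) * (2 * (c * b - d * a))) by ring.
apply Rmult_le_compat_l; [easy|].
pose proof (pow2_ge_0 (c - b)). pose proof (pow2_ge_0 (d + a)). lra.
Qed.

Lemma ray_form_sqr_le x T :
  ray_form x T ^ 2 <= T ^ 2 * (1 + x ^ 2) ^ 2 * (Cnorm2 (J (ray x T)) * Cnorm2 (D (ray x T))).
Proof.
unfold ray_form, Cnorm2. fold J D.
destruct (J (ray x T)) as [a b], (D (ray x T)) as [c d]. unfold Re, Im; simpl fst; simpl snd.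
rewrite !Rpow_mult_distr. apply Rmult_le_compat_l.
- apply Rmult_le_pos; apply pow2_ge_0.
- replace ((a ^ 2 + b ^ 2) * (c ^ 2 + d ^ 2)) with ((c * b - d * a) ^ 2 + (a * c + b * d) ^ 2) by ring.
  pose proof (pow2_ge_0 (a * c + b * d)). lra.
Qed.

Lemma ray_Cmod x T : 0 <= T -> T <= Cmod (ray x T) <= T * (Rabs x + 1).
Proof.
intros HT. unfold ray. rewrite Cplus_0_l, Cmod_mult, Cmod_R, Rabs_pos_eq by easy. split.
- assert (1 <= Cmod (x + Ci)).
  { apply Rle_trans with (2 := Rle_trans _ _ _ (Rmax_r _ _) (Rmax_Cmod _)). simpl.
    rewrite Rplus_0_l, Rabs_R1. lra. }
  nra.
- apply Rmult_le_compat_l; [easy|]. apply Rle_trans with (1 := Cmod_triangle _ _).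
  rewrite Cmod_Ci, Cmod_R. lra.
Qed.

(** The form vanishes at [T = 0] and never decreases; strictness comes from the punctured
    neighbourhood of 0 in which [J] has no zero. *)
Lemma ray_form_pos x T : 0 < T -> 0 < ray_form x T.
Proof.
intros HT.
assert (S0 : ray_form x 0 = 0) by (unfold ray_form; ring).
destruct (BesselJ_neq0_near_0 q) as [d [Hd HJ]].
pose proof (Rabs_pos x) as Hx.
set (t := Rmin T (d / (2 * (Rabs x + 1)))).
assert (Ht : 0 < t) by (apply Rmin_pos; [easy|]; apply Rdiv_lt_0_compat; lra).
assert (HtT : t <= T) by apply Rmin_l.
assert (Htd : t * (Rabs x + 1) < d).
{ assert (h : t <= d / (2 * (Rabs x + 1))) by apply Rmin_r.
  apply Rmult_le_compat_r with (r := Rabs x + 1) in h; [|lra].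
  replace (d / (2 * (Rabs x + 1)) * (Rabs x + 1)) with (d / 2) in h by (field; lra). lra. }
set (S' := Derive (ray_form x)).
assert (HS := ray_form_Derive x). fold S' in HS.
assert (Hnn : forall s, 0 < s -> 0 <= S' s).
{ intros s Hs. destruct (HS s) as [_ E].
  assert (0 <= s * S' s).
  { rewrite E. pose proof (Cnorm2_ge0 (J (ray x s))). pose proof (Cnorm2_ge0 (D (ray x s))).
    apply Rplus_le_le_0_compat; apply Rmult_le_pos; nra. }
  nra. }
apply Rlt_le_trans with (ray_form x t).
- destruct (MVT_cor2 (ray_form x) S' 0 t Ht) as [c [E [Hc0 Hct]]].
  { intros c _. apply is_derive_Reals. apply HS. }
  rewrite S0 in E. destruct (HS c) as [_ Ec].
  assert (0 < c * S' c).
  { rewrite Ec.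
    assert (h1 : 0 < Cnorm2 (J (ray x c))).
    { apply Cnorm2_gt0, HJ. destruct (ray_Cmod x c); [lra|]. split; [lra|]. nra. }
    pose proof (Cnorm2_ge0 (D (ray x c))).
    apply Rplus_lt_le_0_compat; [apply Rmult_lt_0_compat | apply Rmult_le_pos]; nra. }
  assert (0 < S' c) by nra. nra.
- apply (nondecreasing_derive (ray_form x) S' t T HtT).
  + intros s _. apply HS.
  + intros s Hs. apply Hnn. lra.
Qed.

(** The sum of squares in the derivative is at least [T (1 + x^2) (|J|^2 + |J'|^2)], which dominates
    twice the form by [ray_form_le]; so the form times [exp (- 2 T)] is nondecreasing. *)
Lemma ray_form_growth x T : 1 <= T -> ray_form x 1 * exp (2 * (T - 1)) <= ray_form x T.
Proof.
intros HT.
set (S' := Derive (ray_form x)).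
assert (HS := ray_form_Derive x). fold S' in HS.
assert (H : ray_form x 1 * exp (-2 * 1) <= ray_form x T * exp (-2 * T)).
{ apply (nondecreasing_derive (fun s => ray_form x s * exp (-2 * s))
    (fun s => S' s * exp (-2 * s) + ray_form x s * (-2 * exp (-2 * s))) 1 T HT).
  - intros s _. apply (Rder_mult (ray_form x) (fun s => exp (-2 * s)) s (S' s) (-2 * exp (-2 * s))); [apply HS|].
    apply Rder_exp_scal.
  - intros s Hs. destruct (HS s) as [_ E].
    pose proof (ray_form_le x s ltac:(lra)) as h1.
    pose proof (exp_pos (-2 * s)) as h2.
    assert (h3 : 2 * ray_form x s <= S' s).
    { apply (Rmult_le_reg_l s); [lra|]. rewrite E.
      apply (Rmult_le_compat_l s) in h1; [|lra].
      pose proof (Cnorm2_ge0 (J (ray x s))). pose proof (pow2_ge_0 (INR q)).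
      assert (0 <= INR q ^ 2 * Cnorm2 (J (ray x s))) by now apply Rmult_le_pos. lra. }
    nra. }
apply (Rmult_le_compat_r (exp (2 * T))) in H; [|left; apply exp_pos].
rewrite !Rmult_assoc, <- !exp_plus in H.
replace (-2 * T + 2 * T) with 0 in H by ring. rewrite exp_0 in H.
replace (-2 * 1 + 2 * T) with (2 * (T - 1)) in H by ring. lra.
Qed.

(** Write [F] for the form and [e = x + i]. Along the ray [(|J|^2)' <= |J|^2 + |e J'|^2], while
    [F' >= s (|J|^2 + |e J'|^2)]. Hence [s F'] pays for [s^2 (|J|^2)'], and the additional [2 F']
    pays for [2 s |J|^2]: this is the role of the weight [s + 2]. *)
Lemma ray_J_le x T : 0 < T -> T ^ 2 * Cnorm2 (J (ray x T)) <= (T + 2) * ray_form x T.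
Proof.
intros HT.
set (S' := Derive (ray_form x)).
assert (HS := ray_form_Derive x). fold S' in HS.
set (j1 := fun t => Re (J (ray x t))). set (j2 := fun t => Im (J (ray x t))).
set (p1 := fun t => Re (D (ray x t) * (x + Ci))%C). set (p2 := fun t => Im (D (ray x t) * (x + Ci))%C).
assert (Hj : forall t, is_derive j1 t (p1 t) /\ is_derive j2 t (p2 t)).
{ intros t. exact (Cder_path J 0 (x + Ci) t _ (BesselJ_Cder _ _)). }
assert (H : (0 + 2) * ray_form x 0 - 0 * 0 * (j1 0 * j1 0 + j2 0 * j2 0)
  <= (T + 2) * ray_form x T - T * T * (j1 T * j1 T + j2 T * j2 T)).
{ apply (nondecreasing_derive (fun s => (s + 2) * ray_form x s - s * s * (j1 s * j1 s + j2 s * j2 s))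
    (fun s => ((1 + 0) * ray_form x s + (s + 2) * S' s) -
      ((1 * s + s * 1) * (j1 s * j1 s + j2 s * j2 s) +
       s * s * ((p1 s * j1 s + j1 s * p1 s) + (p2 s * j2 s + j2 s * p2 s)))) 0 T); [lra| |].
  - intros s _. apply Rder_minus.
    + apply (Rder_mult (fun s => s + 2) (ray_form x)); [|apply HS].
      apply Rder_plus; [apply Rder_id | apply Rder_const].
    + apply (Rder_mult (fun s => s * s) (fun s => j1 s * j1 s + j2 s * j2 s)).
      * apply (Rder_mult (fun s => s) (fun s => s)); apply Rder_id.
      * apply Rder_plus; [apply (Rder_mult j1 j1) | apply (Rder_mult j2 j2)]; apply Hj.
  - intros s Hs. destruct (HS s) as [_ E].
    assert (Hpos := ray_form_pos x s ltac:(lra)).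
    apply (Rmult_le_reg_l s); [lra|]. rewrite Rmult_0_r.
    assert (EJ : Cnorm2 (J (ray x s)) = j1 s * j1 s + j2 s * j2 s).
    { unfold Cnorm2, j1, j2. ring. }
    assert (ED : (1 + x ^ 2) * Cnorm2 (D (ray x s)) = p1 s * p1 s + p2 s * p2 s).
    { unfold Cnorm2, p1, p2. destruct (D (ray x s)) as [c d].
      unfold Cplus, Cmult, Ci, RtoC, Re, Im; simpl. ring. }
    rewrite Rmult_assoc, ED, EJ in E.
    set (A := j1 s * j1 s + j2 s * j2 s) in *. set (B := p1 s * p1 s + p2 s * p2 s) in *.
    assert (hA : 0 <= A) by (unfold A; nra).
    assert (hc : 2 * (p1 s * j1 s + p2 s * j2 s) <= A + B).
    { unfold A, B. pose proof (pow2_ge_0 (p1 s - j1 s)). pose proof (pow2_ge_0 (p2 s - j2 s)). lra. }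
    assert (hE : s * s * (A + B) <= s * S' s).
    { rewrite E. assert (0 <= INR q ^ 2 * A) by (apply Rmult_le_pos; [apply pow2_ge_0 | easy]).
      assert (0 <= s ^ 2 * x ^ 2 * A) by (apply Rmult_le_pos; [apply Rmult_le_pos; apply pow2_ge_0 | easy]). lra. }
    assert (hE2 : s * s * A <= s * S' s).
    { assert (0 <= B) by (unfold B; nra). assert (0 <= s * s * B) by (apply Rmult_le_pos; nra). lra. }
    apply (Rmult_le_compat_l (s * s * s)) in hc; [|repeat apply Rmult_le_pos; lra].
    apply (Rmult_le_compat_l s) in hE; [|lra].
    assert (0 < s * ray_form x s) by (apply Rmult_lt_0_compat; lra).
    lra. }
replace (ray_form x 0) with 0 in H by (unfold ray_form; ring).
unfold Cnorm2. fold (j1 T) (j2 T). lra.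
Qed.

Lemma ray_bounds x T : -1 <= x <= 1 -> 2 <= T ->
  Cnorm2 (J (ray x T)) <= 16 * Cnorm2 (D (ray x T)) /\ ray_form x 1 * exp (2 * (T - 1)) <= 4 * (T + 2) * Cnorm2 (D (ray x T)).
Proof.
intros Hx HT.
pose proof (ray_form_pos x T ltac:(lra)) as h0.
pose proof (ray_J_le x T ltac:(lra)) as h1.
pose proof (ray_form_sqr_le x T) as h2.
pose proof (Cnorm2_ge0 (J (ray x T))) as ha. pose proof (Cnorm2_ge0 (D (ray x T))) as hb.
pose proof (ray_form_growth x T ltac:(lra)) as h3.
set (a := Cnorm2 (J (ray x T))) in *. set (b := Cnorm2 (D (ray x T))) in *. set (S := ray_form x T) in *.
assert (hm : 1 + x ^ 2 <= 2) by nra.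
assert (h4 : S ^ 2 <= 4 * (T ^ 2 * a) * b).
{ apply Rle_trans with (1 := h2).
  assert ((1 + x ^ 2) ^ 2 <= 4) by nra.
  replace (T ^ 2 * (1 + x ^ 2) ^ 2 * (a * b)) with ((1 + x ^ 2) ^ 2 * (T ^ 2 * (a * b))) by ring.
  replace (4 * (T ^ 2 * a) * b) with (4 * (T ^ 2 * (a * b))) by ring.
  apply Rmult_le_compat_r; [|easy]. apply Rmult_le_pos; nra. }
assert (h5 : S <= 4 * (T + 2) * b).
{ apply (Rmult_le_reg_l S); [easy|].
  assert (4 * (T ^ 2 * a) * b <= 4 * ((T + 2) * S) * b) by (apply Rmult_le_compat_r; lra). lra. }
split; [|exact (Rle_trans _ _ _ h3 h5)].
apply (Rmult_le_reg_l (T ^ 2)); [nra|].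
apply Rle_trans with (1 := h1).
apply Rle_trans with ((T + 2) * (4 * (T + 2) * b)); [apply Rmult_le_compat_l; lra|].
replace ((T + 2) * (4 * (T + 2) * b)) with (4 * (T + 2) ^ 2 * b) by ring.
replace (T ^ 2 * (16 * b)) with (16 * T ^ 2 * b) by ring.
apply Rmult_le_compat_r; [easy|]. nra.
Qed.

(** Compactness makes the constant of [ray_form_growth] uniform over all directions meeting a
    horizontal side. *)
Lemma ray_form_1_min : exists m, 0 < m /\ forall x, -1 <= x <= 1 -> m <= ray_form x 1.
Proof.
destruct (continuity_ab_min (fun x => ray_form x 1) (-1) 1) as [x0 [H Hx0]]; [lra| |].
- intros c _. apply derivable_continuous_pt.
  destruct (Cder_path J Ci 1 c _ (BesselJ_Cder _ _)) as [j1 j2].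
  destruct (Cder_path D Ci 1 c _ (dJ_Cder _ _)) as [d1 d2].
  eexists. apply is_derive_Reals.
  apply (is_derive_ext (fun x : R => (1 * (1 + x * x)) * (Re (D (Ci + x * 1)%C) * Im (J (Ci + x * 1)%C) - Im (D (Ci + x * 1)%C) * Re (J (Ci + x * 1)%C)))).
  { intros x. unfold ray_form. fold J D.
    replace (ray x 1) with (Ci + x * 1)%C by (unfold ray; ring). simpl; ring. }
  apply Rder_mult.
  + apply Rder_mult; [apply Rder_const|]. apply Rder_plus; [apply Rder_const|]. apply Rder_mult; apply Rder_id.
  + apply Rder_minus; apply Rder_mult; eassumption.
- exists (ray_form x0 1). split; [apply ray_form_pos; lra|]. exact H.
Qed.

(** Every term of [ray_form] contains a component of [J'], so a zero of [J'] in the upper half-plane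
    would contradict its positivity; parity covers the lower half-plane. *)
Lemma dJ_neq0_nonreal (z : C) : Im z <> 0 -> D z <> 0%C.
Proof.
assert (A : forall z : C, 0 < Im z -> D z <> 0%C).
{ intros w Hw h. pose proof (ray_form_pos (Re w / Im w) (Im w) Hw) as Hp.
  unfold ray_form in Hp. fold D in Hp.
  replace (ray (Re w / Im w) (Im w)) with w in Hp.
  - rewrite h in Hp. simpl in Hp. lra.
  - unfold ray. apply C_eq_Re_Im; unfold Cplus, Cmult, Ci, RtoC, Re, Im; simpl; field; unfold Im in Hw; lra. }
intros Hz. destruct (Rlt_or_le 0 (Im z)) as [H|H]; [now apply A|].
intros h. apply (A (- z)%C).
- rewrite im_opp. lra.
- destruct (Bessel_parity q) as [s [_ Hs]]. destruct (Hs z) as [_ [h1 _]].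
  fold D in h1. rewrite h1, h. ring.
Qed.

End Ray.

(** * Zeros and amplitude on the real axis *)

Section RealAxis.
Variable q : nat.

Definition bj (x : R) : R := Re (BesselJ (Z.of_nat q) x).
Definition bd (x : R) : R := Re (dJ (Z.of_nat q) x).
Definition bdd (x : R) : R := Re (ddJ (Z.of_nat q) x).

Lemma bj_RtoC (x : R) : BesselJ (Z.of_nat q) x = RtoC (bj x).
Proof. apply C_eq_Re_Im; [easy|]. rewrite (proj1 (BesselJ_real q x)). easy. Qed.

Lemma bd_RtoC (x : R) : dJ (Z.of_nat q) x = RtoC (bd x).
Proof. apply C_eq_Re_Im; [easy|]. rewrite (proj2 (BesselJ_real q x)). easy. Qed.

Lemma is_derive_real_path (h : C -> C) (l : C) (x : R) :
  Cder h x l -> is_derive (fun t : R => Re (h t)) x (Re l).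
Proof.
intros H. destruct (Cder_path h 0 1 x l) as [h1 _].
{ now replace (0 + x * 1)%C with (RtoC x) by ring. }
replace (l * 1)%C with l in h1 by ring. revert h1. apply is_derive_ext.
intros t. now replace (0 + t * 1)%C with (RtoC t) by ring.
Qed.

Lemma bj_derive x : is_derive bj x (bd x).
Proof. apply is_derive_real_path, BesselJ_Cder. Qed.

Lemma bd_derive x : is_derive bd x (bdd x).
Proof. apply is_derive_real_path, dJ_Cder. Qed.

Lemma bessel_ode_real x : x ^ 2 * bdd x + x * bd x + (x ^ 2 - INR q ^ 2) * bj x = 0.
Proof.
pose proof (f_equal Re (Bessel_ode (Z.of_nat q) x)) as H.
rewrite <- INR_IZR_INZ, <- !RtoC_mult, <- RtoC_minus, !re_plus, !re_scal_l in H.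
fold (bj x) (bd x) (bdd x) in H. simpl in H |- *. lra.
Qed.

Lemma bj_neq0_near_0 : exists d, 0 < d /\ forall x, 0 < x < d -> bj x <> 0.
Proof.
destruct (BesselJ_neq0_near_0 q) as [d [Hd H]]. exists d. split; [easy|].
intros x Hx h. apply (H x).
- rewrite Cmod_R, Rabs_pos_eq; lra.
- now rewrite bj_RtoC, h.
Qed.

(** The self-adjoint form of Bessel's equation is [x (x J')' = (q^2 - x^2) J]. *)
Definition bk (x : R) : R := x * bd x.

Lemma bk_derive x : x <> 0 -> is_derive bk x ((INR q ^ 2 - x ^ 2) * bj x / x).
Proof.
intros Hx. replace ((INR q ^ 2 - x ^ 2) * bj x / x) with (1 * bd x + x * bdd x).
- apply Rder_mult; [apply Rder_id | apply bd_derive].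
- pose proof (bessel_ode_real x) as H. apply (Rmult_eq_reg_r x); [|easy].
  replace ((INR q ^ 2 - x ^ 2) * bj x / x * x) with ((INR q ^ 2 - x ^ 2) * bj x) by (field; easy). lra.
Qed.

(** On [(0, q]] the product [J * x J'] starts from 0, and [x] times its derivative is
    [(x J')^2 + (q^2 - x^2) J^2], nonnegative and positive near 0. *)
Lemma bd_neq0_le x : 0 < x <= INR q -> bd x <> 0.
Proof.
intros [Hx Hxq].
destruct bj_neq0_near_0 as [d [Hd Hj]].
set (f' := fun t => bd t * bk t + bj t * (1 * bd t + t * bdd t)).
assert (HD : forall t, is_derive (fun t => bj t * bk t) t (f' t)).
{ intros t. apply (Rder_mult bj bk); [apply bj_derive|].
  apply Rder_mult; [apply Rder_id | apply bd_derive]. }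
assert (Hf : forall t, t * f' t = bk t ^ 2 + (INR q ^ 2 - t ^ 2) * bj t ^ 2).
{ intros t. unfold f', bk. pose proof (bessel_ode_real t) as H.
  apply (f_equal (Rmult (bj t))) in H. lra. }
set (t := Rmin x d / 2).
assert (Ht : 0 < t) by (unfold t; pose proof (Rmin_pos x d Hx Hd); lra).
assert (Htx : t < x) by (unfold t; pose proof (Rmin_l x d); lra).
assert (Htd : t < d) by (unfold t; pose proof (Rmin_r x d); lra).
assert (h0 : bj 0 * bk 0 = 0) by (unfold bk; ring).
destruct (MVT_cor2 (fun t => bj t * bk t) f' 0 t Ht) as [c [E Hc]].
{ intros c _. apply is_derive_Reals, HD. }
assert (h1 : 0 < f' c).
{ apply (Rmult_lt_reg_l c); [lra|]. rewrite Rmult_0_r, Hf.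
  assert (0 < bj c ^ 2) by (apply pow2_gt_0, Hj; lra).
  assert (0 < INR q ^ 2 - c ^ 2) by nra. pose proof (pow2_ge_0 (bk c)). nra. }
assert (h2 : bj t * bk t <= bj x * bk x).
{ apply (nondecreasing_derive (fun t => bj t * bk t) f' t x); [lra|intros; apply HD|].
  intros s Hs. apply (Rmult_le_reg_l s); [lra|]. rewrite Rmult_0_r, Hf.
  pose proof (pow2_ge_0 (bk s)). pose proof (pow2_ge_0 (bj s)).
  assert (0 <= INR q ^ 2 - s ^ 2) by nra. nra. }
intros h. rewrite h0 in E. unfold bk in h2 at 2. rewrite h in h2. nra.
Qed.

(** This energy has derivative [2 x J^2]. For [q > 0] it is positive at [x = q] because [J'(q)] is
    nonzero; for [q = 0] it leaves 0 strictly at the origin. Beyond [q] it forbids a common zero of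
    [J] and [J'], and so makes the zeros of [J'] simple. *)
Lemma bessel_energy_pos x : INR q < x -> 0 < bk x ^ 2 + (x ^ 2 - INR q ^ 2) * bj x ^ 2.
Proof.
intros Hx. pose proof (pos_INR q) as Hq.
set (e := fun x => bk x * bk x + (x * x - INR q ^ 2) * (bj x * bj x)).
set (e' := fun t => (1 * bd t + t * bdd t) * bk t + bk t * (1 * bd t + t * bdd t)
   + ((1 * t + t * 1 - 0) * (bj t * bj t) + (t * t - INR q ^ 2) * (bd t * bj t + bj t * bd t))).
assert (HD : forall t, is_derive e t (e' t)).
{ intros t. assert (hk : is_derive bk t (1 * bd t + t * bdd t)).
  { apply Rder_mult; [apply Rder_id | apply bd_derive]. }
  apply Rder_plus; [now apply (Rder_mult bk bk)|].
  apply (Rder_mult (fun t => t * t - INR q ^ 2) (fun t => bj t * bj t)).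
  - apply Rder_minus; [apply (Rder_mult (fun t => t) (fun t => t)); apply Rder_id | apply Rder_const].
  - apply (Rder_mult bj bj); apply bj_derive. }
assert (He' : forall t, e' t = 2 * t * bj t ^ 2).
{ intros t. unfold e', bk. pose proof (bessel_ode_real t) as H.
  apply (f_equal (Rmult (2 * bd t))) in H. lra. }
assert (Hmon : forall s t, 0 <= s <= t -> e s <= e t).
{ intros s t Hst. apply (nondecreasing_derive e e'); [lra|intros; apply HD|].
  intros r Hr. rewrite He'. pose proof (pow2_ge_0 (bj r)). nra. }
replace (bk x ^ 2 + (x ^ 2 - INR q ^ 2) * bj x ^ 2) with (e x) by (unfold e; ring).
destruct (Rle_lt_or_eq_dec 0 (INR q) Hq) as [Hq0|Hq0].
- apply Rlt_le_trans with (e (INR q)); [|apply Hmon; lra].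
  pose proof (bd_neq0_le (INR q) (conj Hq0 (Rle_refl _))) as h.
  unfold e. replace (INR q * INR q - INR q ^ 2) with 0 by ring.
  rewrite Rmult_0_l, Rplus_0_r. apply Rsqr_pos_lt. unfold bk.
  apply Rmult_integral_contrapositive_currified; lra.
- destruct bj_neq0_near_0 as [d [Hd Hj]].
  set (t := Rmin x d / 2).
  assert (Ht : 0 < t) by (unfold t; pose proof (Rmin_pos x d ltac:(lra) Hd); lra).
  assert (Htx : t < x) by (unfold t; pose proof (Rmin_l x d); lra).
  assert (Htd : t < d) by (unfold t; pose proof (Rmin_r x d); lra).
  destruct (MVT_cor2 e e' 0 t Ht) as [c [E Hc]].
  { intros c _. apply is_derive_Reals, HD. }
  assert (h0 : e 0 = 0) by (unfold e, bk; rewrite <- Hq0; ring).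
  assert (h1 : 0 < e' c).
  { rewrite He'. assert (0 < bj c ^ 2) by (apply pow2_gt_0, Hj; lra). nra. }
  pose proof (Hmon t x ltac:(lra)). nra.
Qed.

Lemma bd_zero_gt x : 0 < x -> bd x = 0 -> INR q < x.
Proof.
intros Hx H. apply Rnot_le_lt. intros h. now apply (bd_neq0_le x).
Qed.

Lemma ddJ_neq0_real x : 0 < x -> bd x = 0 -> bdd x <> 0.
Proof.
intros Hx H h. pose proof (bd_zero_gt x Hx H) as Hq. pose proof (pos_INR q).
pose proof (bessel_energy_pos x Hq) as He. unfold bk in He. rewrite H, Rmult_0_r in He.
pose proof (bessel_ode_real x) as ode. rewrite h, H, !Rmult_0_r, !Rplus_0_l in ode.
assert (bj x = 0). { apply Rmult_integral in ode. destruct ode as [ode|]; [nra|easy]. }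
rewrite H1 in He. simpl in He. lra.
Qed.

(** Rolle's theorem for [x J']: its derivative is [J] times a factor that vanishes only at [x = q],
    and all positive zeros of [J'] lie beyond [q]. *)
Lemma bj_zero_between a b :
  0 < a < b -> bd a = 0 -> bd b = 0 -> exists c, a < c < b /\ bj c = 0.
Proof.
intros Hab Ha Hb. pose proof (bd_zero_gt a ltac:(lra) Ha) as Hq. pose proof (pos_INR q).
destruct (MVT_cor2 bk (fun x => (INR q ^ 2 - x ^ 2) * bj x / x) a b) as [c [E Hc]]; [lra| |].
- intros c Hc. apply is_derive_Reals, bk_derive. lra.
- exists c. split; [easy|]. unfold bk in E. rewrite Ha, Hb, !Rmult_0_r in E.
  assert (h : (INR q ^ 2 - c ^ 2) * bj c = 0).
  { assert (h : (INR q ^ 2 - c ^ 2) * bj c / c = 0) by nra.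
    apply (f_equal (Rmult c)) in h. rewrite Rmult_0_r in h. rewrite <- h. field. lra. }
  apply Rmult_integral in h. destruct h as [h|]; [nra|easy].
Qed.

(* [amp] is [u'^2 + (1 - (q^2 - 1/4)/x^2) u^2] for [u = sqrt x J(x)], whose derivative is O(u^2 / x^3). *)
Definition amp (x : R) : R := x * bd x ^ 2 + bj x * bd x + (x - (INR q ^ 2 - / 2) / x) * bj x ^ 2.

Lemma amp_derive x : 0 < x -> is_derive amp x ((2 * INR q ^ 2 - / 2) * bj x ^ 2 / x ^ 2).
Proof.
intros Hx.
assert (Hi : is_derive (fun x => / x) x (- / x ^ 2)).
{ auto_derive; [lra | field; lra]. }
apply (is_derive_ext (fun x => x * (bd x * bd x) + bj x * bd x + (x - (INR q ^ 2 - / 2) * / x) * (bj x * bj x))).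
{ intros t. match goal with |- ?a = ?b => change (@eq R a b) end. unfold amp, Rdiv. ring. }
replace ((2 * INR q ^ 2 - / 2) * bj x ^ 2 / x ^ 2) with
  ((1 * (bd x * bd x) + x * (bdd x * bd x + bd x * bdd x)) + (bd x * bd x + bj x * bdd x) +
   ((1 - (INR q ^ 2 - / 2) * - / x ^ 2) * (bj x * bj x) + (x - (INR q ^ 2 - / 2) * / x) * (bd x * bj x + bj x * bd x))).
- apply Rder_plus; [apply Rder_plus|].
  + apply (Rder_mult (fun x => x) (fun x => bd x * bd x)); [apply Rder_id|].
    apply (Rder_mult bd bd); apply bd_derive.
  + apply (Rder_mult bj bd); [apply bj_derive | apply bd_derive].
  + apply (Rder_mult (fun x => x - (INR q ^ 2 - / 2) * / x) (fun x => bj x * bj x)).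
    * apply Rder_minus; [apply Rder_id|]. now apply is_derive_scal.
    * apply (Rder_mult bj bj); apply bj_derive.
- replace (bdd x) with (- (bd x / x) - (1 - INR q ^ 2 / x ^ 2) * bj x).
  + field. lra.
  + pose proof (bessel_ode_real x) as H. apply (Rmult_eq_reg_l (x ^ 2)); [|nra].
    replace (x ^ 2 * (- (bd x / x) - (1 - INR q ^ 2 / x ^ 2) * bj x)) with
      (- x * bd x - (x ^ 2 - INR q ^ 2) * bj x) by (field; lra). lra.
Qed.

(** At a zero of [J] the quantity [amp] is [x J'^2]. Since [J^2] is controlled by [amp], the
    derivative satisfies [amp' >= - (2 / x^2) amp], so [amp * exp (- 2 / x)] is nondecreasing, with
    an exponential between positive bounds. *)
Lemma bd_amplitude : exists c x0, 0 < c /\ 0 < x0 /\ forall x, x0 <= x -> bj x = 0 -> c <= x * bd x ^ 2.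
Proof.
(* From [2 q + 1] on, [x^2 - q^2 + 1/4] is at least [x^2 / 4]; this is what makes [amp] dominate
   [x J^2 / 4]. *)
pose proof (pos_INR q) as Hq. set (x0 := 2 * INR q + 1).
assert (Hamp : forall x, x0 <= x ->
  x * amp x = (bk x + bj x / 2) ^ 2 + (x ^ 2 - INR q ^ 2 + / 4) * bj x ^ 2).
{ intros x Hx. unfold amp, bk. field. unfold x0 in Hx. lra. }
assert (Hamp4 : forall x, x0 <= x -> x * bj x ^ 2 <= 4 * amp x).
{ intros x Hx. apply (Rmult_le_reg_l x); [unfold x0 in Hx; lra|].
  replace (x * (4 * amp x)) with (4 * (x * amp x)) by ring. rewrite Hamp by easy.
  pose proof (pow2_ge_0 (bk x + bj x / 2)). pose proof (pow2_ge_0 (bj x)).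
  assert (x ^ 2 <= 4 * (x ^ 2 - INR q ^ 2 + / 4)) by (unfold x0 in Hx; nra). nra. }
assert (H0 : 0 < amp x0).
{ assert (Hx0 : x0 <= x0) by lra. apply (Rmult_lt_reg_l x0); [unfold x0; lra|].
  rewrite Rmult_0_r, Hamp by easy.
  pose proof (bessel_energy_pos x0 ltac:(unfold x0; lra)) as He.
  assert (hp : 0 < x0 ^ 2 - INR q ^ 2 + / 4) by (unfold x0; nra).
  destruct (Req_dec (bj x0) 0) as [h|h].
  - rewrite h in He |- *. unfold Rdiv. rewrite Rmult_0_l, Rplus_0_r. simpl in He |- *. lra.
  - pose proof (pow2_gt_0 _ h). pose proof (pow2_ge_0 (bk x0 + bj x0 / 2)). nra. }
exists (amp x0 * exp (- 2 * / x0)), x0. split; [|split].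
- apply Rmult_lt_0_compat; [easy | apply exp_pos].
- unfold x0; lra.
- intros x Hx Hj.
  assert (Hmon : amp x0 * exp (- 2 * / x0) <= amp x * exp (- 2 * / x)).
  { apply (nondecreasing_derive (fun t => amp t * exp (- 2 * / t))
      (fun t => (2 * INR q ^ 2 - / 2) * bj t ^ 2 / t ^ 2 * exp (- 2 * / t) + amp t * (2 / t ^ 2 * exp (- 2 * / t))) x0 x Hx).
    - intros t Ht. assert (0 < t) by (unfold x0 in Ht; lra).
      apply (Rder_mult amp (fun t => exp (- 2 * / t))); [now apply amp_derive|].
      auto_derive; [lra | field; lra].
    - intros t Ht. assert (ht : 1 <= t) by (unfold x0 in Ht; lra).
      specialize (Hamp4 t ltac:(lra)).
      replace ((2 * INR q ^ 2 - / 2) * bj t ^ 2 / t ^ 2 * exp (- 2 * / t) + amp t * (2 / t ^ 2 * exp (- 2 * / t)))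
        with (((2 * INR q ^ 2 - / 2) * bj t ^ 2 + 2 * amp t) * (exp (- 2 * / t) * / t ^ 2)) by (field; lra).
      apply Rmult_le_pos.
      + pose proof (pow2_ge_0 (bj t)). pose proof (pow2_ge_0 (INR q)). nra.
      + left. apply Rmult_lt_0_compat; [apply exp_pos|]. apply Rinv_0_lt_compat. nra. }
  apply Rle_trans with (1 := Hmon).
  unfold amp. rewrite Hj.
  assert (h : exp (- 2 * / x) <= 1).
  { rewrite <- exp_0. left. apply exp_increasing. assert (0 < / x); [|lra].
    apply Rinv_0_lt_compat. unfold x0 in Hx. lra. }
  assert (0 <= x * bd x ^ 2) by (apply Rmult_le_pos; [unfold x0 in Hx; lra | apply pow2_ge_0]).
  simpl in *. nra.
Qed.

End RealAxis.

(** * Growth on the vertical sides *)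

Lemma Cdot_le (a b : C) : - (Cmod a * Cmod b) <= Re a * Re b + Im a * Im b.
Proof.
replace (Re a * Re b + Im a * Im b) with (Re (Cconj a * b)).
- rewrite <- (Cmod_conj a), <- Cmod_mult. pose proof (re_le_Cmod (Cconj a * b)) as h.
  apply Rabs_le_between in h. lra.
- destruct a, b. unfold Cmult, Cconj, Re, Im. simpl. ring.
Qed.

Section Vertical.
Variables (q : nat) (X sg : R).
Hypothesis HX : 1 <= X.
Hypothesis HXq : 18 * (1 + INR q ^ 2) <= X.
Hypothesis HJ : bj q X = 0.
Hypothesis Hsg : sg = 1 \/ sg = -1.

Let J := BesselJ (Z.of_nat q).
Let D := dJ (Z.of_nat q).
Let D2 := ddJ (Z.of_nat q).
(** Bounds the size of [J'' + J] relative to [|J| + |J'|]. The 18 in [HXq] makes it at most [1/18],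
    the value for which [a <= b + 6 dl (a + b)] becomes [a <= 2 b]. *)
Let dl := (1 + INR q ^ 2) / X.

(** The sign [sg] selects the upper or lower half of the side, so [y >= 0] always leads away from
    the real axis. *)
Definition vert (y : R) : C := (X + y * (sg * Ci))%C.

Let j1 y := Re (J (vert y)).
Let j2 y := Im (J (vert y)).
Let v1 y := Re (sg * Ci * D (vert y))%C.
Let v2 y := Im (sg * Ci * D (vert y))%C.
Let w1 y := - Re (D2 (vert y)).
Let w2 y := - Im (D2 (vert y)).

Let sgsq : (RtoC sg * Ci * (RtoC sg * Ci))%C = (- (1))%C.
Proof.
unfold Cmult, Copp, Ci, RtoC. simpl. destruct Hsg as [->| ->]; f_equal; ring.
Qed.

Let dj y : is_derive j1 y (v1 y) /\ is_derive j2 y (v2 y).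
Proof.
destruct (Cder_path J X (sg * Ci) y _ (BesselJ_Cder _ _)) as [h1 h2].
unfold v1, v2. rewrite (Cmult_comm (sg * Ci)). split; [exact h1 | exact h2].
Qed.

Let dv y : is_derive v1 y (w1 y) /\ is_derive v2 y (w2 y).
Proof.
destruct (Cder_path (fun z => sg * Ci * D z)%C X (sg * Ci) y (sg * Ci * D2 (vert y))%C) as [h1 h2].
{ apply Cder_scal, dJ_Cder. }
replace (sg * Ci * D2 (vert y) * (sg * Ci))%C with (- D2 (vert y))%C in h1, h2.
- unfold w1, w2. rewrite <- re_opp, <- im_opp. split; [exact h1 | exact h2].
- replace (sg * Ci * D2 (vert y) * (sg * Ci))%C with (sg * Ci * (sg * Ci) * D2 (vert y))%C by ring.
  rewrite sgsq. ring.
Qed.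

Let dl_bound : 0 < dl <= / 18.
Proof.
unfold dl. pose proof (pow2_ge_0 (INR q)). split.
- apply Rdiv_lt_0_compat; lra.
- apply Rle_div_l; lra.
Qed.

(** As a function of [y], [u = J (vert y)] nearly solves [u'' = u]. For an exact solution
    [a' = b' = 2 s] and [s' = a + b], so [a + b + 2 s = |u + u'|^2] grows exactly like [exp (2 y)]
    and [b - a] is conserved. *)
Let a y := j1 y * j1 y + j2 y * j2 y.
Let b y := v1 y * v1 y + v2 y * v2 y.
Let s y := j1 y * v1 y + j2 y * v2 y.

Let a_Cmod y : a y = Cmod (J (vert y)) ^ 2.
Proof. rewrite Cmod2_alt. unfold a, j1, j2. ring. Qed.

Let modV y : Cmod (sg * Ci * D (vert y)) = Cmod (D (vert y)).
Proof.
rewrite !Cmod_mult, Cmod_Ci, Cmod_R. replace (Rabs sg) with 1; [ring|].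
destruct Hsg as [->| ->]; [now rewrite Rabs_R1 | rewrite Rabs_left; lra].
Qed.

Let b_Cmod y : b y = Cmod (D (vert y)) ^ 2.
Proof. rewrite <- modV, Cmod2_alt. unfold b, v1, v2. ring. Qed.

Let vert_Cmod y : X <= Cmod (vert y).
Proof.
apply Rle_trans with (2 := re_le_Cmod _). unfold vert, Cplus, Cmult, Ci, RtoC, Re; simpl.
rewrite Rabs_pos_eq; lra.
Qed.

(* [- (J'' + J) = J'/z - q^2 J/z^2] is small compared with [|J| + |J'|]. *)
Let perturbation y :
  - (3 / 2 * dl * (a y + b y)) <= v1 y * (w1 y - j1 y) + v2 y * (w2 y - j2 y) /\
  - (3 / 2 * dl * (a y + b y)) <= j1 y * (w1 y - j1 y) + j2 y * (w2 y - j2 y).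
Proof.
set (zt := vert y). set (eta := (- (D2 zt + J zt))%C).
pose proof (vert_Cmod y) as Hz. fold zt in Hz.
assert (Hz0 : zt <> 0%C) by (apply Cmod_gt_0; lra).
assert (E : eta = (D zt / zt - INR q * INR q * J zt / (zt * zt))%C).
{ pose proof (Bessel_ode (Z.of_nat q) zt) as ode. rewrite <- INR_IZR_INZ in ode.
  fold D2 D J in ode.
  replace eta with (eta + / (zt * zt) * (zt * zt * D2 zt + zt * D zt + (zt * zt - INR q * INR q) * J zt))%C.
  - unfold eta. field. easy.
  - rewrite ode. ring. }
assert (Hb : Cmod eta <= dl * (Cmod (J zt) + Cmod (D zt))).
{ rewrite E. unfold Cminus. apply Rle_trans with (1 := Cmod_triangle _ _).
  rewrite Cmod_opp, !Cmod_div by (try apply Cmult_neq_0; easy).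
  rewrite !Cmod_mult, Cmod_R, (Rabs_pos_eq (INR q)) by apply pos_INR.
  pose proof (Cmod_ge_0 (J zt)) as hj. pose proof (Cmod_ge_0 (D zt)) as hd.
  assert (hi : / Cmod zt <= / X) by (apply Rinv_le_contravar; lra).
  assert (hi0 : 0 < / Cmod zt) by (apply Rinv_0_lt_compat; lra).
  assert (hx : / X <= 1) by (rewrite <- Rinv_1; apply Rinv_le_contravar; lra).
  assert (h2 : / (Cmod zt * Cmod zt) <= / X).
  { rewrite Rinv_mult. nra. }
  unfold dl, Rdiv. pose proof (pow2_ge_0 (INR q)) as hq.
  assert (t1 : Cmod (D zt) * / Cmod zt <= Cmod (D zt) * / X) by (apply Rmult_le_compat_l; easy).
  assert (t2 : INR q * INR q * Cmod (J zt) * / (Cmod zt * Cmod zt) <= INR q * INR q * Cmod (J zt) * / X).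
  { apply Rmult_le_compat_l; [|easy]. apply Rmult_le_pos; nra. }
  assert (0 <= INR q ^ 2 * / X * Cmod (D zt)) by (apply Rmult_le_pos; [apply Rmult_le_pos; lra | lra]).
  assert (0 <= / X * Cmod (J zt)) by (apply Rmult_le_pos; lra).
  lra. }
assert (He1 : w1 y - j1 y = Re eta) by (unfold w1, j1, eta; rewrite re_opp, re_plus; fold zt; ring).
assert (He2 : w2 y - j2 y = Im eta) by (unfold w2, j2, eta; rewrite im_opp, im_plus; fold zt; ring).
rewrite He1, He2, a_Cmod, b_Cmod. fold zt.
pose proof (Cmod_ge_0 (J zt)) as hj. pose proof (Cmod_ge_0 (D zt)) as hd.
pose proof dl_bound as [hdl _].
set (p := Cmod (J zt)) in *. set (r := Cmod (D zt)) in *.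
assert (hpr : 2 * (p * r) <= p ^ 2 + r ^ 2) by (pose proof (pow2_ge_0 (p - r)); lra).
split.
- pose proof (Cdot_le (sg * Ci * D zt)%C eta) as h. pose proof (modV y) as hm. fold zt in hm. rewrite hm in h. fold r in h.
  unfold v1, v2. fold zt.
  assert (r * Cmod eta <= r * (dl * (p + r))) by (apply Rmult_le_compat_l; easy).
  assert (dl * (2 * (p * r)) <= dl * (p ^ 2 + r ^ 2)) by (apply Rmult_le_compat_l; lra).
  assert (0 <= dl * p ^ 2) by (apply Rmult_le_pos; [lra | apply pow2_ge_0]). lra.
- pose proof (Cdot_le (J zt) eta) as h. fold p in h. unfold j1, j2. fold zt.
  assert (p * Cmod eta <= p * (dl * (p + r))) by (apply Rmult_le_compat_l; easy).
  assert (dl * (2 * (p * r)) <= dl * (p ^ 2 + r ^ 2)) by (apply Rmult_le_compat_l; lra).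
  assert (0 <= dl * r ^ 2) by (apply Rmult_le_pos; [lra | apply pow2_ge_0]). lra.
Qed.

Let a' y := 2 * s y.
Let b' y := 2 * (v1 y * w1 y + v2 y * w2 y).
Let s' y := b y + (j1 y * w1 y + j2 y * w2 y).

Let da y : is_derive a y (a' y).
Proof.
replace (a' y) with ((v1 y * j1 y + j1 y * v1 y) + (v2 y * j2 y + j2 y * v2 y)) by (unfold a', s; ring).
apply (Rder_plus (fun t => j1 t * j1 t) (fun t => j2 t * j2 t));
[apply (Rder_mult j1 j1); exact (proj1 (dj y)) | apply (Rder_mult j2 j2); exact (proj2 (dj y))].
Qed.

Let db y : is_derive b y (b' y).
Proof.
replace (b' y) with ((w1 y * v1 y + v1 y * w1 y) + (w2 y * v2 y + v2 y * w2 y)) by (unfold b'; ring).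
apply (Rder_plus (fun t => v1 t * v1 t) (fun t => v2 t * v2 t));
[apply (Rder_mult v1 v1); exact (proj1 (dv y)) | apply (Rder_mult v2 v2); exact (proj2 (dv y))].
Qed.

Let ds y : is_derive s y (s' y).
Proof.
replace (s' y) with ((v1 y * v1 y + j1 y * w1 y) + (v2 y * v2 y + j2 y * w2 y)) by (unfold s', b; ring).
apply (Rder_plus (fun t => j1 t * v1 t) (fun t => j2 t * v2 t));
[apply (Rder_mult j1 v1); [exact (proj1 (dj y)) | exact (proj1 (dv y))]
|apply (Rder_mult j2 v2); [exact (proj2 (dj y)) | exact (proj2 (dv y))]].
Qed.

Let ab_nonneg y : 0 <= a y /\ 0 <= b y /\ 2 * Rabs (s y) <= a y + b y.
Proof.
unfold a, b, s. repeat split; try nra.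
pose proof (pow2_ge_0 (j1 y - v1 y)). pose proof (pow2_ge_0 (j2 y - v2 y)).
pose proof (pow2_ge_0 (j1 y + v1 y)). pose proof (pow2_ge_0 (j2 y + v2 y)).
unfold Rabs. destruct (Rcase_abs _); lra.
Qed.

Let b'_ge y : 2 * s y - 3 * dl * (a y + b y) <= b' y.
Proof.
destruct (perturbation y) as [h _]. unfold b', s.
replace (2 * (v1 y * w1 y + v2 y * w2 y)) with
  (2 * (j1 y * v1 y + j2 y * v2 y) + 2 * (v1 y * (w1 y - j1 y) + v2 y * (w2 y - j2 y))) by ring. lra.
Qed.

Let s'_ge y : (a y + b y) - 3 / 2 * dl * (a y + b y) <= s' y.
Proof.
destruct (perturbation y) as [_ h]. unfold s'.
replace (j1 y * w1 y + j2 y * w2 y) with (a y + (j1 y * (w1 y - j1 y) + j2 y * (w2 y - j2 y))) by (unfold a; ring).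
lra.
Qed.

Let J0 : J (vert 0) = 0%C.
Proof.
replace (vert 0) with (RtoC X) by (unfold vert; ring). unfold J. now rewrite bj_RtoC, HJ.
Qed.

Let s_nonneg y : 0 <= y -> 0 <= s y.
Proof.
intros Hy. replace 0 with (s 0).
- apply (nondecreasing_derive s s' 0 y Hy); [intros; apply ds|].
  intros t _. apply Rle_trans with (2 := s'_ge t).
  destruct (ab_nonneg t) as [h1 [h2 _]]. pose proof dl_bound. nra.
- unfold s, j1, j2. rewrite J0. simpl. ring.
Qed.

Let b0 : b 0 = bd q X ^ 2 /\ a 0 = 0 /\ s 0 = 0.
Proof.
split; [|split].
- rewrite b_Cmod. replace (vert 0) with (RtoC X) by (unfold vert; ring).
  unfold D. rewrite bd_RtoC, Cmod_R. apply pow2_abs.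
- rewrite a_Cmod, J0, Cmod_0. ring.
- unfold s, j1, j2. rewrite J0. simpl. ring.
Qed.

Lemma vertical_bounds y : 0 <= y <= X ->
  Cnorm2 (J (vert y)) <= 2 * Cnorm2 (D (vert y)) /\
  bd q X ^ 2 * exp (2 * y) <= 6 * exp (6 * (1 + INR q ^ 2)) * Cnorm2 (D (vert y)).
Proof.
intros Hy. rewrite !Cnorm2_Cmod, <- a_Cmod, <- b_Cmod.
pose proof dl_bound as Hdl. destruct b0 as [Hb0 [Ha0 Hs0]].
set (W := fun y => a y + b y + 2 * s y). set (W' := fun y => a' y + b' y + 2 * s' y).
assert (dW : forall t, is_derive W t (W' t)).
{ intros t. apply (Rder_plus (fun t => a t + b t) (fun t => 2 * s t)).
  - apply (Rder_plus a b); [apply da | apply db].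
  - apply is_derive_scal, ds. }
assert (HW : forall t, 0 <= t -> a t + b t <= W t <= 2 * (a t + b t)).
{ intros t Ht. pose proof (s_nonneg t Ht) as h. destruct (ab_nonneg t) as [_ [_ h2]].
  rewrite Rabs_pos_eq in h2 by easy. unfold W. lra. }
assert (HW' : forall t, 0 <= t -> (2 - 6 * dl) * W t <= W' t).
{ intros t Ht. pose proof (b'_ge t). pose proof (s'_ge t). destruct (HW t Ht) as [h _].
  assert (dl * (a t + b t) <= dl * W t) by (apply Rmult_le_compat_l; lra).
  assert (e : W t = a t + b t + 2 * s t) by reflexivity.
  assert (e' : W' t = 2 * s t + b' t + 2 * s' t) by reflexivity.
  rewrite e'. clear e'. set (w := W t) in *. clearbody w. lra. }
(* Gronwall's argument for the growing form [W], whose rate 2 loses at most [6 dl] to the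
   perturbation. *)
assert (g1 : W 0 * exp (- (2 - 6 * dl) * 0) <= W y * exp (- (2 - 6 * dl) * y)).
{ apply (nondecreasing_derive (fun t => W t * exp (- (2 - 6 * dl) * t))
    (fun t => W' t * exp (- (2 - 6 * dl) * t) + W t * (- (2 - 6 * dl) * exp (- (2 - 6 * dl) * t))) 0 y); [lra| |].
  - intros t _. apply (Rder_mult W (fun t => exp (- (2 - 6 * dl) * t))); [apply dW | apply Rder_exp_scal].
  - intros t Ht. pose proof (HW' t ltac:(lra)). pose proof (exp_pos (- (2 - 6 * dl) * t)). nra. }
(* The error in the conservation of [b - a] is at most [3 dl (a + b)]; adding [3 dl W] absorbs it
   because [W' >= W >= a + b]. *)
assert (g2 : (b 0 - a 0) + 3 * dl * W 0 <= (b y - a y) + 3 * dl * W y).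
{ apply (nondecreasing_derive (fun t => (b t - a t) + 3 * dl * W t)
    (fun t => (b' t - a' t) + 3 * dl * W' t) 0 y); [lra| |].
  - intros t _. apply (Rder_plus (fun t => b t - a t) (fun t => 3 * dl * W t)).
    + apply (Rder_minus b a); [apply db | apply da].
    + apply is_derive_scal, dW.
  - intros t Ht. pose proof (b'_ge t). pose proof (HW' t ltac:(lra)) as h. destruct (HW t ltac:(lra)) as [h1 _].
    destruct (ab_nonneg t) as [k1 [k2 _]].
    assert (W t <= W' t) by nra.
    assert (dl * (a t + b t) <= dl * W' t) by (apply Rmult_le_compat_l; lra).
    unfold a'. lra. }
assert (HW0 : W 0 = bd q X ^ 2) by (unfold W; rewrite Hb0, Ha0, Hs0; ring).
destruct (HW y ltac:(lra)) as [k1 k2]. destruct (ab_nonneg y) as [ka [kb _]].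
rewrite Ha0, Hb0, HW0 in g2. pose proof (pow2_ge_0 (bd q X)) as hd0.
assert (g3 : a y <= 2 * b y).
{ assert (0 <= dl * bd q X ^ 2) by (apply Rmult_le_pos; lra).
  assert (dl * W y <= / 18 * (2 * (a y + b y))).
  { apply Rmult_le_compat; lra. }
  lra. }
split; [exact g3|].
apply (Rmult_le_compat_r (exp (2 * y))) in g1; [|left; apply exp_pos].
rewrite Rmult_0_r, exp_0, Rmult_1_r, HW0, Rmult_assoc, <- exp_plus in g1.
apply Rle_trans with (1 := g1).
(* The loss in the exponent is [6 dl y], bounded over the whole side because [dl X = 1 + q^2]. *)
assert (he : exp (- (2 - 6 * dl) * y + 2 * y) <= exp (6 * (1 + INR q ^ 2))).
{ replace (- (2 - 6 * dl) * y + 2 * y) with (6 * (dl * y)) by ring.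
  assert (hx : dl * y <= 1 + INR q ^ 2).
  { replace (1 + INR q ^ 2) with (dl * X) by (unfold dl; field; lra).
    apply Rmult_le_compat_l; lra. }
  destruct (Rle_lt_or_eq_dec _ _ hx) as [h|h].
  - left. apply exp_increasing. lra.
  - right. f_equal. lra. }
pose proof (exp_pos (- (2 - 6 * dl) * y + 2 * y)).
apply Rle_trans with (6 * b y * exp (- (2 - 6 * dl) * y + 2 * y)); [apply Rmult_le_compat_r; lra|].
replace (6 * exp (6 * (1 + INR q ^ 2)) * b y) with (6 * b y * exp (6 * (1 + INR q ^ 2))) by ring.
apply Rmult_le_compat_l; lra.
Qed.

End Vertical.

(** * Laurent expansions *)

Local Open Scope C_scope.

Lemma Csum_terms_bounded a l : Csum a l -> exists M : R, forall n, (Cmod (a n) <= M)%R.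
Proof.
intros H.
destruct (filterlim_bounded (K := C_AbsRing) (V := C_NormedModule) (sum_n a)) as [M HM]; [now exists l|].
exists (2 * M)%R. intros n.
assert (HM' : forall n, (Cmod (sum_n a n) <= M)%R) by exact HM.
destruct n as [|n].
- specialize (HM' O). rewrite sum_O in HM'. pose proof (Cmod_ge_0 (a O)). lra.
- assert (E : a (S n) = sum_n a (S n) - sum_n a n).
  { rewrite sum_Sn. change (a (S n) = sum_n a n + a (S n) - sum_n a n). ring. }
  rewrite E. unfold Cminus. apply Rle_trans with (1 := Cmod_triangle _ _).
  rewrite Cmod_opp. pose proof (HM' n). pose proof (HM' (S n)). lra.
Qed.

Lemma contour_decay rho h M :
  (0 < rho)%R -> (forall z, on_square rho z -> cont h z) ->
  (forall z, on_square rho z -> (Cmod (h z) <= M)%R) ->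
  (Cmod (contour rho h) <= 16 * rho * M)%R.
Proof.
intros Hr Hc H. replace (16 * rho * M)%R with (8 * rho * (2 * M))%R by ring.
apply (contour_Cmod_le rho h (fun _ => M)); try easy.
- lra.
- replace (2 * M)%R with (scal (1 - -1)%R M) by (unfold scal; simpl; unfold mult; simpl; ring).
  apply (is_RInt_const (V := R_NormedModule)).
- intros u t Hu Ht. apply H. now apply unit4_on_square.
Qed.

Lemma Rle_0_of_le_inv (x K R0 : R) : (forall r, (R0 < r)%R -> (x <= K / r)%R) -> (x <= 0)%R.
Proof.
intros H. apply Rnot_lt_le. intros Hx.
set (r := (Rmax 1 (Rmax (R0 + 1) ((Rabs K + 1) / x)))%R).
assert (h1 : (1 <= r)%R) by apply Rmax_l.
assert (h2 : (R0 + 1 <= r)%R) by (apply Rle_trans with (2 := Rmax_r _ _); apply Rmax_l).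
assert (h3 : ((Rabs K + 1) / x <= r)%R) by (apply Rle_trans with (2 := Rmax_r _ _); apply Rmax_r).
specialize (H r ltac:(lra)). apply Rle_div_l in h3; [|easy].
apply (Rmult_le_compat_r r) in H; [|lra].
replace (K / r * r)%R with K in H by (field; lra). pose proof (Rle_abs K). lra.
Qed.

Lemma fast_decay_S d : fast_decay d -> fast_decay (fun k => d (S k)).
Proof.
intros Hd rho Hr. destruct (Hd rho Hr) as [B HB]. exists (B / rho)%R. intros k.
apply (proj1 (Rle_div_r _ B rho Hr)). specialize (HB (S k)). simpl in HB. lra.
Qed.

(* Liouville's argument: the Cauchy integral for [d 0] vanishes in the limit, then divide by [zeta]. *)
Lemma vanishing_at_infinity n : forall d V (M rho0 : R),
  fast_decay d -> (forall z, Csum (fun k => d k * z ^ k) (V z)) ->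
  (forall z, (rho0 < Cmod z)%R -> (Cmod z * Cmod (V z) <= M)%R) -> d n = 0.
Proof.
assert (base : forall d V (M rho0 : R),
  fast_decay d -> (forall z, Csum (fun k => d k * z ^ k) (V z)) ->
  (forall z, (rho0 < Cmod z)%R -> (Cmod z * Cmod (V z) <= M)%R) -> d O = 0 /\ V 0 = 0).
{ intros d V M rho0 Hd HV HM.
  assert (HVe : entire V) by now exists d.
  destruct (entire_derive V HVe) as [V' [HV' DV]].
  assert (E0 : V 0 = d O).
  { destruct (fast_decay_Csum _ 0 (fast_decay_S d Hd)) as [l Hl]. apply (Csum_unique _ _ _ (HV 0)). eapply Csum_eq.
    - apply Csum_unshift. apply (Csum_ext (fun k => 0 * (d (S k) * 0 ^ k))).
      + intros k. simpl. ring.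
      + apply Csum_scal, Hl.
    - simpl. ring. }
  enough (V 0 = 0) by (split; [now rewrite <- E0 | easy]).
  assert (HC : forall r, (0 < r)%R -> contour r (fun z => V z / (z - 0)) = V 0 * kappa).
  { intros r Hr. apply (Cauchy_formula r (r + 1) V V').
    - lra.
    - now apply in_square_0.
    - intros z _. split; [apply DV | now apply entire_cont]. }
  assert (Hk := proj1 (Cmod_gt_0 _) kappa_neq0).
  assert (Hle : (Cmod (V 0) * Cmod kappa <= 0)%R).
  { apply (Rle_0_of_le_inv _ (16 * M) (Rmax 0 rho0)). intros r Hr.
    assert (Hr0 : (0 < r)%R) by (pose proof (Rmax_l 0 rho0); lra).
    assert (Hr1 : (rho0 < r)%R) by (pose proof (Rmax_r 0 rho0); lra).
    rewrite <- Cmod_mult, <- (HC r Hr0).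
    replace (16 * M / r)%R with (16 * r * (M / (r * r)))%R by (field; lra).
    apply contour_decay; [easy| |].
    - intros z Hz. apply continuous_Cmult; [now apply entire_cont|].
      apply (cont_inv_sub r); [lra | now apply in_square_0 | easy].
    - intros z Hz. pose proof (supnorm_le_Cmod z) as hs.
      rewrite (on_square_supnorm r z) in hs by (lra || easy).
      assert (hz : z <> 0) by (apply Cmod_gt_0; lra).
      replace (z - 0) with z by ring. rewrite Cmod_div by easy.
      specialize (HM z ltac:(lra)). pose proof (Cmod_ge_0 (V z)).
      assert (hV : (Cmod (V z) <= M / r)%R).
      { apply (proj1 (Rle_div_r _ M r Hr0)). nra. }
      replace (M / (r * r))%R with (M / r * / r)%R by (field; lra).
      unfold Rdiv at 1. apply Rmult_le_compat; try easy.
      + left. apply Rinv_0_lt_compat. lra.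
      + apply Rinv_le_contravar; lra. }
  apply Cmod_eq_0. pose proof (Cmod_ge_0 (V 0)). nra. }
induction n as [|n IH]; intros d V M rho0 Hd HV HM.
- now apply (base d V M rho0).
- destruct (base d V M rho0 Hd HV HM) as [Hd0 HV0].
  assert (Hd1 := fast_decay_S d Hd).
  set (V1 := fun z => CSeries (fun k => d (S k) * z ^ k)).
  assert (HV1 : forall z, Csum (fun k => d (S k) * z ^ k) (V1 z)).
  { intros z. now apply CSeries_fast_decay. }
  apply (IH (fun k => d (S k)) V1 M (Rmax 1 rho0) Hd1 HV1).
  intros z Hz.
  assert (hz1 : (1 < Cmod z)%R) by (pose proof (Rmax_l 1 rho0); lra).
  assert (hz2 : (rho0 < Cmod z)%R) by (pose proof (Rmax_r 1 rho0); lra).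
  assert (E : V z = z * V1 z).
  { apply (Csum_unique _ _ _ (HV z)). eapply Csum_eq.
    - apply Csum_unshift. apply (Csum_ext (fun k => z * (d (S k) * z ^ k))).
      + intros k. simpl. ring.
      + apply Csum_scal, HV1.
    - cbv beta. rewrite Hd0. ring. }
  specialize (HM z hz2). rewrite E, Cmod_mult in HM. pose proof (Cmod_ge_0 (V1 z)).
  assert (0 <= Cmod z * Cmod (V1 z))%R by nra. nra.
Qed.

(** The differences [d] of the principal coefficients give a series converging at arbitrarily small
    [z], hence an entire [V] in [zeta = 1 / z]. Near infinity [zeta V(zeta)] is minus the difference
    of the regular parts, which is bounded, so Liouville's argument kills every [d n]. *)
Lemma laurent0_unique f c c' n :
  is_laurent0 f c -> is_laurent0 f c' -> c (- Z.of_nat (S n))%Z = c' (- Z.of_nat (S n))%Z.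
Proof.
intros [r [Hr H]] [r' [Hr' H']].
set (s := Rmin r r').
assert (Hs : (0 < s)%R) by now apply Rmin_pos.
set (e := fun n => c (Z.of_nat n) - c' (Z.of_nat n)).
set (d := fun n => c (- Z.of_nat (S n))%Z - c' (- Z.of_nat (S n))%Z).
assert (Huv : forall z, (0 < Cmod z < s)%R -> exists u, Csum (fun n => e n * z ^ n) u /\
  Csum (fun n => d n / z ^ S n) (- u)).
{ intros z Hz.
  destruct (H z) as [u [v [Hu [Hv E]]]]. { pose proof (Rmin_l r r'). unfold s in Hz. lra. }
  destruct (H' z) as [u' [v' [Hu' [Hv' E']]]]. { pose proof (Rmin_r r r'). unfold s in Hz. lra. }
  exists (u - u'). split.
  - apply (Csum_ext (fun n => c (Z.of_nat n) * z ^ n - c' (Z.of_nat n) * z ^ n)).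
    + intros k. unfold e. ring.
    + now apply Csum_minus.
  - apply (Csum_eq _ (v - v')).
    + apply (Csum_ext (fun n => c (- Z.of_nat (S n))%Z / z ^ S n - c' (- Z.of_nat (S n))%Z / z ^ S n)).
      * intros k. unfold d, Cdiv. ring.
      * now apply Csum_minus.
    + rewrite E in E'. replace v with (u + v - u) by ring. rewrite E'. ring. }
assert (Hd : fast_decay d).
(* Convergence at a point [t <= 1 / rho] bounds [d k / t^(k+1)], and with it [d k * rho^k]. *)
{ intros rho Hrho. set (t := Rmin (/ rho) (s / 2)).
  assert (Ht : (0 < t)%R) by (apply Rmin_pos; [now apply Rinv_0_lt_compat | lra]).
  assert (Hts : (t < s)%R) by (pose proof (Rmin_r (/ rho) (s / 2)); unfold t; lra).
  assert (Htr : (rho <= / t)%R).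
  { rewrite <- (Rinv_inv rho). apply Rinv_le_contravar; [easy|]. apply Rmin_l. }
  destruct (Huv (RtoC t)) as [u [_ Hv]]. { rewrite Cmod_R, Rabs_pos_eq; lra. }
  destruct (Csum_terms_bounded _ _ Hv) as [M HM]. exists (t * M)%R. intros k. specialize (HM k).
  assert (htc : RtoC t <> 0) by (intros h; apply RtoC_inj in h; lra).
  rewrite Cmod_div, Cmod_pow, Cmod_R, Rabs_pos_eq in HM by (lra || now apply Cpow_nz).
  apply Rle_trans with (Cmod (d k) * (/ t) ^ k)%R.
  - apply Rmult_le_compat_l; [apply Cmod_ge_0|]. apply pow_incr. lra.
  - apply (Rmult_le_compat_l t) in HM; [|lra]. apply Rle_trans with (2 := HM). right.
    rewrite pow_inv. simpl. field. split; [apply pow_nonzero|]; lra. }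
set (V := fun z => CSeries (fun k => d k * z ^ k)).
assert (HV : forall z, Csum (fun k => d k * z ^ k) (V z)).
{ intros z. now apply CSeries_fast_decay. }
destruct (Huv (RtoC (s / 2))) as [u0 [Hu0 _]]. { rewrite Cmod_R, Rabs_pos_eq; lra. }
destruct (Csum_terms_bounded _ _ Hu0) as [M HM].
assert (HMn : (0 <= M)%R) by (apply Rle_trans with (2 := HM O); apply Cmod_ge_0).
assert (Hd0 : d n = 0).
(* For [|z| > 4 / s] the point [1 / z] has modulus below [s / 4], half the radius at which the terms
   of the regular part are bounded by [M]; the geometric series of ratio [1/2] sums to [2 M]. *)
{ apply (vanishing_at_infinity n d V (2 * M)%R (4 / s)%R Hd HV).
  intros z Hz.
  assert (h4 : (0 < 4 / s)%R) by (apply Rdiv_lt_0_compat; lra).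
  assert (hz : z <> 0) by (apply Cmod_gt_0; lra).
  assert (hiz : (Cmod (/ z) < s / 4)%R).
  { rewrite Cmod_inv by easy. replace (s / 4)%R with (/ (4 / s))%R by (field; lra).
    apply Rinv_lt_contravar; [|easy]. apply Rmult_lt_0_compat; lra. }
  assert (hiz0 : (0 < Cmod (/ z))%R). { rewrite Cmod_inv by easy. apply Rinv_0_lt_compat. lra. }
  destruct (Huv (/ z)) as [u [Hu Hv]]; [lra|].
  assert (E : z * V z = - u).
  { apply (Csum_unique (fun n => d n / (/ z) ^ S n)); [|easy].
    apply (Csum_ext (fun n => z * (d n * z ^ n))).
    - intros k. rewrite Cpow_inv by easy. simpl. field. split; [now apply Cpow_nz | easy].
    - apply Csum_scal, HV. }
  rewrite <- Cmod_mult, E, Cmod_opp.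
  apply (Csum_Cmod_le _ _ (fun k => M * (1 / 2) ^ k)%R _ Hu); [apply is_series_geom_half|].
  intros k. specialize (HM k). rewrite Cmod_mult, Cmod_pow in HM |- *.
  rewrite Cmod_R, Rabs_pos_eq in HM by lra.
  apply Rle_trans with (Cmod (e k) * (s / 2 * (1 / 2)) ^ k)%R.
  - apply Rmult_le_compat_l; [apply Cmod_ge_0|]. apply pow_incr. lra.
  - rewrite Rpow_mult_distr, <- Rmult_assoc. apply Rmult_le_compat_r; [apply pow_le; lra | easy]. }
unfold d in Hd0.
replace (c (- Z.of_nat (S n))%Z) with (c (- Z.of_nat (S n))%Z - c' (- Z.of_nat (S n))%Z + c' (- Z.of_nat (S n))%Z) by ring.
rewrite Hd0. ring.
Qed.

Lemma laurent0_coef_eq f c n :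
  is_laurent0 f c -> laurent0_coef f (- Z.of_nat (S n)) = c (- Z.of_nat (S n))%Z.
Proof.
intros H. unfold laurent0_coef. apply (iota_unique (V := C_CompleteNormedModule)).
- intros y [c' [H' <-]]. now apply (laurent0_unique f).
- now exists c.
Qed.

(** * Reciprocal of a power series and its Laurent expansion *)

Section Reciprocal.
Variable gc : nat -> C.
Hypothesis Hgc : fast_decay gc.
Hypothesis Hg0 : gc O <> 0.

(* Long division of 1 by [g = sum gc_j z^j]: after [N] steps the remainder is [z^N sum_j rem N j z^j]. *)
Fixpoint rem (N : nat) : nat -> C :=
  match N with
  | O => fun j => match j with O => RtoC 1 | S _ => RtoC 0 end
  | S N => fun j => rem N (S j) - rem N O / gc O * gc (S j)
  end.

Definition recip (N : nat) : C := rem N O / gc O.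

Fixpoint psum (b : nat -> C) (N : nat) (z : C) : C :=
  match N with O => 0 | S N => psum b N z + b N * z ^ N end.

Lemma rem_fast N : fast_decay (rem N).
Proof.
induction N as [|N IH].
- intros rho Hr. exists 1%R. intros [|j]; simpl.
  + rewrite Cmod_1. lra.
  + rewrite Cmod_0. lra.
- intros rho Hr.
  destruct (fast_decay_S _ IH rho Hr) as [A HA]. destruct (fast_decay_S _ Hgc rho Hr) as [B HB].
  exists (A + Cmod (recip N) * B)%R. intros j. simpl. fold (recip N).
  apply Rle_trans with ((Cmod (rem N (S j)) + Cmod (recip N) * Cmod (gc (S j))) * rho ^ j)%R.
  + apply Rmult_le_compat_r; [apply pow_le; lra|].
    unfold Cminus. apply Rle_trans with (1 := Cmod_triangle _ _).
    rewrite Cmod_opp, Cmod_mult. lra.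
  + specialize (HA j). specialize (HB j).
    apply (Rmult_le_compat_l _ _ _ (Cmod_ge_0 (recip N))) in HB. lra.
Qed.

Variable g : C -> C.
Hypothesis Hg : forall z, Csum (fun n => gc n * z ^ n) (g z).

Definition remf (N : nat) (z : C) : C := CSeries (fun j => rem N j * z ^ j).

Lemma remf_Csum N z : Csum (fun j => rem N j * z ^ j) (remf N z).
Proof. apply CSeries_fast_decay, rem_fast. Qed.

Lemma remf_entire N : entire (remf N).
Proof. exists (rem N). split; [apply rem_fast | apply remf_Csum]. Qed.

Lemma remf_step N z : remf N z = recip N * g z + z * remf (S N) z.
Proof.
apply (Csum_unique (fun j => rem N j * z ^ j)); [apply remf_Csum|].
apply (Csum_ext (fun j => recip N * (gc j * z ^ j) + match j with O => 0 | S k => z * (rem (S N) k * z ^ k) end)).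
- intros [|j].
  + unfold recip. simpl. field. exact Hg0.
  + simpl. fold (recip N). ring.
- apply Csum_plus; [apply Csum_scal, Hg|].
  eapply Csum_eq.
  + apply (Csum_unshift (fun j => match j with O => RtoC 0 | S k => z * (rem (S N) k * z ^ k) end)).
    apply Csum_scal, remf_Csum.
  + cbv beta iota. ring.
Qed.

Lemma recip_remainder N z : RtoC 1 = g z * psum recip N z + z ^ N * remf N z.
Proof.
induction N as [|N IH].
- simpl. rewrite Cmult_0_r, Cplus_0_l, Cmult_1_l.
  apply (Csum_unique (fun j => rem 0 j * z ^ j)); [|apply remf_Csum].
  eapply Csum_eq.
  + apply Csum_unshift. apply (Csum_ext (fun j => 0 * (gc j * z ^ j))).
    * intros j. simpl. ring.
    * apply Csum_scal, Hg.
  + simpl. ring.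
- rewrite IH at 1. rewrite (remf_step N). simpl. ring.
Qed.

(** If [K] bounds the coefficients of [g], each division step multiplies the bound on the
    remainder's coefficients by at most [1 + K / |gc 0|]. Geometric growth gives the reciprocal a
    positive radius of convergence. *)
Lemma rem_bound : exists L : R, (1 <= L)%R /\ forall N j, (Cmod (rem N j) <= L ^ N)%R.
Proof.
destruct (Hgc 1%R Rlt_0_1) as [K HK].
assert (Hm := proj1 (Cmod_gt_0 _) Hg0).
assert (HK' : forall j, (Cmod (gc j) <= K)%R).
{ intros j. specialize (HK j). now rewrite pow1, Rmult_1_r in HK. }
assert (HK0 : (0 <= K)%R) by (apply Rle_trans with (2 := HK' O); apply Cmod_ge_0).
assert (HL : (0 <= K / Cmod (gc O))%R).
{ apply Rmult_le_pos; [easy|]. left. now apply Rinv_0_lt_compat. }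
exists (1 + K / Cmod (gc O))%R. split; [lra|].
induction N as [|N IH].
- intros [|j]; simpl; [rewrite Cmod_1 | rewrite Cmod_0]; lra.
- intros j. change (rem (S N) j) with (rem N (S j) - rem N O / gc O * gc (S j)).
  apply Rle_trans with (1 := Cmod_triangle _ _). rewrite Cmod_opp, Cmod_mult, Cmod_div by easy.
  change ((1 + K / Cmod (gc O)) ^ S N)%R with ((1 + K / Cmod (gc O)) * (1 + K / Cmod (gc O)) ^ N)%R.
  set (P := ((1 + K / Cmod (gc O)) ^ N)%R) in *.
  assert (h : (Cmod (rem N O) / Cmod (gc O) * Cmod (gc (S j)) <= P / Cmod (gc O) * K)%R).
  { apply Rmult_le_compat.
    - apply Rmult_le_pos; [apply Cmod_ge_0|]. left. now apply Rinv_0_lt_compat.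
    - apply Cmod_ge_0.
    - apply Rmult_le_compat_r; [left; now apply Rinv_0_lt_compat | apply IH].
    - apply HK'. }
  specialize (IH (S j)). unfold Rdiv in *. lra.
Qed.

Lemma recip_Csum : exists r : R, (0 < r)%R /\
  forall z, (Cmod z < r)%R -> g z <> 0 /\ Csum (fun n => recip n * z ^ n) (/ g z).
Proof.
destruct rem_bound as [L [HL H]].
exists (/ (2 * L))%R. split; [apply Rinv_0_lt_compat; lra|].
intros z Hz. pose proof (Cmod_ge_0 z) as Hz0.
assert (HLz : (L * Cmod z <= 1 / 2)%R).
{ apply (Rmult_lt_compat_l (2 * L)) in Hz; [|lra]. rewrite Rinv_r in Hz by lra. lra. }
assert (HR : forall N, (Cmod (z ^ N * remf N z) <= 2 * (1 / 2) ^ N)%R).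
{ intros N. rewrite Cmod_mult, Cmod_pow.
  assert (h : (Cmod (remf N z) <= 2 * L ^ N)%R).
  { apply (Csum_Cmod_le _ _ (fun k => L ^ N * (1 / 2) ^ k)%R _ (remf_Csum N z)); [apply is_series_geom_half|].
    intros k. rewrite Cmod_mult, Cmod_pow. apply Rmult_le_compat; [apply Cmod_ge_0|now apply pow_le|apply H|].
    apply pow_incr. nra. }
  apply Rle_trans with (Cmod z ^ N * (2 * L ^ N))%R.
  - apply Rmult_le_compat_l; [now apply pow_le | easy].
  - replace (Cmod z ^ N * (2 * L ^ N))%R with (2 * (L * Cmod z) ^ N)%R by (rewrite Rpow_mult_distr; ring).
    apply Rmult_le_compat_l; [lra|]. apply pow_incr. split; [|easy]. apply Rmult_le_pos; lra. }
assert (Hgz : g z <> 0).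
(* At a zero of [g] the remainder would equal 1, whereas after two division steps it is at most
   [1/2]. *)
{ intros h. pose proof (recip_remainder 2 z) as E. rewrite h in E.
  specialize (HR 2%nat). replace (z ^ 2 * remf 2 z) with (RtoC 1) in HR.
  - rewrite Cmod_1 in HR. simpl in HR. lra.
  - rewrite E at 1. ring. }
split; [easy|].
assert (Hm := proj1 (Cmod_gt_0 _) Hgz).
assert (E : forall N, sum_n (fun n => recip n * z ^ n) N = psum recip (S N) z).
{ induction N as [|N IH].
  - rewrite sum_O. simpl. ring.
  - rewrite sum_Sn, IH. easy. }
unfold Csum, is_series.
apply (proj2 (filterlim_Cmod eventually _ _)).
intros eps He.
assert (Hl : is_lim_seq (fun N => 2 * (1 / 2) ^ N)%R 0%R).
{ replace 0%R with (2 * 0)%R by ring. apply (is_lim_seq_scal_l _ 2 0), is_lim_seq_geom. rewrite Rabs_pos_eq; lra. }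
assert (He' : (0 < eps * Cmod (g z))%R) by nra.
destruct (proj2 (is_lim_seq_spec _ _) Hl (mkposreal _ He')) as [N0 HN0].
exists N0. intros N HN. specialize (HN0 (S N) ltac:(lia)). simpl in HN0.
rewrite Rminus_0_r in HN0. apply Rabs_def2 in HN0. destruct HN0 as [HN0 _].
refine (eq_ind_r (fun x => (Cmod (x - / g z) < eps)%R) _ (E N)).
replace (psum recip (S N) z - / g z) with (- (z ^ S N * remf (S N) z) / g z).
- rewrite Cmod_div, Cmod_opp by easy. apply Rlt_div_l; [easy|].
  apply Rle_lt_trans with (1 := HR (S N)). exact HN0.
- pose proof (recip_remainder (S N) z) as h.
  replace (z ^ S N * remf (S N) z) with (1 - g z * psum recip (S N) z) by (rewrite h at 1; ring).
  field. easy.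
Qed.

End Reciprocal.

(* [sum_(1 <= k <= m) b_(m-k) / z^k] in Horner form *)
Fixpoint lsum (b : nat -> C) (m : nat) (z : C) : C :=
  match m with O => 0 | S m => (b m + lsum b m z) / z end.

Lemma lsum_psum b m (z : C) : z <> 0 -> z ^ m * lsum b m z = psum b m z.
Proof.
intros Hz. induction m as [|m IH]; simpl; [ring|].
rewrite <- IH. field. easy.
Qed.

Lemma lsum_sum_n_m b m (z : C) : z <> 0 ->
  lsum b m z = sum_n_m (fun k => b (m - k)%nat / z ^ k) 1 m.
Proof.
intros Hz. induction m as [|m IH].
- rewrite sum_n_m_zero by lia. easy.
- rewrite sum_Sn_m by lia. rewrite <- sum_n_m_S. simpl lsum.
  rewrite (sum_n_m_ext _ (fun k => / z * (b (m - k)%nat / z ^ k))).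
  + assert (E : sum_n_m (fun k => / z * (b (m - k)%nat / z ^ k)) 1 m = / z * sum_n_m (fun k => b (m - k)%nat / z ^ k) 1 m).
    { apply (sum_n_m_mult_l (K := C_Ring) (/ z) (fun k => b (m - k)%nat / z ^ k)). }
    rewrite E, <- IH. replace (S m - 1)%nat with m by lia.
    change ((b m + lsum b m z) / z = b m / z ^ 1 + / z * lsum b m z). rewrite Cpow_1_r.
    unfold Cdiv. ring.
  + intros k. replace (S m - S k)%nat with (m - k)%nat by lia. simpl. field.
    split; [now apply Cpow_nz | easy].
Qed.

Lemma lsum_Csum b m (z : C) : z <> 0 ->
  Csum (fun n => (if (n <? m)%nat then b (m - 1 - n)%nat else 0) / z ^ S n) (lsum b m z).
Proof.
intros Hz. induction m as [|m IH].
- apply (Csum_ext (fun _ => RtoC 0)); [|apply Csum_zero].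
  intros n. simpl. unfold Cdiv. ring.
- eapply Csum_eq.
  + apply Csum_unshift.
    apply (Csum_ext (fun n => / z * ((if (n <? m)%nat then b (m - 1 - n)%nat else 0) / z ^ S n))).
    * intros n. replace (S n <? S m)%nat with (n <? m)%nat by reflexivity.
      replace (S m - 1 - S n)%nat with (m - 1 - n)%nat by lia.
      simpl. field. split; [now apply Cpow_nz | easy].
    * apply Csum_scal, IH.
  + simpl. replace (m - 0 - 0)%nat with m by lia. field. easy.
Qed.

Lemma Csum_tail (a : nat -> C) l m (z : C) : z <> 0 ->
  Csum (fun n => a n * z ^ n) l -> Csum (fun n => a (n + m)%nat * z ^ n) ((l - psum a m z) / z ^ m).
Proof.
intros Hz H. induction m as [|m IH].
- apply (Csum_eq _ l).
  + refine (Csum_ext _ _ _ _ H). intros n. now rewrite Nat.add_0_r.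
  + simpl. field.
- eapply Csum_eq.
  + apply (Csum_ext (fun n => / z * (a (S n + m)%nat * z ^ S n))).
    * intros n. replace (n + S m)%nat with (S n + m)%nat by lia. simpl. field. easy.
    * apply Csum_scal. apply (Csum_shift (fun n => a (n + m)%nat * z ^ n)).
      eapply Csum_eq; [exact IH|]. instantiate (1 := (l - psum a m z) / z ^ m - a m). simpl. ring.
  + simpl. field. split; [now apply Cpow_nz | easy].
Qed.

(** Dividing the series of [1 / g] by [z^m] shifts its indices: the first [m] terms become the
    finite principal part [lsum], the tail the regular part. The test for negative indices guards
    against [Z.to_nat] sending them all to 0. *)
Lemma laurent0_recip f g gc m :
  fast_decay gc -> gc O <> 0 -> (forall z, Csum (fun n => gc n * z ^ n) (g z)) ->
  (forall z, f z = z ^ m * g z) ->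
  is_laurent0 (fun z => 1 / f z)
    (fun n => if (n + Z.of_nat m <? 0)%Z then 0 else recip gc (Z.to_nat (n + Z.of_nat m))).
Proof.
intros Hgc Hg0 Hg Ef.
destruct (recip_Csum gc Hgc Hg0 g Hg) as [r [Hr H]].
exists r. split; [easy|]. intros z [Hz Hzr].
assert (hz : z <> 0) by now apply Cmod_gt_0.
destruct (H z Hzr) as [Hgz HS].
exists ((/ g z - psum (recip gc) m z) / z ^ m), (lsum (recip gc) m z). split; [|split].
- apply (Csum_ext (fun n => recip gc (n + m)%nat * z ^ n)); [|now apply Csum_tail].
  intros n. rewrite (proj2 (Z.ltb_ge _ _)) by lia. do 2 f_equal. lia.
- apply (Csum_ext (fun n => (if (n <? m)%nat then recip gc (m - 1 - n)%nat else 0) / z ^ S n)); [|now apply lsum_Csum].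
  intros n. destruct (Nat.ltb_spec n m) as [h|h].
  + rewrite (proj2 (Z.ltb_ge _ _)) by lia. do 2 f_equal. lia.
  + now rewrite (proj2 (Z.ltb_lt _ _)) by lia.
- rewrite Ef, <- lsum_psum by easy. field. repeat split; try easy. now apply Cpow_nz.
Qed.

(** * Bounds on the squares *)

Local Open Scope R_scope.

(** Trades the exponential for the weight [1 + s^2], whose reciprocal is integrated exactly by
    [atan]. *)
Lemma exp_ge_quadratic s : 0 <= s -> (1 + s ^ 2) / 4 <= exp s.
Proof.
intros Hs. replace s with (s / 2 + s / 2) at 2 by field. rewrite exp_plus.
pose proof (exp_ineq1_le (s / 2)) as h. nra.
Qed.

Lemma side_opp rho u t : side rho (- u) t = (- side rho u t)%C.
Proof. unfold side. ring. Qed.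

Lemma Cnorm2_parity q z :
  Cnorm2 (BesselJ (Z.of_nat q) (- z)%C) = Cnorm2 (BesselJ (Z.of_nat q) z) /\
  Cnorm2 (dJ (Z.of_nat q) (- z)%C) = Cnorm2 (dJ (Z.of_nat q) z).
Proof.
destruct (Bessel_parity q) as [s [Hs H]]. destruct (H z) as [h1 [h2 _]]. rewrite h1, h2.
rewrite !Cnorm2_Cmod, !Cmod_mult, !Cmod_opp.
replace (Cmod s) with 1; [split; ring|].
destruct Hs as [->| ->]; now rewrite ?Cmod_opp, Cmod_1.
Qed.

(** The weight [exp (2 X |t|)] is the growth found on vertical sides and a weakening of the
    [exp (2 X)] available on horizontal ones. One bound for all four sides is the form
    [contour_Cmod_le] accepts. *)
Lemma side_bounds q : exists c X0, 0 < c /\ 2 <= X0 /\ forall X, X0 <= X -> bj q X = 0 ->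
  forall u t, unit4 u -> -1 <= t <= 1 ->
  Cnorm2 (BesselJ (Z.of_nat q) (side X u t)) <= 16 * Cnorm2 (dJ (Z.of_nat q) (side X u t)) /\
  c * exp (2 * (X * Rabs t)) <= X * Cnorm2 (dJ (Z.of_nat q) (side X u t)).
Proof.
destruct (bd_amplitude q) as [c1 [x1 [Hc1 [Hx1 Hamp]]]].
destruct (ray_form_1_min q) as [m [Hm Hmin]].
set (E := 6 * exp (6 * (1 + INR q ^ 2))).
assert (HE : 0 < E) by (unfold E; pose proof (exp_pos (6 * (1 + INR q ^ 2))); lra).
(* First entry: amplitude at the real axis over the loss on a vertical side. Second: the ray
   estimate, with [exp (2 (X - 1)) = exp (2 X) exp (-2)] and [4 (X + 2) <= 12 X]. *)
set (c := Rmin (c1 / E) (m * exp (-2) / 12)).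
assert (Hc : 0 < c).
{ apply Rmin_pos; [now apply Rdiv_lt_0_compat|]. pose proof (exp_pos (-2)).
  apply Rdiv_lt_0_compat; [|lra]. now apply Rmult_lt_0_compat. }
set (X0 := Rmax 2 (Rmax x1 (18 * (1 + INR q ^ 2)))).
assert (HX2 : 2 <= X0) by apply Rmax_l.
assert (HXx1 : x1 <= X0) by (apply Rle_trans with (2 := Rmax_r _ _); apply Rmax_l).
assert (HXq : 18 * (1 + INR q ^ 2) <= X0) by (apply Rle_trans with (2 := Rmax_r _ _); apply Rmax_r).
exists c, X0. split; [easy|]. split; [easy|]. intros X HX HJ.
assert (A : forall u t, u = RtoC 1 \/ u = Ci -> -1 <= t <= 1 ->
  Cnorm2 (BesselJ (Z.of_nat q) (side X u t)) <= 16 * Cnorm2 (dJ (Z.of_nat q) (side X u t)) /\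
  c * exp (2 * (X * Rabs t)) <= X * Cnorm2 (dJ (Z.of_nat q) (side X u t))).
{ intros u t [->| ->] Ht.
  - assert (V : forall sg y, sg = 1 \/ sg = -1 -> 0 <= y <= X -> vert X sg y = side X 1 t -> y = X * Rabs t ->
      Cnorm2 (BesselJ (Z.of_nat q) (side X 1 t)) <= 16 * Cnorm2 (dJ (Z.of_nat q) (side X 1 t)) /\
      c * exp (2 * (X * Rabs t)) <= X * Cnorm2 (dJ (Z.of_nat q) (side X 1 t))).
    { intros sg y Hsg Hy <- <-.
      destruct (vertical_bounds q X sg ltac:(lra) ltac:(lra) HJ Hsg y Hy) as [h1 h2]. fold E in h2.
      pose proof (Cnorm2_ge0 (dJ (Z.of_nat q) (vert X sg y))).
      split; [lra|].
      assert (hc : c * E <= X * bd q X ^ 2).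
      { apply Rle_trans with (2 := Hamp X ltac:(lra) HJ).
        assert (h : c <= c1 / E) by apply Rmin_l. now apply (proj2 (Rle_div_r _ _ _ HE)) in h. }
      apply (Rmult_le_reg_r E); [easy|].
      pose proof (exp_pos (2 * y)).
      apply Rle_trans with (X * (bd q X ^ 2 * exp (2 * y))).
      - apply (Rmult_le_compat_r (exp (2 * y))) in hc; lra.
      - apply (Rmult_le_compat_l X) in h2; lra. }
    destruct (Rle_or_lt 0 t) as [h|h].
    + apply (V 1 (X * t)); [now left|nra| |rewrite Rabs_pos_eq by easy; ring].
      unfold vert, side. rewrite RtoC_mult. ring.
    + apply (V (-1) (X * - t)); [now right|nra| |rewrite Rabs_left by easy; ring].
      unfold vert, side. replace (RtoC (-1)) with (- (1))%C by (rewrite <- RtoC_opp; f_equal; lra).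
      rewrite RtoC_mult, RtoC_opp. ring.
  (* Counterclockwise orientation runs the upper side leftwards, so its parameter [t] is the ray of
     slope parameter [- t]. *)
  - destruct (ray_bounds q (- t) X ltac:(lra) ltac:(lra)) as [h1 h2].
    replace (ray (- t) X) with (side X Ci t) in h1, h2.
    + split; [easy|].
      specialize (Hmin (- t) ltac:(lra)).
      pose proof (Cnorm2_ge0 (dJ (Z.of_nat q) (side X Ci t))) as hd.
      set (N := Cnorm2 (dJ (Z.of_nat q) (side X Ci t))) in *.
      assert (he : exp (2 * (X * Rabs t)) <= exp (2 * X)).
      { assert (Rabs t <= 1) by (apply Rabs_le; lra).
        assert (h : 2 * (X * Rabs t) <= 2 * X) by nra.
        destruct (Rle_lt_or_eq_dec _ _ h) as [h'|h']; [left; now apply exp_increasing | right; now f_equal]. }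
      assert (hc : c <= m * exp (-2) / 12) by apply Rmin_r.
      replace (2 * (X - 1)) with (2 * X + -2) in h2 by ring. rewrite exp_plus in h2.
      pose proof (exp_pos (2 * X)) as e1. pose proof (exp_pos (-2)) as e2. pose proof (exp_pos (2 * (X * Rabs t))) as e3.
      apply Rle_trans with (c * exp (2 * X)); [apply Rmult_le_compat_l; lra|].
      apply Rle_trans with (m * exp (-2) / 12 * exp (2 * X)); [apply Rmult_le_compat_r; lra|].
      assert (m * (exp (2 * X) * exp (-2)) <= 4 * (X + 2) * N).
      { apply Rle_trans with (2 := h2). apply Rmult_le_compat_r; [|easy]. left. now apply Rmult_lt_0_compat. }
      assert (4 * (X + 2) * N <= 12 * X * N) by (apply Rmult_le_compat_r; lra). lra.
    + unfold side, ray. rewrite RtoC_opp. replace (t * (X * Ci * Ci))%C with (t * X * (Ci * Ci))%C by ring.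
      rewrite Ci_sqr. ring. }
intros u t [->|[->|[->| ->]]] Ht.
- apply A; [now left | easy].
- apply A; [now right | easy].
- rewrite side_opp. destruct (Cnorm2_parity q (side X 1 t)) as [-> ->]. apply A; [now left | easy].
- rewrite side_opp. destruct (Cnorm2_parity q (side X Ci t)) as [-> ->]. apply A; [now right | easy].
Qed.

Lemma side_Cmod_bounds q : exists K X0, 0 < K /\ 2 <= X0 /\ forall X, X0 <= X -> bj q X = 0 ->
  forall u t, unit4 u -> -1 <= t <= 1 ->
  dJ (Z.of_nat q) (side X u t) <> 0%C /\
  Cmod (BesselJ (Z.of_nat q) (side X u t) / dJ (Z.of_nat q) (side X u t)) <= 4 /\
  Cmod (1 / dJ (Z.of_nat q) (side X u t)) <= K * sqrt X * / (1 + (X * t) ^ 2).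
Proof.
destruct (side_bounds q) as [c [X0 [Hc [HX0 H]]]].
assert (Hsc : 0 < sqrt c) by now apply sqrt_lt_R0.
exists (4 / sqrt c), X0. split; [apply Rdiv_lt_0_compat; lra|]. split; [easy|].
intros X HX HJ u t Hu Ht. destruct (H X HX HJ u t Hu Ht) as [h1 h2].
rewrite !Cnorm2_Cmod in h1. rewrite Cnorm2_Cmod in h2.
set (j := BesselJ (Z.of_nat q) (side X u t)) in *. set (d := dJ (Z.of_nat q) (side X u t)) in *.
pose proof (Cmod_ge_0 j) as hj. pose proof (Cmod_ge_0 d) as hd.
assert (Hd0 : 0 < Cmod d).
{ destruct hd as [hd|hd]; [easy|]. rewrite <- hd in h2.
  pose proof (exp_pos (2 * (X * Rabs t))). simpl in h2. nra. }
assert (Hdn : d <> 0%C) by now apply Cmod_gt_0.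
split; [easy|]. split.
- rewrite Cmod_div by easy. apply Rle_div_l; [easy|]. apply Rsqr_incr_0_var; [unfold Rsqr; nra | lra].
- rewrite Cmod_div, Cmod_1 by easy.
  set (s := X * Rabs t) in *.
  assert (Hs : 0 <= s) by (apply Rmult_le_pos; [lra | apply Rabs_pos]).
  assert (Hst : (X * t) ^ 2 = s ^ 2) by (unfold s; rewrite !Rpow_mult_distr, pow2_abs; ring).
  rewrite Hst.
  assert (HsX : 0 < sqrt X) by (apply sqrt_lt_R0; lra).
  assert (h3 : sqrt c * (1 + s ^ 2) <= 4 * (sqrt X * Cmod d)).
  { apply Rsqr_incr_0_var.
    - unfold Rsqr.
      replace (sqrt c * (1 + s ^ 2) * (sqrt c * (1 + s ^ 2))) with (sqrt c * sqrt c * (1 + s ^ 2) ^ 2) by ring.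
      replace (4 * (sqrt X * Cmod d) * (4 * (sqrt X * Cmod d))) with (16 * (sqrt X * sqrt X * Cmod d ^ 2)) by ring.
      rewrite !sqrt_sqrt by lra.
      apply Rle_trans with (16 * (c * exp (2 * s))); [|lra].
      replace (2 * s) with (s + s) by ring. rewrite exp_plus.
      pose proof (exp_ge_quadratic s Hs) as he.
      assert ((1 + s ^ 2) ^ 2 <= 16 * (exp s * exp s)) by nra.
      replace (16 * (c * (exp s * exp s))) with (c * (16 * (exp s * exp s))) by ring.
      apply Rmult_le_compat_l; lra.
    - assert (0 < sqrt X * Cmod d) by now apply Rmult_lt_0_compat. lra. }
  apply Rle_div_l; [easy|].
  assert (h4 : 0 < 1 + s ^ 2) by nra.
  replace (4 / sqrt c * sqrt X * / (1 + s ^ 2) * Cmod d) with (4 * (sqrt X * Cmod d) / (sqrt c * (1 + s ^ 2))).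
  + assert (h5 : 0 < sqrt c * (1 + s ^ 2)) by now apply Rmult_lt_0_compat.
    apply (proj1 (Rle_div_r 1 _ _ h5)). lra.
  + field. lra.
Qed.

Lemma is_RInt_lorentz X : 1 <= X -> exists I, is_RInt (fun t => / (1 + (X * t) ^ 2)) (-1) 1 I /\ I <= 4 / X.
Proof.
intros HX. exists (minus (atan (X * 1) / X) (atan (X * -1) / X)). split.
- apply (is_RInt_derive (V := R_CompleteNormedModule) (fun t => atan (X * t) / X)).
  + intros t _. auto_derive; [easy|]. unfold Rsqr. field. split; nra.
  + intros t _. apply (ex_derive_continuous (K := R_AbsRing) (V := R_NormedModule)). auto_derive. nra.
- unfold minus, plus, opp; simpl. pose proof (atan_bound (X * 1)). pose proof (atan_bound (X * -1)).
  pose proof PI_4. replace (atan (X * 1) / X + - (atan (X * -1) / X)) with ((atan (X * 1) - atan (X * -1)) / X) by (field; lra).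
  apply Rmult_le_compat_r; [left; apply Rinv_0_lt_compat; lra | lra].
Qed.

Section ContourLimits.
Variable q : nat.
Let J := BesselJ (Z.of_nat q).
Let D := dJ (Z.of_nat q).

Lemma Cmod_sub_ge X u t (w : C) : 2 * Cmod w <= X -> 1 <= X -> unit4 u -> -1 <= t <= 1 ->
  X / 2 <= Cmod (side X u t - w).
Proof.
intros Hw HX Hu Ht. pose proof (supnorm_side X u t ltac:(lra) Hu Ht) as hs.
pose proof (supnorm_le_Cmod (side X u t)) as h1.
pose proof (Cmod_triangle (side X u t - w) w) as h2.
replace (side X u t - w + w)%C with (side X u t) in h2 by ring. lra.
Qed.

Lemma Cmod_inv_sub_le X u t (w : C) : 2 * Cmod w <= X -> 1 <= X -> unit4 u -> -1 <= t <= 1 ->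
  Cmod (/ (side X u t - w)) <= 2 / X.
Proof.
intros Hw HX Hu Ht. pose proof (Cmod_sub_ge X u t w Hw HX Hu Ht) as h.
assert (h0 : (side X u t - w)%C <> 0%C) by (apply Cmod_gt_0; lra).
rewrite Cmod_inv by easy. replace (2 / X) with (/ (X / 2)) by (field; lra).
apply Rinv_le_contravar; lra.
Qed.

Lemma cont_kernel X (h : C -> C) w : 2 * Cmod w <= X -> 1 <= X -> entire h ->
  (forall z, on_square X z -> D z <> 0%C) ->
  forall z, on_square X z -> cont (fun z => h z / D z * / (z - w))%C z.
Proof.
intros Hw HX Hh HD z Hz. apply continuous_Cmult.
- apply continuous_Cdiv; [now apply entire_cont|apply entire_cont, dJ_entire|now apply HD].
- apply (cont_inv_sub X); [lra| |easy]. apply in_square_supnorm.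
  pose proof (supnorm_le_Cmod w). pose proof (Cmod_ge_0 w). lra.
Qed.

Lemma contour_den_limit w : exists K X1, forall X, X1 <= X -> bj q X = 0 ->
  Cmod (contour X (fun z => 1 / D z * / (z - w))%C) <= K / sqrt X.
Proof.
destruct (side_Cmod_bounds q) as [K [X0 [HK [HX0 H]]]].
exists (64 * K), (Rmax X0 (2 * Cmod w)). intros X HX HJ.
assert (HX1 : X0 <= X) by (pose proof (Rmax_l X0 (2 * Cmod w)); lra).
assert (HX2 : 2 * Cmod w <= X) by (pose proof (Rmax_r X0 (2 * Cmod w)); lra).
destruct (is_RInt_lorentz X ltac:(lra)) as [I [HI HI4]].
assert (HsX : 0 < sqrt X) by (apply sqrt_lt_R0; lra).
assert (Hc := contour_Cmod_le X (fun z => 1 / D z * / (z - w))%C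
  (fun t => 2 / X * (K * sqrt X) * / (1 + (X * t) ^ 2)) (2 / X * (K * sqrt X) * I)).
apply Rle_trans with (8 * X * (2 / X * (K * sqrt X) * I)).
- apply Hc; clear Hc.
  + lra.
  + apply (cont_kernel X (fun _ => RtoC 1)); [easy|lra|apply entire_const|].
    intros z [u [t [Hu [Ht ->]]]]. now apply (H X HX1 HJ u t Hu Ht).
  + exact (is_RInt_scal (V := R_NormedModule) _ (-1) 1 (2 / X * (K * sqrt X)) I HI).
  + intros u t Hu Ht. destruct (H X HX1 HJ u t Hu Ht) as [_ [_ h]]. fold D in h.
    rewrite Cmod_mult, Rmult_comm, (Rmult_assoc (2 / X)).
    apply Rmult_le_compat; try apply Cmod_ge_0; [apply Cmod_inv_sub_le; easy || lra | easy].
- replace (8 * X * (2 / X * (K * sqrt X) * I)) with (16 * K * sqrt X * I) by (field; lra).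
  apply Rle_trans with (16 * K * sqrt X * (4 / X)).
  + apply Rmult_le_compat_l; [|easy]. apply Rmult_le_pos; lra.
  + right. rewrite <- (sqrt_sqrt X) at 2 by lra. field. lra.
Qed.

Lemma contour_num_limit w : exists K X1, forall X, X1 <= X -> bj q X = 0 ->
  Cmod (contour X (fun z => J z / D z * / (z - w)) - contour X (fun z => J z / D z * / (z - - w)))%C <= K / X.
Proof.
destruct (side_Cmod_bounds q) as [K [X0 [HK [HX0 H]]]].
exists (512 * Cmod w), (Rmax X0 (2 * Cmod w)). intros X HX HJ.
assert (HX1 : X0 <= X) by (pose proof (Rmax_l X0 (2 * Cmod w)); lra).
assert (HX2 : 2 * Cmod w <= X) by (pose proof (Rmax_r X0 (2 * Cmod w)); lra).
assert (HX2' : 2 * Cmod (- w)%C <= X) by now rewrite Cmod_opp.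
assert (HD : forall z, on_square X z -> D z <> 0%C).
{ intros z [u [t [Hu [Ht ->]]]]. now apply (H X HX1 HJ u t Hu Ht). }
assert (Hc1 := cont_kernel X J w HX2 ltac:(lra) (BesselJ_entire _) HD).
assert (Hc2 := cont_kernel X J (- w)%C HX2' ltac:(lra) (BesselJ_entire _) HD).
rewrite <- contour_minus by assumption.
pose proof (Cmod_ge_0 w) as Hw.
assert (Hc := contour_Cmod_le X (fun z => J z / D z * / (z - w) - J z / D z * / (z - - w))%C
  (fun _ => 4 * (2 * Cmod w * (2 / X * (2 / X)))) (2 * (4 * (2 * Cmod w * (2 / X * (2 / X)))))).
apply Rle_trans with (8 * X * (2 * (4 * (2 * Cmod w * (2 / X * (2 / X)))))); [|right; field; lra].
apply Hc; clear Hc.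
- lra.
- intros z Hz. apply continuous_Cminus; [now apply Hc1 | now apply Hc2].
- match goal with |- is_RInt (fun _ => ?c) _ _ _ => replace (2 * c) with (scal (1 - -1) c) by (unfold scal; simpl; unfold mult; simpl; ring) end.
  apply (is_RInt_const (V := R_NormedModule)).
- intros u t Hu Ht. destruct (H X HX1 HJ u t Hu Ht) as [_ [h _]]. fold J D in h.
  pose proof (Cmod_inv_sub_le X u t w HX2 ltac:(lra) Hu Ht) as k1.
  pose proof (Cmod_inv_sub_le X u t (- w)%C HX2' ltac:(lra) Hu Ht) as k2.
  pose proof (Cmod_sub_ge X u t w HX2 ltac:(lra) Hu Ht) as l1.
  pose proof (Cmod_sub_ge X u t (- w)%C HX2' ltac:(lra) Hu Ht) as l2.
  assert (n1 : (side X u t - w)%C <> 0%C) by (apply Cmod_gt_0; lra).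
  assert (n2 : (side X u t - - w)%C <> 0%C) by (apply Cmod_gt_0; lra).
  set (zt := side X u t) in *.
  replace (J zt / D zt * / (zt - w) - J zt / D zt * / (zt - - w))%C with
    (J zt / D zt * (2%R * w * (/ (zt - w) * / (zt - - w))))%C.
  + set (F := (J zt / D zt)%C) in *. rewrite !Cmod_mult, Cmod_R, Rabs_pos_eq by lra.
    assert (e1 : 0 <= Cmod (/ (zt - w))) by apply Cmod_ge_0.
    assert (e2 : 0 <= Cmod (/ (zt - - w))) by apply Cmod_ge_0.
    assert (e3 : Cmod (/ (zt - w)) * Cmod (/ (zt - - w)) <= 2 / X * (2 / X)) by (apply Rmult_le_compat; easy).
    apply Rmult_le_compat; [apply Cmod_ge_0| |easy|].
    * repeat apply Rmult_le_pos; lra.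
    * apply Rmult_le_compat_l; lra.
  + assert (n3 := HD zt (unit4_on_square X u t Hu Ht)). field. repeat split; try easy.
Qed.

End ContourLimits.

(** * Zeros and the expansions *)

Local Open Scope C_scope.

(** What [reduced_Cauchy] asks of the principal part on the contour, bundled so that it can be
    checked term by term. *)
Definition null_part (X : R) (w : C) (PP : C -> C) : Prop :=
  (forall z, on_square X z -> cont PP z) /\ contour X (fun z => PP z * / (z - w)) = 0.

Lemma null_part_kernel X w PP :
  (0 < X)%R -> in_square X w -> (forall z, on_square X z -> cont PP z) ->
  forall z, on_square X z -> cont (fun z => PP z * / (z - w)) z.
Proof.
intros HX Hw H z Hz. apply continuous_Cmult; [now apply H|].
apply (cont_inv_sub X); lra || easy.
Qed.

Lemma null_part_plus X w P Q : (0 < X)%R -> in_square X w ->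
  null_part X w P -> null_part X w Q -> null_part X w (fun z => P z + Q z).
Proof.
intros HX Hw [HP1 HP2] [HQ1 HQ2]. split.
- intros z Hz. apply continuous_Cplus; [exact (HP1 z Hz) | exact (HQ1 z Hz)].
- assert (c1 := null_part_kernel X w P HX Hw HP1). assert (c2 := null_part_kernel X w Q HX Hw HQ1).
  rewrite (contour_ext X _ (fun z => P z * / (z - w) + Q z * / (z - w))) by (intros; ring).
  rewrite contour_plus by assumption. rewrite HP2, HQ2. ring.
Qed.

Lemma null_part_scal X w c P : (0 < X)%R -> in_square X w ->
  null_part X w P -> null_part X w (fun z => c * P z).
Proof.
intros HX Hw [HP1 HP2]. split.
- intros z Hz. apply continuous_Cmult; [apply continuous_Cconst | exact (HP1 z Hz)].
- assert (c1 := null_part_kernel X w P HX Hw HP1).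
  rewrite (contour_ext X _ (fun z => c * (P z * / (z - w)))) by (intros; ring).
  rewrite contour_scal by assumption. rewrite HP2. ring.
Qed.

Lemma null_part_ext X w P Q : (forall z, P z = Q z) -> null_part X w P -> null_part X w Q.
Proof.
intros E [H1 H2]. split.
- intros z Hz. apply (continuous_ext P); [exact E | exact (H1 z Hz)].
- rewrite <- H2. apply contour_ext. intros z _. now rewrite E.
Qed.

Lemma null_part_zero X w : (0 < X)%R -> in_square X w -> null_part X w (fun _ => 0).
Proof.
intros HX Hw. split.
- intros z Hz. apply continuous_Cconst.
- rewrite (contour_scal X 0 (fun z => / (z - w))); [ring|]. intros z Hz. apply (cont_inv_sub X); lra || easy.
Qed.

Lemma null_part_pole X w c p : (0 < X)%R -> in_square X w -> in_square X p -> p <> w ->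
  null_part X w (fun z => c / (z - p)).
Proof.
intros HX Hw Hp Hpw. apply (null_part_scal X w c (fun z => / (z - p)) HX Hw). split.
- intros z Hz. apply (cont_inv_sub X); lra || easy.
- now apply contour_simple_pole.
Qed.

Lemma null_part_pow X w c n : (0 < X)%R -> in_square X w -> w <> 0 ->
  null_part X w (fun z => c / z ^ S n).
Proof.
intros HX Hw Hw0. apply (null_part_scal X w c (fun z => / z ^ S n) HX Hw). split.
- intros z Hz. apply continuous_Cinv.
  + apply entire_cont. apply (entire_ext (fun z => z ^ S n * 1)); [intros; ring|].
    apply entire_mul_pow, entire_const.
  + apply Cpow_nz. replace z with (z - 0) by ring. apply (on_square_sub_neq0 X); try easy. now apply in_square_0.
- now apply contour_pow_pole.
Qed.

Lemma null_part_sum X w (P : nat -> C -> C) N : (0 < X)%R -> in_square X w ->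
  (forall k, (1 <= k <= N)%nat -> null_part X w (P k)) ->
  null_part X w (fun z => sum_n_m (fun k => P k z) 1 N).
Proof.
intros HX Hw. induction N as [|N IH]; intros H.
- apply (null_part_ext X w (fun _ => 0)); [|now apply null_part_zero].
  intros z. rewrite sum_n_m_zero by lia. easy.
- apply (null_part_ext X w (fun z => sum_n_m (fun k => P k z) 1 N + P (S N) z)).
  + intros z. rewrite (sum_n_Sm (G := C_AbelianMonoid)) by lia. easy.
  + apply null_part_plus; [easy|easy| |].
    * apply IH. intros k Hk. apply H. lia.
    * apply H. lia.
Qed.

Section Zeros.
Variables (q : nat) (z : Z -> R).
Hypothesis z_pos : forall k : Z, (1 <= k)%Z -> (0 < z k)%R.
Hypothesis z_incr : forall k : Z, (1 <= k)%Z -> (z k < z (k + 1)%Z)%R.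
Hypothesis z_zeros : forall x : R, (0 < x)%R ->
  (dJ (Z.of_nat q) (RtoC x) = RtoC 0 <-> exists k : Z, (1 <= k)%Z /\ z k = x).
Hypothesis z_neg : forall k : Z, (1 <= k)%Z -> z (- k)%Z = (- z k)%R.

Let D := dJ (Z.of_nat q).
Let DD := ddJ (Z.of_nat q).

Lemma zeros_lt i j : (1 <= i < j)%nat -> (z (Z.of_nat i) < z (Z.of_nat j))%R.
Proof.
intros [Hi Hj]. induction j as [|j IH]; [lia|].
assert (h : (z (Z.of_nat j) < z (Z.of_nat (S j)))%R).
{ replace (Z.of_nat (S j)) with (Z.of_nat j + 1)%Z by lia. apply z_incr. lia. }
destruct (Nat.eq_dec i j) as [->|n]; [easy|]. apply Rlt_trans with (2 := h). apply IH. lia.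
Qed.

Lemma zeros_bd n : (1 <= n)%nat -> bd q (z (Z.of_nat n)) = 0%R.
Proof.
intros Hn. assert (hp : (0 < z (Z.of_nat n))%R) by (apply z_pos; lia).
assert (h : D (z (Z.of_nat n)) = 0).
{ apply z_zeros; [easy|]. exists (Z.of_nat n). split; [lia | easy]. }
unfold bd. fold D. now rewrite h.
Qed.

Lemma bd_zeros x : (0 < x)%R -> bd q x = 0%R -> exists n, (1 <= n)%nat /\ x = z (Z.of_nat n).
Proof.
intros Hx H. destruct (proj1 (z_zeros x Hx)) as [k [Hk E]].
- now rewrite bd_RtoC, H.
- exists (Z.to_nat k). split; [lia|]. now rewrite Z2Nat.id by lia.
Qed.

(** A finite limit of the zeros would be a positive zero by continuity, hence some [z n] by the
    enumeration, contradicting that [z (n + 1)] is larger than [z n] yet at most the limit. *)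
Lemma zeros_unbounded B : exists N, forall n, (N <= n)%nat -> (B < z (Z.of_nat n))%R.
Proof.
destruct (Classical_Prop.classic (exists N, (1 <= N)%nat /\ (B < z (Z.of_nat N))%R)) as [[N [HN1 HN]]|H].
- exists N. intros n Hn. destruct (Nat.eq_dec N n) as [<-|ne]; [easy|].
  apply Rlt_trans with (1 := HN). apply zeros_lt. lia.
- exfalso.
  assert (HB : forall n, (1 <= n)%nat -> (z (Z.of_nat n) <= B)%R).
  { intros n Hn. apply Rnot_lt_le. intros h. apply H. now exists n. }
  set (U := fun n => z (Z.of_nat (S n))).
  assert (HU : Un_growing U).
  { intros n. left. apply zeros_lt. lia. }
  assert (Hub : has_ub U).
  { exists B. intros x [n ->]. apply HB. lia. }
  destruct (growing_cv U HU Hub) as [L HL].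
  assert (HUL : forall n, (U n <= L)%R) by (intros n; now apply growing_ineq).
  assert (Hc : continuity_pt (bd q) L).
  { apply derivable_continuous_pt. exists (bdd q L). apply is_derive_Reals, bd_derive. }
  assert (HbL : bd q L = 0%R).
  { apply (UL_sequence (fun n => bd q (U n))).
    - now apply continuity_seq.
    - intros eps He. exists O. intros n _. unfold U. rewrite zeros_bd by lia.
      unfold Rdist. rewrite Rminus_0_r, Rabs_R0. exact He. }
  assert (HLp : (0 < L)%R).
  { apply Rlt_le_trans with (2 := HUL O). apply z_pos. lia. }
  destruct (bd_zeros L HLp HbL) as [n [Hn ->]].
  pose proof (HUL n) as h1. pose proof (zeros_lt n (S n) ltac:(lia)) as h2. unfold U in h1. lra.
Qed.

Lemma dJ_zero_cases w : D w = 0 ->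
  w = 0 \/ exists n, (1 <= n)%nat /\ (w = z (Z.of_nat n) \/ w = z (- Z.of_nat n)%Z).
Proof.
intros H.
assert (Hi : Im w = 0%R).
{ destruct (Req_dec (Im w) 0) as [h|h]; [easy|]. now apply (dJ_neq0_nonreal q) in h. }
assert (Ew : w = RtoC (Re w)) by (apply C_eq_Re_Im; easy).
rewrite Ew in H |- *. set (x := Re w) in *. clearbody x. clear Ew Hi w.
destruct (Rtotal_order x 0) as [hx|[->|hx]].
- right. destruct (Bessel_parity q) as [s [_ Hs]]. destruct (Hs x) as [_ [h _]]. fold D in h.
  rewrite H in h. rewrite Cmult_0_r in h. rewrite <- RtoC_opp in h.
  destruct (bd_zeros (- x)) as [n [Hn E]].
  + lra.
  + unfold bd. fold D. now rewrite h.
  + exists n. split; [easy|]. right. rewrite z_neg by lia. rewrite <- E. f_equal. ring.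
- now left.
- right. destruct (bd_zeros x hx) as [n [Hn E]].
  + unfold bd. fold D. now rewrite H.
  + exists n. split; [easy|]. left. now rewrite E.
Qed.

Lemma zeros_neg n : (1 <= n)%nat -> RtoC (z (- Z.of_nat n)%Z) = - RtoC (z (Z.of_nat n)).
Proof. intros Hn. rewrite z_neg by lia. apply RtoC_opp. Qed.

Lemma zeros_simple n : (1 <= n)%nat ->
  (D (z (Z.of_nat n)) = 0 /\ DD (z (Z.of_nat n)) <> 0) /\
  (D (z (- Z.of_nat n)%Z) = 0 /\ DD (z (- Z.of_nat n)%Z) <> 0).
Proof.
intros Hn. pose proof (z_pos (Z.of_nat n) ltac:(lia)) as hp. pose proof (zeros_bd n Hn) as hb.
assert (h1 : D (z (Z.of_nat n)) = 0) by (unfold D; rewrite bd_RtoC, hb; easy).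
assert (h2 : DD (z (Z.of_nat n)) <> 0).
{ intros h. apply (ddJ_neq0_real q _ hp hb). unfold bdd. fold DD. now rewrite h. }
split; [easy|]. rewrite zeros_neg by easy.
destruct (Bessel_parity q) as [s [Hs H]]. destruct (H (z (Z.of_nat n))) as [_ [k1 k2]].
fold D in k1. fold DD in k2. split.
- rewrite k1, h1. ring.
- rewrite k2. apply Cmult_neq_0; [|easy].
  destruct Hs as [->| ->]; intros h; [apply RtoC_inj in h; lra|].
  rewrite <- RtoC_opp in h. apply RtoC_inj in h. lra.
Qed.

(** The origin is kept abstract: [S0] holds at most the point 0 and [PP0] is the principal part
    there. One argument then serves both numerators and all orders. *)
Variables (num : C -> C) (S0 : C -> Prop) (PP0 : C -> C).
Hypothesis Hnum : entire num.
Hypothesis HS0 : forall p, S0 p -> p = 0.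
Hypothesis Hred0 : reduced num D S0 PP0.
Hypothesis HD0 : D 0 = 0 -> S0 0.
Hypothesis HS0D : forall p, S0 p -> D p = 0.
Hypothesis HPP0 : forall X w, (0 < X)%R -> in_square X w -> D w <> 0 -> null_part X w PP0.

Let res (k : Z) := num (z k) / DD (z k).

Definition pair_term (w : C) (k : nat) : C :=
  res (Z.of_nat k) / (w - z (Z.of_nat k)) + res (- Z.of_nat k)%Z / (w - z (- Z.of_nat k)%Z).

Let SN (N : nat) (p : C) : Prop :=
  S0 p \/ exists k, (1 <= k <= N)%nat /\ (p = z (Z.of_nat k) \/ p = z (- Z.of_nat k)%Z).

Let PPN (N : nat) (w : C) : C := PP0 w + sum_n_m (pair_term w) 1 N.

(** Zeros are removed in pairs [z N], [- z N], by two uses of [reduced_pole], which produces the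
    symmetric partial sums of [is_bisum]. *)
Let reduced_N N : reduced num D (SN N) (PPN N).
Proof.
induction N as [|N IH].
- refine (reduced_ext _ _ _ _ _ _ _ _ Hred0).
  + intros p. unfold SN. split; [now left|]. intros [h|[k [Hk _]]]; [easy | lia].
  + intros w. unfold PPN. rewrite sum_n_m_zero by lia. symmetry. apply (plus_zero_r (G := C_AbelianMonoid)).
- set (p := RtoC (z (Z.of_nat (S N)))). set (p' := RtoC (z (- Z.of_nat (S N))%Z)).
  destruct (zeros_simple (S N) ltac:(lia)) as [[h1 h2] [h3 h4]]. fold p in h1, h2. fold p' in h3, h4.
  assert (hp : (0 < z (Z.of_nat (S N)))%R) by (apply z_pos; lia).
  assert (hp' : p' = - p) by (apply zeros_neg; lia).
  assert (Hn1 : ~ SN N p).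
  { intros [h|[k [Hk [h|h]]]].
    - apply HS0 in h. apply RtoC_inj in h. lra.
    - apply RtoC_inj in h. pose proof (zeros_lt k (S N) ltac:(lia)). lra.
    - apply RtoC_inj in h. rewrite z_neg in h by lia. pose proof (z_pos (Z.of_nat k) ltac:(lia)). lra. }
  assert (Hn2 : ~ (SN N p' \/ p' = p)).
  { rewrite hp'. unfold p. rewrite <- RtoC_opp. intros [[h|[k [Hk [h|h]]]]|h].
    - apply HS0 in h. apply RtoC_inj in h. lra.
    - apply RtoC_inj in h. pose proof (z_pos (Z.of_nat k) ltac:(lia)). lra.
    - apply RtoC_inj in h. rewrite z_neg in h by lia. pose proof (zeros_lt k (S N) ltac:(lia)). lra.
    - apply RtoC_inj in h. lra. }
  pose proof (reduced_pole num D (DD p) (SN N) (PPN N) p (dJ_Cder _ _) h1 h2 Hn1 IH) as R1.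
  pose proof (reduced_pole num D (DD p') _ _ p' (dJ_Cder _ _) h3 h4 Hn2 R1) as R2.
  refine (reduced_ext _ _ _ _ _ _ _ _ R2).
  + intros w. unfold SN. split.
    * intros [[[h|[k [Hk h]]]|h]|h].
      -- now left.
      -- right. exists k. split; [lia | easy].
      -- right. exists (S N). split; [lia | now left].
      -- right. exists (S N). split; [lia | now right].
    * intros [h|[k [Hk h]]]; [now left; left; left|].
      destruct (Nat.eq_dec k (S N)) as [->|ne].
      -- destruct h as [h|h]; [now left; right | now right].
      -- left; left; right. exists k. split; [lia | easy].
  + intros w. unfold PPN. rewrite (sum_n_Sm (G := C_AbelianMonoid)) by lia.
    unfold pair_term at 3. fold p p'. unfold res. fold p p'.
    match goal with |- _ = _ + plus ?a ?b => change (plus a b) with (a + b) end. ring.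
Qed.

Lemma partial_fraction_contour N X w :
  (1 <= N)%nat -> (z (Z.of_nat N) < X < z (Z.of_nat (S N)))%R -> in_square X w -> D w <> 0 ->
  contour X (fun s => num s / D s * / (s - w)) =
  (num w / D w - (PP0 w + sum_n_m (pair_term w) 1 N)) * kappa.
Proof.
intros HN HX Hw HDw.
assert (hX0 : (0 < X)%R) by (pose proof (z_pos (Z.of_nat N) ltac:(lia)); lra).
assert (HSN : forall p, SN N p -> D p = 0 /\ in_square X p).
{ intros p [h|[k [Hk h]]].
  - split; [now apply HS0D|]. rewrite (HS0 p h). now apply in_square_0.
  - destruct (zeros_simple k ltac:(lia)) as [[e1 _] [e2 _]].
    pose proof (z_pos (Z.of_nat k) ltac:(lia)) as hp.
    assert (hk : (z (Z.of_nat k) < X)%R).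
    { destruct (Nat.eq_dec k N) as [->|ne]; [lra|]. pose proof (zeros_lt k N ltac:(lia)). lra. }
    destruct h as [->| ->].
    + split; [easy|]. split; simpl; [rewrite Rabs_pos_eq; lra | rewrite Rabs_R0; lra].
    + split; [easy|]. rewrite z_neg by lia. split; simpl.
      * rewrite Rabs_Ropp, Rabs_pos_eq; lra.
      * rewrite Rabs_R0; lra. }
assert (Hnull : null_part X w (PPN N)).
{ apply (null_part_plus X w PP0 (fun w => sum_n_m (pair_term w) 1 N) hX0 Hw); [now apply HPP0|].
  apply (null_part_sum X w (fun k s => pair_term s k) N hX0 Hw).
  intros k Hk.
  destruct (HSN (z (Z.of_nat k))) as [a1 a2]. { right. exists k. split; [easy | now left]. }
  destruct (HSN (z (- Z.of_nat k)%Z)) as [b1 b2]. { right. exists k. split; [easy | now right]. }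
  apply null_part_plus; [easy|easy| |]; apply null_part_pole; try easy; intros e; apply HDw; now rewrite <- e. }
destruct Hnull as [Hc H0].
(* The next zero [z (N + 1)] serves as outer radius: the open square it bounds contains no zeros of
   [J'] beyond those already removed. *)
refine (reduced_Cauchy num D (SN N) (PPN N) X (z (Z.of_nat (S N))) w (reduced_N N) Hnum (dJ_entire _) _ Hw _ HDw _ _ Hc H0).
- lra.
- intros h. apply HDw. now apply HSN.
- clear H0. intros s Hs HDs. destruct (dJ_zero_cases s HDs) as [->|[n [Hn h]]].
  + left. now apply HD0.
  + right. exists n. split; [|easy].
    assert (hn : (z (Z.of_nat n) < z (Z.of_nat (S N)))%R).
    { destruct Hs as [Hs _]. destruct h as [->| ->]; simpl in Hs.
      - apply Rle_lt_trans with (2 := Hs). apply Rle_abs.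
      - rewrite z_neg, Rabs_Ropp in Hs by lia. apply Rle_lt_trans with (2 := Hs). apply Rle_abs. }
    destruct (le_lt_dec n N) as [h'|h']; [lia|]. exfalso.
    destruct (Nat.eq_dec n (S N)) as [->|ne]; [lra|]. pose proof (zeros_lt (S N) n ltac:(lia)). lra.
- intros p Hp. now apply HSN.
Qed.

End Zeros.

(** * Principal parts at the origin *)

Lemma Csum_at_0 c l : Csum (fun n => c n * 0 ^ n) l -> l = c O.
Proof.
intros H. apply (Csum_unique _ _ _ H). eapply Csum_eq.
- apply Csum_unshift. apply (Csum_ext (fun _ => RtoC 0)); [|apply Csum_zero].
  intros n. simpl. ring.
- simpl. ring.
Qed.

(** Empty precisely for [q = 1], where [J'(0) = 1/2]. Otherwise 0 is a zero of [J'], simple for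
    [q = 0] and of order [q - 1] for [q >= 2]. *)
Definition origin_pole (q : nat) (p : C) : Prop := p = 0 /\ dJ (Z.of_nat q) 0 = 0.

Lemma dJ_1_at_0 : dJ (Z.of_nat 1) 0 <> 0.
Proof.
destruct (dJ_zero_order 0) as [g [_ [Hg E]]]. rewrite E. simpl. now rewrite Cmult_1_l.
Qed.

Lemma dJ_SS_at_0 m : dJ (Z.of_nat (S (S m))) 0 = 0.
Proof. destruct (dJ_zero_order (S m)) as [g [_ [_ E]]]. rewrite E. simpl. ring. Qed.

(** Both numerators take the value 1 at 0 when [q = 0], so they share the principal part
    [- 2 / w]. *)
Lemma reduced_origin_0 n : entire n -> n 0 = 1 ->
  reduced n (dJ (Z.of_nat 0)) (origin_pole 0) (fun w => - (2 / w)).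
Proof.
intros Hn Hn0. destruct Bessel0_at_0 as [_ [h1 h2]].
assert (h3 : ddJ (Z.of_nat 0) 0 <> 0).
{ simpl. rewrite h2. intros h. apply (f_equal (Cmult (- (2)))) in h.
  replace (- (2) * - / 2) with (RtoC 1) in h by field. rewrite Cmult_0_r in h. apply RtoC_inj in h. lra. }
refine (reduced_ext _ _ _ _ _ _ _ _
  (reduced_pole n _ _ _ _ 0 (dJ_Cder _ 0) h1 h3 (fun h => h) (reduced_nil n _ Hn (dJ_entire _)))).
- intros p. unfold origin_pole. simpl. tauto.
- intros p. simpl. rewrite Hn0, h2. replace (p - 0) with p by ring. unfold Cdiv.
  replace (/ - / 2) with (- (2)) by (field; intros h; apply RtoC_inj in h; lra). ring.
Qed.

Lemma reduced_origin_1 n : entire n -> reduced n (dJ (Z.of_nat 1)) (origin_pole 1) (fun w => 0).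
Proof.
intros Hn. refine (reduced_ext _ _ _ _ _ _ _ _ (reduced_nil n _ Hn (dJ_entire _))); [|easy].
intros p. unfold origin_pole. split; [easy|]. intros [_ h]. now apply dJ_1_at_0.
Qed.

(** For [q >= 2], [J = z^q h] and [J' = z^(q-1) g]: the quotient is [z h / g], regular at 0, so
    nothing has to be subtracted there. *)
Lemma reduced_num q : reduced (BesselJ (Z.of_nat q)) (dJ (Z.of_nat q)) (origin_pole q) (A0_num q).
Proof.
destruct q as [|[|m]].
- apply reduced_origin_0; [apply BesselJ_entire | apply Bessel0_at_0].
- apply reduced_origin_1, BesselJ_entire.
- destruct (dJ_zero_order (S m)) as [g [Hg [Hg0 E]]].
  destruct (BesselJ_zero_order (S (S m))) as [h [Hh [_ Eh]]].
  exists g, (fun z => z * h z), (fun z => z ^ S m). split; [easy|]. split; [now apply entire_mul_id|]. split.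
  { intros z. apply entire_cont. apply (entire_ext (fun z => z ^ S m * 1)); [intros; ring|].
    apply entire_mul_pow, entire_const. }
  split; [easy|]. split.
  + intros z Hz. split.
    * apply Cpow_nz. intros ->. apply Hz. split; [easy | apply dJ_SS_at_0].
    * rewrite Eh. simpl. ring.
  + now intros z [-> _].
Qed.

Lemma A0_den_lsum m g gc : fast_decay gc -> gc O <> 0 -> (forall z, Csum (fun n => gc n * z ^ n) (g z)) ->
  (forall z, dJ (Z.of_nat (S (S m))) z = z ^ S m * g z) ->
  forall z : C, z <> 0 -> A0_den (S (S m)) z = lsum (recip gc) (S m) z.
Proof.
intros Hgc Hgc0 Hg E z Hz. rewrite lsum_sum_n_m by easy.
unfold A0_den. replace (S (S m) - 1)%nat with (S m) by lia.
apply (sum_n_m_ext_loc (G := C_AbelianMonoid)). intros k Hk.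
destruct k as [|k]; [lia|]. f_equal.
rewrite (laurent0_coef_eq _ _ k (laurent0_recip _ g gc (S m) Hgc Hgc0 Hg E)).
rewrite (proj2 (Z.ltb_ge _ _)) by lia. f_equal. lia.
Qed.

(** For [q >= 2], long division of 1 by [g] stopped after [q - 1] steps is the required
    decomposition: the quotient is [z^(q-1)] times the principal part, the remainder is [z^(q-1)]
    times an entire function. *)
Lemma reduced_den q : reduced (fun _ => 1) (dJ (Z.of_nat q)) (origin_pole q) (A0_den q).
Proof.
destruct q as [|[|m]].
- apply reduced_origin_0; [apply entire_const | easy].
- apply reduced_origin_1, entire_const.
- destruct (dJ_zero_order (S m)) as [g [Hg [Hg0 E]]].
  destruct Hg as [gc [Hgc Hgs]].
  assert (Hgc0 : gc O <> 0) by now rewrite <- (Csum_at_0 gc _ (Hgs 0)).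
  exists g, (remf gc (S m)), (fun z => z ^ S m). split; [now exists gc|].
  split; [now apply remf_entire|]. split.
  { intros z. apply entire_cont. apply (entire_ext (fun z => z ^ S m * 1)); [intros; ring|].
    apply entire_mul_pow, entire_const. }
  split; [easy|]. split.
  + intros z Hz.
    assert (hz : z <> 0). { intros ->. apply Hz. split; [easy | apply dJ_SS_at_0]. }
    split; [now apply Cpow_nz|].
    rewrite (A0_den_lsum m g gc Hgc Hgc0 Hgs E z hz), E.
    replace (z ^ S m * g z * lsum (recip gc) (S m) z) with (g z * (z ^ S m * lsum (recip gc) (S m) z)) by ring.
    rewrite lsum_psum by easy. now apply recip_remainder.
  + now intros z [-> _].
Qed.

Lemma null_part_origin_0 X w : (0 < X)%R -> in_square X w -> dJ (Z.of_nat 0) w <> 0 ->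
  null_part X w (fun w => - (2 / w)).
Proof.
intros HX Hw HD. apply (null_part_ext X w (fun w => - (2) / (w - 0))).
- intros p. replace (p - 0) with p by ring. unfold Cdiv. ring.
- apply null_part_pole; try easy; [now apply in_square_0|]. intros <-. apply HD. apply Bessel0_at_0.
Qed.

Lemma null_part_num q X w : (0 < X)%R -> in_square X w -> dJ (Z.of_nat q) w <> 0 ->
  null_part X w (A0_num q).
Proof.
intros HX Hw HD. destruct q as [|q]; [now apply null_part_origin_0 | now apply null_part_zero].
Qed.

Lemma null_part_den q X w : (0 < X)%R -> in_square X w -> dJ (Z.of_nat q) w <> 0 ->
  null_part X w (A0_den q).
Proof.
intros HX Hw HD. destruct q as [|[|m]]; [now apply null_part_origin_0 | now apply null_part_zero|].
unfold A0_den. apply null_part_sum; [easy|easy|].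
intros k Hk. destruct k as [|k]; [lia|]. apply null_part_pow; try easy.
intros ->. apply HD, dJ_SS_at_0.
Qed.

Lemma eventually_small (K eps : R) : (0 < eps)%R ->
  exists B, forall X, (B < X)%R -> (K / sqrt X < eps)%R /\ (K / X < eps)%R.
Proof.
intros He. set (y := (Rabs K / eps)%R).
assert (Hy : (0 <= y)%R) by (apply Rmult_le_pos; [apply Rabs_pos | left; now apply Rinv_0_lt_compat]).
exists (1 + y * y)%R. intros X HX.
assert (hX : (0 < X)%R) by nra.
assert (h1 : (y < sqrt X)%R).
{ rewrite <- (sqrt_square y) by easy. apply sqrt_lt_1_alt. nra. }
assert (h2 : (sqrt X <= X)%R).
{ rewrite <- (sqrt_square X) at 2 by lra. apply sqrt_le_1_alt. nra. }
pose proof (Rle_abs K) as hK.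
assert (hy : (y * eps = Rabs K)%R) by (unfold y; field; lra).
split; apply Rlt_div_l; try lra; nra.
Qed.

Section Expansions.
Variables (q : nat) (z : Z -> R).
Hypothesis z_pos : forall k : Z, (1 <= k)%Z -> (0 < z k)%R.
Hypothesis z_incr : forall k : Z, (1 <= k)%Z -> (z k < z (k + 1)%Z)%R.
Hypothesis z_zeros : forall x : R, (0 < x)%R ->
  (dJ (Z.of_nat q) (RtoC x) = RtoC 0 <-> exists k : Z, (1 <= k)%Z /\ z k = x).
Hypothesis z_neg : forall k : Z, (1 <= k)%Z -> z (- k)%Z = (- z k)%R.
Variable w : C.
Hypothesis Hw : dJ (Z.of_nat q) w <> 0.

Let J := BesselJ (Z.of_nat q).
Let D := dJ (Z.of_nat q).

Let squares B : exists N0, forall N, (N0 <= N)%nat -> exists X,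
  (1 <= N)%nat /\ (z (Z.of_nat N) < X < z (Z.of_nat (S N)))%R /\ bj q X = 0%R /\ (B < X)%R /\ (Cmod w < X)%R.
Proof.
destruct (zeros_unbounded q z z_pos z_incr z_zeros (Rmax B (Cmod w))) as [N0 HN0].
exists (S N0). intros N HN.
destruct (bj_zero_between q (z (Z.of_nat N)) (z (Z.of_nat (S N)))) as [X [HX HJ]].
- split; [apply z_pos; lia|]. apply zeros_lt; [easy | lia].
- apply (zeros_bd q z z_pos z_zeros). lia.
- apply (zeros_bd q z z_pos z_zeros). lia.
- exists X. specialize (HN0 N ltac:(lia)).
  pose proof (Rmax_l B (Cmod w)). pose proof (Rmax_r B (Cmod w)). repeat split; try easy; lra || lia.
Qed.

Let in_square_Cmod X p : (Cmod p < X)%R -> in_square X p.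
Proof. intros h. apply in_square_supnorm. pose proof (supnorm_le_Cmod p). lra. Qed.

Let pf num PP0 (Hnum : entire num) (Hred : reduced num D (origin_pole q) PP0)
  (HPP0 : forall X w, (0 < X)%R -> in_square X w -> D w <> 0 -> null_part X w PP0) N X p :
  (1 <= N)%nat -> (z (Z.of_nat N) < X < z (Z.of_nat (S N)))%R -> (Cmod p < X)%R -> D p <> 0 ->
  contour X (fun s => num s / D s * / (s - p)) =
  (num p / D p - (PP0 p + sum_n_m (pair_term q z num p) 1 N)) * kappa.
Proof.
intros HN HX Hp HDp.
apply (partial_fraction_contour q z z_pos z_incr z_zeros z_neg num (origin_pole q) PP0 Hnum); try easy.
- now intros s [-> _].
- now intros s [-> h].
- now apply in_square_Cmod.
Qed.

(** The distance from a partial sum to its limit is the modulus of the contour integral divided by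
    that of [kappa]; each large [N] has its own square, through a zero of [J] between [z N] and
    [z (N + 1)]. *)
Lemma bisum_den :
  is_bisum (fun k => a_den (Z.of_nat q) (z k) / (w - z k)) (1 / D w - A0_den q w).
Proof.
apply (proj2 (filterlim_Cmod eventually _ _)). intros eps He.
destruct (contour_den_limit q w) as [K [X1 HK]].
assert (Hk := proj1 (Cmod_gt_0 _) kappa_neq0).
destruct (eventually_small K (eps * Cmod kappa)) as [B HB]; [now apply Rmult_lt_0_compat|].
destruct (squares (Rmax B X1)) as [N0 HN0]. exists N0. intros N HN.
destruct (HN0 N HN) as [X [HN1 [HX [HJ [HXB HXw]]]]].
pose proof (Rmax_l B X1). pose proof (Rmax_r B X1).
specialize (HK X ltac:(lra) HJ). destruct (HB X ltac:(lra)) as [h _].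
assert (P := pf (fun _ => 1) (A0_den q) (entire_const 1) (reduced_den q) (null_part_den q) N X w HN1 HX HXw Hw).
cbv beta in P. fold D in HK. rewrite P, Cmod_mult in HK. clear P.
apply (Rmult_lt_reg_r (Cmod kappa)); [easy|].
apply Rle_lt_trans with (2 := h). apply Rle_trans with (2 := HK). right. f_equal.
match goal with |- Cmod ?a = Cmod ?b => replace a with (- b); [apply Cmod_opp|] end.
change (sum_n_m (pair_term q z (fun _ => 1) w) 1 N) with
  (sum_n_m (fun k : nat => a_den (Z.of_nat q) (z (Z.of_nat k)) / (w - z (Z.of_nat k)) +
     a_den (Z.of_nat q) (z (- Z.of_nat k)%Z) / (w - z (- Z.of_nat k)%Z)) 1 N). ring.
Qed.

(** [J] and [J''] have the same parity, so the residues at [p] and [- p] agree, and replacing [w] by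
    [- w] exchanges the two fractions up to sign. *)
Let pair_term_odd k : (1 <= k)%nat -> pair_term q z J (- w) k = - pair_term q z J w k.
Proof.
intros Hk. unfold pair_term. rewrite (zeros_neg z z_neg k Hk).
destruct (zeros_simple q z z_pos z_zeros z_neg k Hk) as [[h1 h2] [h3 _]].
rewrite (zeros_neg z z_neg k Hk) in h3.
set (p := RtoC (z (Z.of_nat k))) in *.
destruct (Bessel_parity q) as [s [Hs H]]. destruct (H p) as [e1 [_ e2]]. fold J in e1. rewrite e1, e2.
assert (n1 : w - p <> 0).
{ intros e. apply Hw. replace w with (w - p + p) by ring. rewrite e, Cplus_0_l. exact h1. }
assert (n2 : w + p <> 0).
{ intros e. apply Hw. replace w with (w + p + - p) by ring. rewrite e, Cplus_0_l. exact h3. }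
assert (n3 : s <> 0).
{ destruct Hs as [->| ->]; intros h; [apply RtoC_inj in h; lra|].
  rewrite <- RtoC_opp in h. apply RtoC_inj in h. lra. }
assert (n4 : - w - p <> 0).
{ intros e. apply n2. replace (w + p) with (- (- w - p)) by ring. rewrite e. ring. }
assert (n5 : - w - - p <> 0).
{ intros e. apply n1. replace (w - p) with (- (- w - - p)) by ring. rewrite e. ring. }
assert (n6 : w - - p <> 0) by now replace (w - - p) with (w + p) by ring.
field. repeat split; easy.
Qed.

Lemma bisum_num :
  is_bisum (fun k => a_num (Z.of_nat q) (z k) / (w - z k)) (J w / D w - A0_num q w).
Proof.
apply (proj2 (filterlim_Cmod eventually _ _)). intros eps He.
destruct (contour_num_limit q w) as [K [X1 HK]].
assert (Hk := proj1 (Cmod_gt_0 _) kappa_neq0).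
(* The quotient, its part at the origin and its partial sums are all odd in [w], so subtracting the
   formula at [- w] doubles the error to be bounded. *)
destruct (eventually_small K (2 * (eps * Cmod kappa))) as [B HB].
{ pose proof (Rmult_lt_0_compat _ _ He Hk). lra. }
destruct (squares (Rmax B X1)) as [N0 HN0]. exists N0. intros N HN.
destruct (HN0 N HN) as [X [HN1 [HX [HJ [HXB HXw]]]]].
pose proof (Rmax_l B X1). pose proof (Rmax_r B X1).
specialize (HK X ltac:(lra) HJ). destruct (HB X ltac:(lra)) as [_ h].
destruct (Bessel_parity q) as [s [Hs Hpar]]. destruct (Hpar w) as [e1 [e2 _]]. fold J in e1. fold D in e2.
assert (n3 : s <> 0).
{ destruct Hs as [->| ->]; intros h'; [apply RtoC_inj in h'; lra|].
  rewrite <- RtoC_opp in h'. apply RtoC_inj in h'. lra. }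
assert (n3' : - s <> 0). { intros e. apply n3. replace s with (- - s) by ring. rewrite e. ring. }
assert (Hw' : D (- w) <> 0) by (rewrite e2; now apply Cmult_neq_0).
assert (HXw' : (Cmod (- w) < X)%R) by now rewrite Cmod_opp.
assert (Hred := reduced_num q). fold J in Hred.
assert (P := pf J (A0_num q) (BesselJ_entire _) Hred (null_part_num q) N X w HN1 HX HXw Hw).
assert (P' := pf J (A0_num q) (BesselJ_entire _) Hred (null_part_num q) N X (- w) HN1 HX HXw' Hw').
fold J D in HK. rewrite P, P' in HK. clear P P'.
assert (E1 : J (- w) / D (- w) = - (J w / D w)) by (rewrite e1, e2; field; easy).
assert (E2 : A0_num q (- w) = - A0_num q w).
{ destruct q as [|q']; simpl; [|ring].
  assert (hw0 : w <> 0). { intros ->. apply Hw. apply Bessel0_at_0. }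
  assert (hw1 : - w <> 0). { intros e. apply hw0. replace w with (- - w) by ring. rewrite e. ring. }
  field. easy. }
assert (E3 : sum_n_m (pair_term q z J (- w)) 1 N = - sum_n_m (pair_term q z J w) 1 N).
{ clear - pair_term_odd. induction N as [|N IH].
  - rewrite !sum_n_m_zero by lia. change (RtoC 0 = - RtoC 0). ring.
  - rewrite !(sum_n_Sm (G := C_AbelianMonoid)) by lia. rewrite IH, pair_term_odd by lia.
    change (- sum_n_m (pair_term q z J w) 1 N + - pair_term q z J w (S N) =
      - (sum_n_m (pair_term q z J w) 1 N + pair_term q z J w (S N))). ring. }
rewrite E1, E2, E3 in HK.
set (SN := sum_n_m (pair_term q z J w) 1 N) in *.
change (Cmod (SN - (J w / D w - A0_num q w)) < eps)%R.
replace ((J w / D w - (A0_num q w + SN)) * kappa - (- (J w / D w) - (- A0_num q w + - SN)) * kappa) with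
  (2 * (- (SN - (J w / D w - A0_num q w))) * kappa) in HK by ring.
rewrite !Cmod_mult, Cmod_opp, Cmod_R, Rabs_pos_eq in HK by lra.
apply (Rmult_lt_reg_r (Cmod kappa)); [easy|]. lra.
Qed.

End Expansions.

Theorem mainTheorem7 (q : nat) (z : Z -> R)
  (z_pos : forall k : Z, (1 <= k)%Z -> (0 < z k)%R)
  (z_incr : forall k : Z, (1 <= k)%Z -> (z k < z (k + 1)%Z)%R)
  (z_zeros : forall x : R, (0 < x)%R ->
     (dJ (Z.of_nat q) (RtoC x) = RtoC 0 <-> exists k : Z, (1 <= k)%Z /\ z k = x))
  (z_neg : forall k : Z, (1 <= k)%Z -> z (- k)%Z = (- z k)%R) :
  let Q := Z.of_nat q in
  let zeta (k : Z) := RtoC (z k) in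
  let D (k : Z) :=
    (BesselJ (Q - 2) (zeta k) - 2 * BesselJ Q (zeta k)
     + BesselJ (Q + 2) (zeta k))%C in
  (forall k : Z, k <> 0%Z ->
     ddJ Q (zeta k) <> RtoC 0 /\
     a_num Q (zeta k) = (4 * BesselJ Q (zeta k) / D k)%C /\
     a_den Q (zeta k) = (4 / D k)%C) /\
  (forall w : C, dJ Q w <> RtoC 0 ->
     exists Snum Sden : C,
       is_bisum (fun k => a_num Q (zeta k) / (w - zeta k))%C Snum /\
       is_bisum (fun k => a_den Q (zeta k) / (w - zeta k))%C Sden /\
       (A0_den q w + Sden)%C <> RtoC 0 /\
       BesselJ Q w = ((A0_num q w + Snum) / (A0_den q w + Sden))%C).
Proof.
intros Q zeta D. split.
- intros k Hk.
  assert (Hdd : ddJ Q (zeta k) <> RtoC 0).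
  { destruct (Z.lt_ge_cases k 0) as [h|h].
    - replace k with (- Z.of_nat (Z.to_nat (- k)))%Z by lia.
      exact (proj2 (proj2 (zeros_simple q z z_pos z_zeros z_neg (Z.to_nat (- k)) ltac:(lia)))).
    - replace k with (Z.of_nat (Z.to_nat k)) by lia.
      exact (proj2 (proj1 (zeros_simple q z z_pos z_zeros z_neg (Z.to_nat k) ltac:(lia)))). }
  assert (E : ddJ Q (zeta k) = D k / 4) by apply ddJ_BesselJ.
  assert (HD : D k <> 0).
  { intros h. apply Hdd. rewrite E, h. unfold Cdiv. ring. }
  split; [easy|]. unfold a_num, a_den. rewrite E. split; field; easy.
(* With these sums the numerator is [J / J'] and the denominator [1 / J'] at [w]; the latter is
   nonzero and the ratio is [J]. *)
- intros w Hw. exists (BesselJ Q w / dJ Q w - A0_num q w), (1 / dJ Q w - A0_den q w).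
  split; [now apply bisum_num|]. split; [now apply bisum_den|].
  replace (A0_den q w + (1 / dJ Q w - A0_den q w)) with (1 / dJ Q w) by ring.
  replace (A0_num q w + (BesselJ Q w / dJ Q w - A0_num q w)) with (BesselJ Q w / dJ Q w) by ring.
  pose proof C1_neq0 as h1.
  split.
  + intros h. apply h1. replace (RtoC 1) with (1 / dJ Q w * dJ Q w) by (field; easy). rewrite h. ring.
  + field. easy.
Qed.
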